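(* Let $a>1$, $E=\{1,2,\dots\}$ and $T_e(\epsilon,x)=\big(\frac1{5^e}+\frac1{a^e}\epsilon\big)x+b(e)$ for $e\in E$, $\epsilon\ge0$ small, where the numbers $b(e)$ are chosen as described in the context. Let $s(\epsilon)=\dim_HK(\epsilon)$ be the Hausdorff dimension of the limit set; $s(0)=\log2/\log5$. (1) If $a\ge5$, then for any $n\ge0$, $s(\epsilon)$ has the $n$-order asymptotic expansion $s(\epsilon)=\log2/\log5+s_1\epsilon+\cdots+s_n\epsilon^n+\tilde s_n(\epsilon)\epsilon^n$ with $\tilde s_n(\epsilon)\to0$ as $\epsilon\to0$. Each coefficient $s_k$ ($k=1,\dots,n$) is determined by $$s_k=\frac1{2\log5}\sum_{\substack{0\le v\le k,\ 0\le q\le k-v\\(v,q)\ne(0,1)}}\ \sum_{j=0}^{\min(v,q)}s_{q,k-v}\frac{a_{v,j,s(0)}}{(q-j)!}(-\log5)^{q-j}\sum_{e=1}^\infty e^{q-j}\Big(\frac{5^v}{2a^v}\Big)^e.\qquad( * )$$ (2) If $1<a<5$, let $k\ge0$ be the smallest integer satisfying $a\le5/2^{1/(k+1)}$. Then $s(\epsilon)$ has the form $$s(\epsilon)=\begin{cases}s(0)+s_1\epsilon+\cdots+s_k\epsilon^k+\hat s(\epsilon)\epsilon^{\frac{\log2}{\log(5/a)}},&a<5/2^{1/(k+1)},\\ s(0)+s_1\epsilon+\cdots+s_k\epsilon^k+\hat s(\epsilon)\epsilon^{k+1}\log\epsilon,&a=5/2^{1/(k+1)},\end{cases}$$ with $|\hat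 s(\epsilon)|\asymp1$ as $\epsilon\to0$, where $s_1,\dots,s_k$ are given by $( * )$. (Note that $k<\log2/\log(5/a)\le k+1$.)
   Context: The system is an infinite linear iterated function system on $J=[0,1]$ (with $O=(-\eta,1+\eta)$ for a small $\eta>0$). The numbers $b(e)$ (independent of $\epsilon$) are chosen so that for all small $\epsilon\ge0$ it is a conformal iterated function system satisfying the open set condition: each $T_e(\epsilon,\cdot)$ maps $(0,1)$ into $(0,1)$ and $O$ into $O$, and the sets $T_e(\epsilon,(0,1))$, $e\in E$, are pairwise disjoint. The limit set is $K(\epsilon)=\pi(\epsilon,E^{\mathbb N})$, where $\pi(\epsilon,\omega)$ is the unique point of $\bigcap_{m\ge0}T_{\omega_0}(\epsilon,\cdot)\circ\cdots\circ T_{\omega_m}(\epsilon,\cdot)([0,1])$. The numbers $s_{q,i}$ are the coefficients of the formal power $(s_1\epsilon+s_2\epsilon^2+\cdots)^q=\sum_is_{q,i}\epsilon^i$; thus $s_{0,0}=1$, $s_{0,i}=0$ for $i\ge1$, $s_{q,i}=0$ for $q\ge 1$, $i<q$, $s_{1,i}=s_i$ for $i\ge1$, and for $q\ge2$, $i\ge q$, $s_{q,i}=\sum\frac{q!}{j_1!\cdots j_{i-1}!}s_1^{j_1}\cdots s_{i-1}^{j_{i-1}}$ over $j_1,\dots,j_{i-1}\ge0$ with $j_1+\cdots+j_{i-1}=q$ and $j_1+2j_2+\cdots+(i-1)j_{i-1}=i$. The numbers $a_{l,j,s}$ are defined by $\binom pl=\sum_{j=0}^la_{l,j,s}(p-s)^j$,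 i.e. $a_{l,0,s}=\binom sl$; $a_{l,j,s}=\frac1{l!}\sum_{0\le i_1<\cdots<i_{l-j}\le l-1}\prod_{m=1}^{l-j}(s-i_m)$ for $l\ge1$, $0\le j<l$; $a_{l,l,s}=1/l!$; $a_{l,j,s}=0$ for $j>l$. $b(\epsilon)\asymp c(\epsilon)$ means that for some constant $d\ge1$, $d^{-1}c(\epsilon)\le b(\epsilon)\le d\,c(\epsilon)$ for all small $\epsilon>0$. *)

(* Defs.v *)
From HB Require Import structures.
From mathcomp Require Import all_boot all_order all_algebra.
From mathcomp Require Import all_classical all_reals all_analysis.
Set Implicit Arguments.
Unset Strict Implicit.
Unset Printing Implicit Defensive.
Import Order.TTheory GRing.Theory Num.Theory.
Import numFieldNormedType.Exports.
Local Open Scope classical_set_scope.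
Local Open Scope ring_scope.

Section HausdorffDimension.
Context {R : realType}.
Implicit Types (A U : set R) (s delta : R).

Definition diam U : \bar R :=
  maxe 0%E (ereal_sup [set `|p.1 - p.2|%:E | p in U `*` U]).

(* The empty set contributes 0 for every exponent, also for s = 0, where
   poweR 0 0 = 1 would be wrong. *)
Definition diam_pow s U : \bar R :=
  if `[< U = set0 >] then 0%E else poweR (diam U) s.

Definition hausdorff_premeasure s delta A : \bar R :=
  ereal_inf [set (\sum_(0 <= i <oo) diam_pow s (U i))%E |
    U in [set U : (set R)^nat |
           A `<=` \bigcup_i U i /\ forall i, (diam (U i) <= delta%:E)%E]].

Definition hausdorff_measure s A : \bar R :=
  ereal_sup [set hausdorff_premeasure s delta A | delta in [set d | 0 < d]].

(* For A in the line every s > 1 belongs to this set, so the real-valued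
   infimum is not a default value. *)
Definition hausdorff_dim A : R :=
  inf [set s | 0 <= s /\ hausdorff_measure s A = 0%E].

End HausdorffDimension.

Section LinearIFS.
Context {R : realType}.
Implicit Types (a eps eta : R) (b : nat -> R).

Definition alphabet : set nat := [set e | (0 < e)%N].

Definition T a b eps (e : nat) (x : R) : R :=
  ((5 ^+ e)^-1 + (a ^+ e)^-1 * eps) * x + b e.

Fixpoint cylinder_map (f : nat -> R -> R) (w : nat -> nat) (m : nat) : R -> R :=
  if m is m'.+1 then cylinder_map f w m' \o f (w m) else f (w 0%N).

(* [get] returns the point of the intersection, a singleton for the systems
   satisfying [ifs_osc] below. *)
Definition coding_map a b eps (w : nat -> nat) : R :=
  get (\bigcap_m (cylinder_map (T a b eps) w m @` `[0, 1])).

Definition limit_set a b eps : set R :=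
  coding_map a b eps @` [set w | forall i, alphabet (w i)].

Definition dim_limit_set a b eps : R := hausdorff_dim (limit_set a b eps).

(* Uniform contraction, bounded distortion and the cone condition of a
   conformal system are automatic for these affine maps and J = [0, 1]. *)
Definition ifs_osc a b : Prop :=
  exists2 eta : R, 0 < eta &
    \forall eps \near (0 : R), 0 <= eps ->
      [/\ forall e, alphabet e -> T a b eps e @` `]0, 1[ `<=` `]0, 1[,
          forall e, alphabet e ->
            T a b eps e @` `](- eta), (1 + eta)[ `<=` `](- eta), (1 + eta)[ &
          trivIset alphabet (fun e => T a b eps e @` `]0, 1[)].

End LinearIFS.

Section Coefficients.
Context {R : realType}.
Implicit Types (a s : R) (c : nat -> R).

(* Coefficient of eps^i in (c_1 eps + c_2 eps^2 + ...)^q; the terms of the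
   series of degree > i do not contribute to it. *)
Definition spow c (q i : nat) : R :=
  ((\sum_(1 <= j < i.+1) c j *: 'X^j : {poly R}) ^+ q)`_i.

Definition binomial_poly (l : nat) : {poly R} :=
  (l`!%:R)^-1 *: \prod_(i < l) ('X - (i%:R)%:P).

(* Coefficient of (p - s)^j in the expansion of binomial(p, l) around s. *)
Definition abinom (l j : nat) s : R := (binomial_poly l \Po ('X + s%:P))`_j.

Definition coef_rhs a (s0 : R) c (k : nat) : R :=
  (2 * ln 5)^-1 *
  \sum_(0 <= v < k.+1)
   \sum_(0 <= q < (k - v).+1 | (v, q) != (0%N, 1%N))
    \sum_(0 <= j < (minn v q).+1)
      spow c q (k - v) * (abinom v j s0 / ((q - j)`!)%:R) *
      (- ln 5) ^+ (q - j) *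
      \big[+%R/0]_(1 <= e <oo) (e%:R ^+ (q - j) * (5 ^+ v / (2 * a ^+ v)) ^+ e).

End Coefficients.

Section Asymptotics.
Context {R : realType}.

Definition asymp (f g : R -> R) : Prop :=
  exists2 d : R, 1 <= d &
    \forall eps \near 0^'+, d^-1 * g eps <= f eps <= d * g eps.

Definition threshold (k : nat) : R := 5 / 2 `^ (k.+1%:R^-1).

End Asymptotics.

(* Main.v *)
Require Import Defs.
From HB Require Import structures.
From mathcomp Require Import all_boot all_order all_algebra.
From mathcomp Require Import all_classical all_reals all_analysis.
From mathcomp Require Import ring lra zify.
Import Order.TTheory GRing.Theory Num.Theory.
Import numFieldNormedType.Exports.
Local Open Scope classical_set_scope.
Local Open Scope ring_scope.

(** Proof idea. The ratios r_e = 5^-e + a^-e eps sum their powers r_e^t to a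
    pressure P(t), and the dimension is the root of P = 1. Above the root, iterating
    K within the union of the f_e(K) gives covers of geometrically small weight.
    Below the root, finitely many words, all ending in a letter that avoids the
    endpoint 0, have P > 1 and images separated by a definite gap, and a greedy
    choice of cylinders produces a point outside any cover that is too light.

    Put theta = 5/a, s_0 = ln 2 / ln 5 and s = s_0 + u. The equation becomes
    1 = sum_e 2^-e 5^(-e u) (1 + theta^e eps)^s. Expanding the binomial to order k
    and the exponential to order k + 1 gives a polynomial in (eps, u), which the
    polynomial with the coefficients of the theorem solves up to O(eps^(k+1)),
    plus the binomial remainders. As the u-derivative at the origin is -2 ln 5, the
    error of the expansion is comparable to the sum of these remainders, up to
    O(eps^(k+1)). The remainders all have the sign of binom(s, k+1), and their sum
    is comparable to the sum of 2^-e (theta^e eps)^(k+1) over the e with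
    theta^e eps <= 1. For theta <= 1 it is O(eps^(k+1)), for theta^(k+1) > 2 it is
    of order eps^(ln 2 / ln theta), and for theta^(k+1) = 2 it is of order
    eps^(k+1) |ln eps|. *)

(** The root u is known a priori only to be small, not to be O(eps). Let w be the value of the
    polynomial of the theorem. The error u^(k+2) of the exponential expansion is split: if u >= 2
    |w| it is a small multiple of |u - w|, otherwise u = O(eps). The extra order in u keeps the
    linear term present and this error at least quadratic even for k = 0. The binomial remainders
    stay unexpanded because the moments of order v converge only when theta^v < 2. Their lower bound
    is a bootstrap. The letters up to the scale M, which is of order |ln eps|, carry factors 5^(-e
    u), and these are bounded below only if M u is bounded; that follows from the upper bound,
    obtained beforehand without it. The competing error O(eps^(k+1)) is beaten because the sum of
    the remainders is at least a constant times M eps^(k+1), and M tends to infinity as eps tends to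
    0. In the dimension bound, images of [0, 1] under different words may share an endpoint; only a
    final letter whose image stays off 0 creates a gap. *)

(** * Series over the letters e >= 1 *)

(** Convergence is part of the statement, whereas the limit notation in [coef_rhs] has a default
    value for a divergent series. *)
Definition sums {R : realType} (f : nat -> R) (l : R) : Prop :=
  (\sum_(1 <= e < n) f e) @[n --> \oo] --> l.

Lemma sums_lim {R : realType} (f : nat -> R) (l : R) :
  sums f l -> \big[+%R/0]_(1 <= e <oo) f e = l.
Proof. exact: cvg_lim. Qed.

Lemma sums_unique {R : realType} (f : nat -> R) (l l' : R) :
  sums f l -> sums f l' -> l = l'.
Proof. by move=> /sums_lim <- /sums_lim <-. Qed.

Lemma eq_sums {R : realType} (f g : nat -> R) (l : R) :
  (forall e, (0 < e)%N -> f e = g e) -> sums f l -> sums g l.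
Proof.
move=> fg; rewrite /sums.
suff -> : (fun n => \sum_(1 <= e < n) f e) = (fun n => \sum_(1 <= e < n) g e) by [].
by apply/funext => n; apply: eq_big_nat => e /andP[e0 _]; exact: fg.
Qed.

Lemma sumsD {R : realType} (f g : nat -> R) (l l' : R) :
  sums f l -> sums g l' -> sums (fun e => f e + g e) (l + l').
Proof.
move=> fl gl; rewrite /sums.
under eq_fun do rewrite big_split /=.
exact: cvgD.
Qed.

Lemma sumsZ {R : realType} (c : R) (f : nat -> R) (l : R) :
  sums f l -> sums (fun e => c * f e) (c * l).
Proof.
move=> fl; rewrite /sums.
under eq_fun do rewrite -mulr_sumr.
exact: cvgMr.
Qed.

Lemma sumsB {R : realType} (f g : nat -> R) (l l' : R) :
  sums f l -> sums g l' -> sums (fun e => f e - g e) (l - l').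
Proof.
move=> fl gl; rewrite -[- l']mulN1r.
apply: eq_sums (sumsD _ _ _ _ fl (sumsZ (-1) _ _ gl)) => e _.
by rewrite mulN1r.
Qed.

Lemma sums0 {R : realType} : sums (fun=> 0 : R) 0.
Proof.
rewrite /sums; under eq_fun do rewrite big1//.
exact: cvg_cst.
Qed.

Lemma sums_sum {R : realType} (I : Type) (r : seq I) (f : I -> nat -> R) (l : I -> R) :
  (forall i, sums (f i) (l i)) ->
  sums (fun e => \sum_(i <- r) f i e) (\sum_(i <- r) l i).
Proof.
move=> fl; elim: r => [|i r IH].
  by rewrite big_nil; apply: eq_sums sums0 => e _; rewrite big_nil.
rewrite big_cons; apply: eq_sums (sumsD _ _ _ _ (fl i) IH) => e _.
by rewrite big_cons.
Qed.

Lemma sums_le {R : realType} (f g : nat -> R) (l l' : R) :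
  (forall e, (0 < e)%N -> f e <= g e) -> sums f l -> sums g l' -> l <= l'.
Proof.
move=> fg fl gl; rewrite -(sums_lim _ _ fl) -(sums_lim _ _ gl).
apply: ler_lim; [by apply/cvg_ex; exists l|by apply/cvg_ex; exists l'|].
by apply: nearW => n; rewrite big_nat [leRHS]big_nat; apply: ler_sum => e /andP[+ _]; exact: fg.
Qed.

Lemma nat_partial_nd {R : realType} (f : nat -> R) :
  (forall e, (0 < e)%N -> 0 <= f e) ->
  nondecreasing_seq (fun n => \sum_(1 <= e < n) f e).
Proof.
move=> f0; apply/nondecreasing_seqP => -[|n]; first by rewrite !big_geq.
by rewrite [leRHS]big_nat_recr//= lerDl f0.
Qed.

Lemma sums_ge_partial {R : realType} (f : nat -> R) (l : R) (n : nat) :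
  (forall e, (0 < e)%N -> 0 <= f e) -> sums f l ->
  \sum_(1 <= e < n) f e <= l.
Proof.
move=> f0 fl; rewrite -(sums_lim _ _ fl).
apply: (nondecreasing_cvgn_le (nat_partial_nd _ f0)).
by apply/cvg_ex; exists l.
Qed.

Lemma sums_ge_term {R : realType} (f : nat -> R) (l : R) (n : nat) :
  (forall e, (0 < e)%N -> 0 <= f e) -> sums f l -> (0 < n)%N -> f n <= l.
Proof.
move=> f0 fl n0; apply: le_trans (sums_ge_partial _ _ n.+1 f0 fl).
by rewrite big_nat_recr//= lerDr big_nat sumr_ge0// => e /andP[+ _]; exact: f0.
Qed.

Lemma sums_ex {R : realType} (f : nat -> R) (M : R) :
  (forall e, (0 < e)%N -> 0 <= f e) -> (forall n, \sum_(1 <= e < n) f e <= M) ->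
  exists2 l, sums f l & 0 <= l <= M.
Proof.
move=> f0 fM; have := nondecreasing_is_cvgn (nat_partial_nd _ f0).
have ub : has_ubound (range (fun n => \sum_(1 <= e < n) f e)).
  by exists M => _ [n _ <-].
move=> /(_ ub) /cvg_ex[l fl]; exists l => //.
rewrite (sums_le _ _ _ _ f0 sums0 fl) /=.
rewrite -(cvg_lim (@Rhausdorff R) fl); apply: limr_le; first by apply/cvg_ex; exists l.
by apply: nearW.
Qed.

Lemma sums_comp_ge0 {R : realType} (f g : nat -> R) (L : R) :
  (forall e, (0 < e)%N -> 0 <= f e <= g e) -> sums g L ->
  exists2 l, sums f l & 0 <= l <= L.
Proof.
move=> fg gL.
have f0 e : (0 < e)%N -> 0 <= f e by move=> /fg/andP[].
have g0 e : (0 < e)%N -> 0 <= g e by move=> /fg/andP[]; exact: le_trans.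
apply: (sums_ex _ _ f0) => n.
apply: le_trans (sums_ge_partial _ _ n g0 gL).
rewrite big_nat [leRHS]big_nat; apply: ler_sum => e /andP[e0 _].
by have /andP[] := fg e e0.
Qed.

(** The function f + g is nonnegative and at most 2 g, which reduces the signed case to
    [sums_comp_ge0]. *)
Lemma sums_comp {R : realType} (f g : nat -> R) (L : R) :
  (forall e, (0 < e)%N -> `|f e| <= g e) -> sums g L ->
  exists2 l, sums f l & `|l| <= L.
Proof.
move=> fg gL.
have [e e0|l1 h1 /andP[l10 l1L]] := sums_comp_ge0 (fun e => (f e + g e)) (fun e => 2 * g e) (2 * L) _ (sumsZ 2 _ _ gL).
  have := fg e e0; rewrite ler_norml; lra.
have h : sums f (l1 - L).
  by apply: eq_sums (sumsB _ _ _ _ h1 gL) => e _; rewrite addrK.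
exists (l1 - L) => //; rewrite ler_norml; lra.
Qed.

Lemma sums_geo {R : realType} (z : R) : `|z| < 1 -> sums (fun e => z ^+ e) (z / (1 - z)).
Proof.
move=> z1.
have z1' : 1 - z != 0 by rewrite subr_eq0; apply/eqP => zE; move: z1; rewrite -zE normr1 ltxx.
rewrite /sums -cvg_shiftS /=.
have -> : (fun n => \sum_(1 <= e < n.+1) z ^+ e) = series (geometric z z).
  apply/funext => n; rewrite /series /= big_add1 /=; apply: eq_bigr => i _.
  by rewrite exprS.
exact: cvg_geometric_series.
Qed.

Lemma sumsS {R : realType} (f : nat -> R) (l : R) :
  sums f l -> sums (fun e => f e.+1) (l - f 1%N).
Proof.
rewrite /sums => fl; rewrite -cvg_shiftS /= in fl.
have h : \sum_(1 <= e < n.+1) f e - f 1%N @[n --> \oo] --> l - f 1%N.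
  by apply: cvgB => //; exact: cvg_cst.
apply: cvg_trans h; apply: near_eq_cvg; near=> n.
have n1 : (0 < n)%N by near: n; exact: nbhs_infty_gt.
by rewrite big_ltn// addrC addKr big_add1.
Unshelve. all: by end_near. Qed.

(** Any y strictly between z and 1 gives a geometric majorant: with h = ln (y / z), the exponential
    series yields (h e)^m / m! <= expR (h e) = (y / z)^e. *)
Lemma sums_pow_geo {R : realType} (m : nat) (z : R) : 0 < z < 1 ->
  exists2 l, sums (fun e => e%:R ^+ m * z ^+ e) l & 0 <= l.
Proof.
move=> /andP[z0 z1]; pose y := (1 + z) / 2; have zy : z < y by rewrite /y; lra.
have y0 : 0 < y := lt_trans z0 zy.
have y1 : y < 1 by rewrite /y; lra.
clearbody y.
pose h := ln (y / z); have h0 : 0 < h by rewrite ln_gt0// ltr_pdivlMr// mul1r.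
have eh : expR h = y / z by rewrite lnK// posrE divr_gt0.
have hm : 0 < h ^+ m by rewrite exprn_gt0.
have mf : 0 < m`!%:R :> R by rewrite ltr0n fact_gt0.
have y1' : `|y| < 1 by rewrite gtr0_norm.
have [e e0|l fl /andP[l0 _]] :=
  sums_comp_ge0 (fun e => e%:R ^+ m * z ^+ e) (fun e => m`!%:R / h ^+ m * y ^+ e) _ _
   (sumsZ _ _ _ (sums_geo y y1')).
- rewrite mulr_ge0 ?exprn_ge0 ?ler0n ?(ltW z0)//=.
  have -> : y ^+ e = expR (h * e%:R) * z ^+ e.
    by rewrite expRM_natr eh expr_div_n divfK// expf_neq0// gt_eqF.
  rewrite mulrA ler_wpM2r ?exprn_ge0 ?(ltW z0)//.
  rewrite mulrAC ler_pdivlMr// mulrC -exprMn -ler_pdivrMl// mulrC.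
  case: (m) => [|m']; first by rewrite expr0 mul1r invr1 -expR0 ler_expR mulr_ge0// ltW.
  apply: le_trans (expR_ge1Dxn m' _); first by rewrite lerDr.
  by rewrite mulr_ge0// ltW.
- by exists l.
Qed.

Lemma sums_geo_half {R : realType} : sums (fun e => 2^-1 ^+ e : R) 1.
Proof.
have := @sums_geo R 2^-1; have -> : 2^-1 / (1 - 2^-1) = 1 :> R by field.
by apply; rewrite ger0_norm ?invr_ge0// invf_lt1// ltr1n.
Qed.

(** Shifting the index gives l - 1/2 = l/2 + 1/2. This 2 is the one in the slope - 2 ln 5 of the
    pressure. *)
Lemma sums_id_geo_half {R : realType} : sums (fun e => e%:R * 2^-1 ^+ e : R) 2.
Proof.
have [|l fl l0] := @sums_pow_geo R 1 2^-1; first by rewrite invr_gt0 invf_lt1 ?ltr1n ?ltr0n.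
have h1 := sumsS _ _ fl.
have h2 := sumsD _ _ _ _ (sumsZ 2^-1 _ _ fl) (sumsZ 2^-1 _ _ (@sums_geo_half R)).
have lE : l - 1%:R ^+ 1 * 2^-1 ^+ 1 = 2^-1 * l + 2^-1 * 1.
  apply: sums_unique h1 _; apply: eq_sums h2 => e _.
  by rewrite !expr1 exprS -natr1; ring.
have l2 : l = 2 by move: lE; rewrite !expr1 mul1r mulr1; lra.
by rewrite -[X in sums _ X]l2; apply: eq_sums fl => e _; rewrite expr1.
Qed.

(** * Taylor remainders *)

Lemma derive_ge0_le {R : realType} (f df : R -> R) (Y y : R) :
  (forall x : R, 0 <= x -> is_derive x 1 f (df x)) ->
  (forall x : R, 0 <= x <= Y -> 0 <= df x) ->
  0 <= y <= Y -> f 0 <= f y.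
Proof.
move=> fdf df0 /andP[y0 yY].
have [x x0|c|c cy fE] := @MVT_segment _ f df 0 y y0.
- by apply: fdf; rewrite ltW// (itvP x0).
- apply: continuous_in_subspaceT => x; rewrite inE /= => xy.
  apply: differentiable_continuous; apply/derivable1_diffP.
  by have [] := fdf x; rewrite ?(itvP xy).
- rewrite -subr_ge0 fE mulr_ge0 ?subr0// df0// (itvP cy)/=.
  by rewrite (le_trans _ yY)// (itvP cy).
Qed.

Definition binom {R : realType} (s : R) (v : nat) : R := (binomial_poly v).[s].

Lemma binom0 {R : realType} (s : R) : binom s 0 = 1.
Proof. by rewrite /binom /binomial_poly big_ord0 hornerZ hornerC fact0 invr1 mulr1. Qed.

Lemma binomE {R : realType} (s : R) v :
  binom s v = (v`!%:R)^-1 * \prod_(i < v) (s - i%:R).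
Proof.
by rewrite /binom hornerZ horner_prod; congr (_ * _); apply: eq_bigr => i _; rewrite !hornerE.
Qed.

Lemma binomS {R : realType} (s : R) v : v.+1%:R * binom s v.+1 = s * binom (s - 1) v.
Proof.
rewrite !binomE factS natrM big_ord_recl /= invfM subr0.
have -> : \prod_(i < v) (s - (bump 0 i)%:R) = \prod_(i < v) (s - 1 - i%:R).
  by apply: eq_bigr => i _; rewrite /bump /= natrD opprD addrA.
by rewrite !mulrA divff ?pnatr_eq0// mul1r [s * _]mulrC.
Qed.

Definition binom_rem {R : realType} (s : R) (n : nat) (y : R) : R :=
  (1 + y) `^ s - \sum_(v < n) binom s v * y ^+ v.

Lemma binom_rem0 {R : realType} (s : R) n : binom_rem s n.+1 0 = 0.
Proof.
rewrite /binom_rem addr0 powR1 big_ord_recl /= binom0 expr0 mulr1 big1 ?addr0 ?subrr// => i _.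
by rewrite expr0n mulr0.
Qed.

Lemma is_derive_cpow {R : realType} (c : R) n (x : R) :
  is_derive x 1 (fun y : R => c * y ^+ n) (c * (n%:R * x ^+ n.-1)).
Proof.
have -> : (fun y : R => c * y ^+ n) = c \*: (@id R ^+ n).
  by apply/funext => y; rewrite /= exprfctE.
apply: is_derive_eq (is_deriveZ c (is_deriveX n (is_derive_id x 1))) _.
by rewrite /GRing.scale /= mulr1.
Qed.

Lemma is_derive_sum_pow {R : realType} n (F : nat -> R) (x : R) :
  is_derive x 1 (fun y => \sum_(v < n) F v * y ^+ v)
    (\sum_(v < n) F v * (v%:R * x ^+ v.-1)).
Proof.
elim: n => [|n IH].
  under eq_fun do rewrite big_ord0.
  rewrite big_ord0; exact: is_derive_cst.
under eq_fun do rewrite big_ord_recr /=.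
rewrite big_ord_recr /=.
apply: is_deriveD.
exact: is_derive_cpow.
Qed.

(** Differentiation lowers the order and the exponent together, so their difference is preserved;
    this drives the induction on the order. *)
Lemma is_derive_binom_rem {R : realType} (s : R) n (x : R) : 0 <= x ->
  is_derive x 1 (binom_rem s n.+1) (s * binom_rem (s - 1) n x).
Proof.
move=> x0.
have h1 : is_derive x 1 (fun y : R => (1 + y) `^ s) (s * (1 + x) `^ (s - 1)).
  have hy : is_derive x 1 (fun y : R => 1 + y) 1.
    have := is_deriveD (is_derive_cst (1:R) x 1) (is_derive_id x (1:R)).
    by rewrite add0r.
  have x1 : 0 < 1 + x by lra.
  have := @is_derive1_comp _ (fun y => y `^ s) (fun y : R => 1 + y) x _ _
   (is_derive1_powR s x1) hy.
  by rewrite mulr1.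
apply: is_derive_eq (is_deriveB h1 (is_derive_sum_pow n.+1 (binom s) x)) _.
rewrite /binom_rem mulrBr; congr (_ - _).
rewrite big_ord_recl /= mul0r mulr0 add0r mulr_sumr; apply: eq_bigr => i _.
by rewrite /bump /= add1n mulrA [binom _ _ * _]mulrC binomS mulrA.
Qed.

(* The factor binom s n makes both bounds independent of its sign. *)
Lemma binom_rem_bounds {R : realType} (n : nat) (s y Y : R) :
  s <= n%:R -> 0 <= y <= Y ->
  binom s n ^+ 2 * (1 + Y) `^ (s - n%:R) * y ^+ n <= binom s n * binom_rem s n y
   <= binom s n ^+ 2 * y ^+ n.
Proof.
elim: n s y => [|n IH] s y sn /andP[y0 yY].
  (* Order 0: as s <= 0, the power (1 + y)^s decreases from 1 and is at least (1 + Y)^s. *)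
  rewrite /binom_rem big_ord0 binom0 expr1n !mul1r !subr0 mulr1 expr0.
  have l x : 0 <= x -> (1 + x) `^ s = ((1 + x) `^ (- s))^-1.
    by move=> x0; rewrite -powRN opprK.
  rewrite !l ?(le_trans y0)// lef_pV2 ?posrE ?powR_gt0 ?invf_le1 ?powR_gt0; [|lra..].
  apply/andP; split; last first.
    by rewrite -[leLHS](powRr0 (1 + y)); apply: ler_powR; lra.
  by apply: ge0_ler_powR; rewrite ?nnegrE; lra.
set A := binom s n.+1; set L := (1 + Y) `^ (s - n.+1%:R).
have drem (x : R) : 0 <= x -> is_derive x 1 (fun y => A * binom_rem s n.+1 y)
    (A * (s * binom_rem (s - 1) n x)).
  by move=> x0; exact: (is_deriveZ A (is_derive_binom_rem s n x x0)).
have key x : 0 <= x <= Y ->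
    A ^+ 2 * L * (n.+1%:R * x ^+ n) <= A * (s * binom_rem (s - 1) n x)
      <= A ^+ 2 * (n.+1%:R * x ^+ n).
  move=> xY; have sn' : s - 1 <= n%:R by rewrite lerBlDr natr1.
  have := IH (s - 1) x sn' xY; set B := binom (s - 1) n.
  (* Hence A s is the nonnegative number s^2 / (n + 1) times B, and the bounds of order n pass to
     the derivative whatever the signs of A and B. *)
  have AE : A = s * B / n.+1%:R by rewrite /A -binomS mulrAC divff ?mul1r ?pnatr_eq0.
  have -> : s - 1 - n%:R = s - n.+1%:R by rewrite -natr1 opprD [- _ - _]addrC addrA.
  rewrite -/L => /andP[h1 h2].
  have c0 : 0 <= s ^+ 2 / n.+1%:R by rewrite mulr_ge0 ?sqr_ge0// invr_ge0.
  have n0 : n.+1%:R != 0 :> R by rewrite pnatr_eq0.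
  have -> : A * (s * binom_rem (s - 1) n x) = s ^+ 2 / n.+1%:R * (B * binom_rem (s - 1) n x).
    by rewrite AE; field.
  have -> : A ^+ 2 * L * (n.+1%:R * x ^+ n) = s ^+ 2 / n.+1%:R * (B ^+ 2 * L * x ^+ n).
    by rewrite AE; field.
  have -> : A ^+ 2 * (n.+1%:R * x ^+ n) = s ^+ 2 / n.+1%:R * (B ^+ 2 * x ^+ n).
    by rewrite AE; field.
  by rewrite !ler_wpM2l.
apply/andP; split; rewrite -subr_ge0.
- have := @derive_ge0_le _ (fun y => A * binom_rem s n.+1 y - A ^+ 2 * L * y ^+ n.+1)
   (fun x => A * (s * binom_rem (s - 1) n x) - A ^+ 2 * L * (n.+1%:R * x ^+ n)) Y y.
  rewrite binom_rem0 expr0n /= !mulr0 subr0; apply; last by rewrite y0.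
  + move=> x x0; exact: is_deriveB (drem x x0) (is_derive_cpow _ _ x).
  + by move=> x /key/andP[h _]; rewrite subr_ge0.
- have := @derive_ge0_le _ (fun y => A ^+ 2 * y ^+ n.+1 - A * binom_rem s n.+1 y)
   (fun x => A ^+ 2 * (n.+1%:R * x ^+ n) - A * (s * binom_rem (s - 1) n x)) Y y.
  rewrite binom_rem0 expr0n /= !mulr0 subr0; apply; last by rewrite y0.
  + move=> x x0; exact: is_deriveB (is_derive_cpow _ _ x) (drem x x0).
  + by move=> x /key/andP[_ h]; rewrite subr_ge0.
Qed.

Definition expN_rem {R : realType} (n : nat) (x : R) : R :=
  expR (- x) - \sum_(m < n) (-1) ^+ m / m`!%:R * x ^+ m.

(** The derivative of each remainder is minus the preceding one, so the signs alternate and both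
    bounds follow by integration from 0. *)
Lemma expN_rem_bounds {R : realType} (n : nat) (x : R) : 0 <= x ->
  0 <= (-1) ^+ n * expN_rem n x <= x ^+ n / n`!%:R.
Proof.
elim: n x => [|n IH] x x0.
  by rewrite /expN_rem big_ord0 expr0 subr0 mul1r fact0 divr1 expR_ge0 expR_le1 oppr_le0.
have drem (y : R) : is_derive y 1 (expN_rem n.+1) (- expN_rem n y).
  have h1 : is_derive y 1 (fun x : R => expR (- x)) (- expR (- y)).
    have hy : is_derive y 1 (fun y : R => - y) (- 1) := is_deriveN (is_derive_id y (1:R)).
    have := @is_derive1_comp _ expR (fun y : R => - y) y _ _ (is_derive_expR _) hy.
    by rewrite mulrN1.
  apply: is_derive_eq (is_deriveB h1 (is_derive_sum_pow n.+1 (fun m => (-1) ^+ m / m`!%:R) y)) _.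
  rewrite /expN_rem opprB addrC; congr (_ + _).
  rewrite big_ord_recl /= mul0r mulr0 add0r -sumrN; apply: eq_bigr => i _.
  rewrite /bump /= add1n factS natrM exprS.
  have h0 : i.+1%:R != 0 :> R by rewrite pnatr_eq0.
  have h2 : i`!%:R != 0 :> R by rewrite pnatr_eq0 -lt0n fact_gt0.
  by field; rewrite h2 nat1r.
have r0 : expN_rem n.+1 (0 : R) = 0.
  rewrite /expN_rem oppr0 expR0 big_ord_recl /= expr0 fact0 divr1 mul1r big1 ?addr0 ?subrr//.
  by move=> i _; rewrite expr0n mulr0.
have ds : forall y : R, is_derive y 1 (fun x => (-1) ^+ n.+1 * expN_rem n.+1 x)
   ((-1) ^+ n * expN_rem n y).
  move=> y; have h := @is_deriveZ _ _ _ _ ((-1) ^+ n.+1) _ _ _ (drem y).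
  apply: is_derive_eq h _.
  by rewrite /GRing.scale /= exprS mulN1r mulNr mulrN opprK.
have dp : forall y : R, is_derive y 1 (fun x => x ^+ n.+1 / n.+1`!%:R) (y ^+ n / n`!%:R).
  move=> y.
  have -> : (fun x : R => x ^+ n.+1 / n.+1`!%:R) = (fun x => n.+1`!%:R^-1 * x ^+ n.+1).
    by apply/funext => z; rewrite mulrC.
  apply: is_derive_eq (is_derive_cpow _ _ y) _.
  rewrite /= factS natrM.
  have h0 : n.+1%:R != 0 :> R by rewrite pnatr_eq0.
  have h2 : n`!%:R != 0 :> R by rewrite pnatr_eq0 -lt0n fact_gt0.
  by field; rewrite h2 nat1r.
have xx : 0 <= x <= x by rewrite x0 lexx.
apply/andP; split.
  have := @derive_ge0_le _ _ _ x x (fun y _ => ds y) _ xx; rewrite r0 mulr0; apply.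
  by move=> y /andP[y0 _]; have /andP[] := IH y y0.
rewrite -subr_ge0.
have := @derive_ge0_le _ (fun y => y ^+ n.+1 / n.+1`!%:R - (-1) ^+ n.+1 * expN_rem n.+1 y)
  _ x x (fun y _ => is_deriveB (dp y) (ds y)) _ xx.
rewrite /= r0 mulr0 !subr0 expr0n mul0r; apply.
by move=> y /andP[y0 _]; rewrite subr_ge0; have /andP[] := IH y y0.
Qed.

(** * Upper bound for the Hausdorff dimension *)

Lemma dist_le_diam {R : realType} (U : set R) (x y : R) :
  U x -> U y -> (`|x - y|%:E <= diam U)%E.
Proof.
move=> Ux Uy; rewrite /diam le_max; apply/orP; right.
by apply: ereal_sup_ubound; exists (x, y).
Qed.

Lemma diam_le {R : realType} (U : set R) (M : \bar R) : (0 <= M)%E ->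
  (forall x y, U x -> U y -> (`|x - y|%:E <= M)%E) -> (diam U <= M)%E.
Proof.
move=> M0 UM; rewrite /diam ge_max M0 /=; apply: ge_ereal_sup => _ [[x y] [/= Ux Uy] <-].
exact: UM.
Qed.

Lemma diam_ge0 {R : realType} (U : set R) : (0 <= diam U)%E.
Proof. by rewrite /diam le_max lexx. Qed.

Lemma diam_pow_ge0 {R : realType} (t : R) (U : set R) : (0 <= diam_pow t U)%E.
Proof. by rewrite /diam_pow; case: ifP => // _; exact: poweR_ge0. Qed.

Lemma diam_pow_set0 {R : realType} (t : R) : diam_pow t (set0 : set R) = 0%E.
Proof. by rewrite /diam_pow; case: ifPn => // /negP; case; apply/asboolP. Qed.

Lemma diam_pow_neq0 {R : realType} (t : R) (U : set R) :
  U !=set0 -> diam_pow t U = poweR (diam U) t.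
Proof.
by move=> /set0P/eqP U0; rewrite /diam_pow; case: ifPn => // /asboolP.
Qed.

Lemma diam_pow_affine {R : realType} (t r c : R) (U : set R) : 0 < r ->
  0 <= t ->
  (diam_pow t ((fun x => (r * x + c)%R) @` U) <= (r `^ t)%:E * diam_pow t U)%E.
Proof.
move=> r0 t0; have [->|U0] := eqVneq U set0.
  by rewrite image_set0 !diam_pow_set0 mule0.
have Un : U !=set0 by apply/set0P.
rewrite !diam_pow_neq0//; last first.
  by case: Un => x Ux; exists (r * x + c), x.
rewrite -poweR_EFin -poweRM ?lee_fin ?(ltW r0) ?diam_ge0//.
have rd : (0 <= r%:E * diam U)%E by rewrite mule_ge0 ?diam_ge0// lee_fin ltW.
apply: gt0_ler_poweR => //; rewrite ?in_itv/= ?diam_ge0 ?rd ?leey//.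
apply: diam_le => // _ _ [x Ux <-] [y Uy <-].
have -> : r * x + c - (r * y + c) = r * (x - y) by ring.
rewrite normrM gtr0_norm// EFinM; apply: lee_pmul => //; first by rewrite lee_fin ltW.
exact: dist_le_diam.
Qed.

Lemma diam_affine {R : realType} (r c M : R) (U : set R) : 0 <= r ->
  (diam U <= M%:E)%E -> (diam ((fun x => r * x + c)%R @` U) <= (r * M)%:E)%E.
Proof.
move=> r0 UM; have M0 : 0 <= M by rewrite -lee_fin; apply: le_trans UM; exact: diam_ge0.
apply: diam_le => [|_ _ [x Ux <-] [y Uy <-]]; first by rewrite lee_fin mulr_ge0.
have -> : r * x + c - (r * y + c) = r * (x - y) by ring.
rewrite normrM ger0_norm// lee_fin ler_wpM2l// -lee_fin.
by apply: le_trans UM; exact: dist_le_diam.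
Qed.

Lemma diam_pow_le {R : realType} (s t : R) (U : set R) : 0 <= s <= t ->
  (diam U <= 1%:E)%E -> (diam_pow t U <= diam_pow s U)%E.
Proof.
move=> /andP[s0 st] U1.
have [->|U0] := eqVneq U set0; first by rewrite !diam_pow_set0.
rewrite !diam_pow_neq0; [|exact/set0P..].
case: (diam U) (diam_ge0 U) U1 => // d; rewrite !lee_fin => d0 d1.

case: (ltgtP 0 d) d0 => // [d0 _|<- _]; first by apply: ger_powR; rewrite ?d0.
(* Diameter 0: the power is 1 for exponent 0 and 0 for a positive exponent. *)
have [->|sn] := eqVneq s 0; last first.
  by rewrite !powR0//; apply/eqP => t0; move/eqP: sn; lra.
rewrite powRr0; have [->|tn] := eqVneq t 0; first by rewrite powRr0.
by rewrite powR0.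
Qed.

Definition ifs_map {R : realType} (r b : nat -> R) (e : nat) (x : R) : R := r e * x + b e.

(** The points lying in all cylinders of some code. Unlike the limit set it is defined without a
    choice operator, and the limit set will be a subset of it. *)
Definition ifs_points {R : realType} (r b : nat -> R) : set R :=
  [set x | exists2 w : nat -> nat, (forall i, (0 < w i)%N) &
    forall m, (cylinder_map (ifs_map r b) w m @` `[0, 1]) x].

Lemma cylinder_mapS {R : realType} (f : nat -> R -> R) w m x :
  cylinder_map f w m.+1 x = f (w 0%N) (cylinder_map f (fun i => w i.+1) m x).
Proof. by elim: m x => //= m IH x; rewrite IH. Qed.

(** The image of [0, 1] under letter e is the interval from b e to b e + r e. Disjointness of the
    open images is encoded as an order between endpoints, so that two images may touch. *)
Record good_ifs {R : realType} (r b : nat -> R) (rho : R) : Prop := GoodIfs {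
  good_lt1 : rho < 1;
  good_ratio : forall e, (0 < e)%N -> 0 < r e <= rho;
  good_itv : forall e, (0 < e)%N -> 0 <= b e /\ b e + r e <= 1;
  good_disj : forall e e', (0 < e)%N -> (0 < e')%N -> e <> e' ->
    b e + r e <= b e' \/ b e' + r e' <= b e }.

Lemma ifs_points_sub {R : realType} (r b : nat -> R) (rho : R) : good_ifs r b rho ->
  ifs_points r b `<=` \bigcup_e (ifs_map r b e.+1 @` ifs_points r b).
Proof.
move=> G x [w w0 wx]; exists (w 0%N).-1 => //; rewrite prednK//.
have r0 : r (w 0%N) != 0 by have /andP[/gt_eqF->] := good_ratio _ _ _ G _ (w0 0%N).
pose y := (x - b (w 0%N)) / r (w 0%N).
have xy : ifs_map r b (w 0%N) y = x by rewrite /ifs_map /y mulrCA divff// mulr1 subrK.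
exists y => //; exists (fun i => w i.+1) => // m.
have [z z01 zx] := wx m.+1.
exists z => //; rewrite /y -zx cylinder_mapS /ifs_map addrK mulrC mulKf//.
Qed.

Lemma ifs_covers {R : realType} (r b : nat -> R) (rho t L : R) : good_ifs r b rho ->
  0 <= t -> sums (fun e => r e `^ t) L -> forall n : nat,
  exists U : nat -> set R,
  [/\ ifs_points r b `<=` \bigcup_i U i,
      forall i, (diam (U i) <= (rho ^+ n)%:E)%E &
      (\sum_(0 <= i <oo) diam_pow t (U i) <= (L ^+ n)%:E)%E].
Proof.
move=> G t0 rL.
have rho0 : 0 <= rho.
  by have /andP[h1 h2] := good_ratio _ _ _ G 1%N isT; apply: le_trans h2; exact: ltW.
have L0 : 0 <= L by apply: sums_le sums0 rL => e _; exact: powR_ge0.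
elim=> [|n [U [U1 U2 U3]]].
  (* The unit interval followed by empty sets, which weigh 0 for every exponent. *)
  exists (fun i => if i == 0%N then `[0, 1]%classic else set0).
  have d1 : (diam (`[0%R, 1%R]%classic : set R) <= 1%:E)%E.
    apply: diam_le => // x y; rewrite /= !in_itv /= => /andP[x0 x1] /andP[y0 y1].
    by rewrite lee_fin ler_norml; lra.
  split.
  - move=> x [w w0 /(_ 0%N) /= [y y01 <-]]; exists 0%N => //=.
    move: y01; rewrite /= !in_itv /= => /andP[y0 y1].
    have [b0 b1] := good_itv _ _ _ G _ (w0 0%N).
    have /andP[r0 _] := good_ratio _ _ _ G _ (w0 0%N).
    rewrite /ifs_map addr_ge0 ?mulr_ge0 ?(ltW r0)//= (le_trans _ b1)// addrC lerD2l.
    by rewrite ler_piMr// ltW.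
  - move=> [|i] /=; first by rewrite expr0.
    by apply: diam_le => //; rewrite lee_fin.
  - rewrite (nneseries_split 0 1); last by move=> k _; exact: diam_pow_ge0.
    rewrite add0n big_nat1 eseries0 ?adde0; last first.
      by move=> [|i]//= _ _; rewrite diam_pow_set0.
    rewrite /= expr0 (le_trans (diam_pow_le 0 t _ _ d1)) ?lexx//.
    by rewrite diam_pow_neq0 ?poweRe0//; exists 0; rewrite /= in_itv /= lexx ler01.
(* The images of all sets of the previous cover under all letters are indexed by pairs; a bijection
   with nat turns them into a sequence. *)
have /card_set_bijP[g [_ ginj gsurj]] : ([set: nat] #= [set: nat * nat])%card.
  by rewrite card_eq_sym; exact: card_nat2.
pose V (p : nat * nat) := ifs_map r b p.1.+1 @` U p.2.
exists (V \o g); split.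
- move=> x /(ifs_points_sub _ _ _ G)[e _ [y /U1[i _ Uy] <-]].
  have [k _ gk] := gsurj (e, i) I.
  by exists k => //=; rewrite gk; exists y.
- move=> k /=; rewrite /V /ifs_map exprS.
  have /andP[h1 h2] := good_ratio _ _ _ G (g k).1.+1 isT.
  apply: le_trans (diam_affine _ _ _ _ (ltW h1) (U2 _)) _.
  by rewrite lee_fin ler_wpM2r// exprn_ge0.
- rewrite /= nneseries_esumT; last by move=> k; exact: diam_pow_ge0.
  rewrite -(@reindex_esum _ _ _ [set: nat] [set: nat * nat] g (fun p => diam_pow t (V p)))//.
  have -> : [set: nat * nat] = [set: nat] `*`` (fun=> [set: nat]).
    by apply/seteqP; split => // -[].
  rewrite -(@esum_esum _ _ _ _ _ (fun e i => diam_pow t (V (e, i))));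
    last by move=> *; exact: diam_pow_ge0.
  apply: (@le_trans _ _ (\esum_(e in [set: nat]) ((r e.+1 `^ t)%:E * (L ^+ n)%:E)%E)).
    apply: le_esum => e _; rewrite -nneseries_esumT; last by move=> k; exact: diam_pow_ge0.
    have /andP[h1 h2] := good_ratio _ _ _ G e.+1 isT.
    apply: (@le_trans _ _ (\sum_(0 <= i <oo) ((r e.+1 `^ t)%:E * diam_pow t (U i)))%E).
      apply: lee_nneseries => [*|i _]; first exact: diam_pow_ge0.
      exact: diam_pow_affine.
    rewrite nneseriesZl; last by move=> *; exact: diam_pow_ge0.
    by apply: lee_pmul => //; [rewrite lee_fin powR_ge0|apply: nneseries_ge0 => *; exact: diam_pow_ge0].
  rewrite -nneseries_esumT; last by move=> k; rewrite -EFinM lee_fin mulr_ge0 ?powR_ge0 ?exprn_ge0.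
  apply: lime_le.
    by apply: is_cvg_nneseries => k _ _; rewrite -EFinM lee_fin mulr_ge0 ?powR_ge0 ?exprn_ge0.
  apply: nearW => N; under eq_bigr do rewrite -EFinM.
  rewrite sumEFin -mulr_suml lee_fin exprS ler_wpM2r ?exprn_ge0//.
  have := sums_ge_partial _ _ N.+1 (fun e _ => powR_ge0 (r e) t) rL.
  by rewrite big_add1.
Qed.

Lemma hausdorff_measure_eq0 {R : realType} (r b : nat -> R) (rho t L : R) (A : set R) :
  good_ifs r b rho -> A `<=` ifs_points r b ->
  0 <= t -> sums (fun e => r e `^ t) L -> L < 1 -> hausdorff_measure t A = 0%E.
Proof.
move=> G AK t0 rL L1.
have L0 : 0 <= L by apply: sums_le sums0 rL => e _; exact: powR_ge0.
have rho0 : 0 <= rho.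
  by have /andP[h1 h2] := good_ratio _ _ _ G 1%N isT; apply: le_trans h2; exact: ltW.
have p0 d : (0 <= hausdorff_premeasure t d A)%E.
  apply: le_ereal_inf_tmp => _ [U _ <-]; apply: nneseries_ge0 => *; exact: diam_pow_ge0.
apply/eqP; rewrite eq_le; apply/andP; split; last first.
  by apply: le_ereal_sup_tmp; exists (hausdorff_premeasure t 1 A); [exists 1 => /=|exact: p0].
apply: ge_ereal_sup => _ [d /= d0 <-].
apply/lee_addgt0Pr => e e0; rewrite add0e.
have [n [nd ne]] : exists n, rho ^+ n <= d /\ L ^+ n <= e.
  have cvg z x : 0 <= z -> z < 1 -> 0 < x -> \forall n \near \oo, z ^+ n <= x :> R.
    move=> z0 z1 x0.
    have z1' : `|z| < 1 by rewrite ger0_norm.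
    have /cvgrPdist_le/(_ _ x0) := @cvg_expr R z z1'.
    by apply: filterS => n; rewrite sub0r normrN ger0_norm// exprn_ge0.
  have h := filterI (cvg _ _ rho0 (good_lt1 _ _ _ G) d0) (cvg _ _ L0 L1 e0).
  by have [n _ /(_ n (leqnn n))] := h; exists n.
have [U [U1 U2 U3]] := ifs_covers _ _ _ _ _ G t0 rL n.
apply: ge_ereal_inf; exists (\sum_(0 <= i <oo) diam_pow t (U i))%E; last first.
  by apply: le_trans U3 _; rewrite lee_fin.
exists U => //; split; first exact: subset_trans AK U1.
by move=> i; apply: le_trans (U2 i) _; rewrite lee_fin.
Qed.

(** * Lower bound for the Hausdorff dimension *)

(** Composition along a finite word, first letter outermost. Lists can be concatenated, while
    [cylinder_map] only sees prefixes of one infinite code. *)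
Definition word_map {R : realType} (r b : nat -> R) (W : seq nat) (x : R) : R :=
  foldr (ifs_map r b) x W.

Definition word_ratio {R : realType} (r : nat -> R) (W : seq nat) : R := \prod_(e <- W) r e.

Definition pos_word (W : seq nat) : bool := all (fun e => 0 < e)%N W.

Lemma word_mapB {R : realType} (r b : nat -> R) W (x y : R) :
  word_map r b W x - word_map r b W y = word_ratio r W * (x - y).
Proof.
elim: W => [|e W IH] /=; first by rewrite /word_ratio big_nil mul1r.
by rewrite /word_ratio big_cons -mulrA -IH /ifs_map; ring.
Qed.

Lemma word_map_cat {R : realType} (r b : nat -> R) V W (x : R) :
  word_map r b (V ++ W) x = word_map r b V (word_map r b W x).
Proof. by rewrite /word_map foldr_cat. Qed.

Lemma cylinder_map_word {R : realType} (r b : nat -> R) w m (x : R) :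
  cylinder_map (ifs_map r b) w m x = word_map r b (mkseq w m.+1) x.
Proof.
elim: m x => [|m IH] x //.
by rewrite mkseqS /word_map foldr_rcons -/(word_map _ _ _ _) -IH.
Qed.

Lemma word_ratio_gt0 {R : realType} (r b : nat -> R) (rho : R) W :
  good_ifs r b rho -> pos_word W -> 0 < word_ratio r W <= rho ^+ size W.
Proof.
move=> G; elim: W => [|e W IH] /=; first by rewrite /word_ratio big_nil expr0 ltr01 lexx.
move=> /andP[e0 W0]; rewrite /word_ratio big_cons exprS.
have /andP[r0 rr] := good_ratio _ _ _ G _ e0.
have /andP[h1 h2] := IH W0; rewrite -/(word_ratio r W).
by rewrite mulr_gt0//=; apply: ler_pM => //; exact: ltW.

Qed.

Lemma word_ratio_powR {R : realType} (r b : nat -> R) (rho t : R) W :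
  good_ifs r b rho -> pos_word W -> word_ratio r W `^ t = \prod_(e <- W) r e `^ t.
Proof.
move=> G; elim: W => [|e W IH] /=; first by rewrite /word_ratio !big_nil powR1.
move=> /andP[e0 W0]; rewrite big_cons -IH// /word_ratio big_cons -/(word_ratio r W).
have /andP[r0 _] := good_ratio _ _ _ G _ e0.
have /andP[h1 _] := word_ratio_gt0 _ _ _ _ G W0.
by rewrite powRM// ltW.
Qed.

Lemma word_map_itv {R : realType} (r b : nat -> R) (rho : R) W x :
  good_ifs r b rho -> pos_word W -> 0 <= x <= 1 -> 0 <= word_map r b W x <= 1.
Proof.
move=> G; elim: W => //= e W IH /andP[e0 W0] x01.
have /andP[y0 y1] := IH W0 x01.
have /andP[r0 rr] := good_ratio _ _ _ G _ e0; have [b0 b1] := good_itv _ _ _ G _ e0.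
rewrite /ifs_map addr_ge0 ?mulr_ge0 ?(ltW r0)//= (le_trans _ b1)// addrC lerD2l.
by rewrite ler_piMr// ltW.
Qed.

(** Equal lengths exclude that one word is a prefix of the other; common first letters are stripped,
    and the first difference is decided by [good_disj]. *)
Lemma word_map_disj {R : realType} (r b : nat -> R) (rho : R) V W :
  good_ifs r b rho -> pos_word V -> pos_word W -> size V = size W -> V <> W ->
  word_map r b V 1 <= word_map r b W 0 \/ word_map r b W 1 <= word_map r b V 0.
Proof.
move=> G; elim: V W => [|e V IH] [|e' W]//= /andP[e0 V0] /andP[e'0 W0] [VW] neq.
have I1 : (0 <= 1 :> R) && (1 <= 1 :> R) by rewrite ler01 lexx.
have I0 : (0 <= 0 :> R) && (0 <= 1 :> R) by rewrite ler01 lexx.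
have [ee'|ee'] := eqVneq e e'.
  have /IH : V <> W by move=> VW'; apply: neq; rewrite ee' VW'.
  rewrite -ee' /ifs_map; have /andP[r0 _] := good_ratio _ _ _ G _ e0.
  by move=> /(_ V0 W0 VW) [h|h]; [left|right]; rewrite lerD2r ler_pM2l.
have /eqP ee := ee'.
have /andP[r0 _] := good_ratio _ _ _ G _ e0; have /andP[r'0 _] := good_ratio _ _ _ G _ e'0.
have /andP[v1 v1'] := word_map_itv _ _ _ V 1 G V0 I1.
have /andP[v0 v0'] := word_map_itv _ _ _ V 0 G V0 I0.
have /andP[w1 w1'] := word_map_itv _ _ _ W 1 G W0 I1.
have /andP[w0 w0'] := word_map_itv _ _ _ W 0 G W0 I0.
have [h|h] := good_disj _ _ _ G _ _ e0 e'0 ee; [left|right]; rewrite /ifs_map.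
- have h1 : r e * word_map r b V 1 <= r e by rewrite ler_piMr// ltW.
  have h2 : 0 <= r e' * word_map r b W 0 by rewrite mulr_ge0// ltW.
  by rewrite -!/(word_map _ _ _ _); lra.
- have h1 : r e' * word_map r b W 1 <= r e' by rewrite ler_piMr// ltW.
  have h2 : 0 <= r e * word_map r b V 0 by rewrite mulr_ge0// ltW.
  by rewrite -!/(word_map _ _ _ _); lra.
Qed.

(** Of the intervals of letters 1 and 2, the right one starts at a positive point. Words ending with
    such a letter have images off the left end of the preceding cylinder. *)
Lemma good_ifs_exists_pos {R : realType} (r b : nat -> R) (rho : R) :
  good_ifs r b rho -> exists2 u, (0 < u)%N & 0 < b u.
Proof.
move=> G.
have [b1 _] := good_itv _ _ _ G 1 isT; have [b2 _] := good_itv _ _ _ G 2 isT.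
have /andP[r1 _] := good_ratio _ _ _ G 1 isT; have /andP[r2 _] := good_ratio _ _ _ G 2 isT.
have [|h|h] := good_disj _ _ _ G 1 2 isT isT; first by [].
- by exists 2 => //; lra.
- by exists 1 => //; lra.
Qed.

(** The supremum of the left ends lies in every cylinder. Nonemptiness is what makes [get] in
    [coding_map] return a point of the intersection. *)
Lemma cylinders_meet {R : realType} (r b : nat -> R) (rho : R) w :
  good_ifs r b rho -> (forall i, (0 < w i)%N) ->
  \bigcap_m (cylinder_map (ifs_map r b) w m @` `[0, 1]) !=set0.
Proof.
move=> G w0; pose l m := word_map r b (mkseq w m) 0.
pose h m := word_map r b (mkseq w m) 1.
have pw m n : pos_word [seq w i | i <- iota m n] by apply/allP => _ /mapP[i _ ->].
have wr m n := word_ratio_gt0 _ _ _ _ G (pw m n).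
have split m n : (m <= n)%N -> mkseq w n = mkseq w m ++ [seq w i | i <- iota m (n - m)].
  by move=> mn; rewrite /mkseq -map_cat -iotaD subnKC.
have I1 : (0 <= 1 :> R) && (1 <= 1 :> R) by rewrite ler01 lexx.
have I0 : (0 <= 0 :> R) && (0 <= 1 :> R) by rewrite ler01 lexx.
have mono m x y : x <= y -> word_map r b (mkseq w m) x <= word_map r b (mkseq w m) y.
  move=> xy; rewrite -subr_ge0 word_mapB mulr_ge0 ?subr_ge0//.
  by have /andP[/ltW] := wr 0%N m.
have lh m : l m <= h m by exact: mono.
have lm m n : (m <= n)%N -> l m <= l n /\ h n <= h m.
  move=> mn; rewrite /l /h (split _ _ mn) !word_map_cat; split; apply: mono.
  - by have /andP[] := word_map_itv _ _ _ _ _ G (pw m (n - m)%N) I0.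
  - by have /andP[] := word_map_itv _ _ _ _ _ G (pw m (n - m)%N) I1.
have lhmn m n : l m <= h n.
  have [h1 _] := lm _ _ (leq_maxl m n); have [_ h2] := lm _ _ (leq_maxr m n).
  exact: le_trans h1 (le_trans (lh _) h2).
have hs : has_sup (range l).
  split; first by exists (l 0%N), 0%N.
  by exists (h 0%N) => _ [m _ <-]; exact: lhmn.
have sl m : l m <= sup (range l) by apply: (ub_le_sup hs.2); exists m.
have sh m : sup (range l) <= h m.
  by apply: ge_sup; [exact: hs.1|move=> _ [n _ <-]; exact: lhmn].
exists (sup (range l)) => m _.
set W := mkseq w m.+1; have /andP[R0 _] := wr 0%N m.+1; rewrite -/W in R0.
have hl : h m.+1 - l m.+1 = word_ratio r W by rewrite word_mapB subr0 mulr1.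
exists ((sup (range l) - l m.+1) / word_ratio r W).
  rewrite /= in_itv /= divr_ge0 ?subr_ge0 ?sl ?(ltW R0)//= ler_pdivrMr// mul1r -hl.
  by rewrite lerD2r sh.
rewrite cylinder_map_word -/W.
have := word_mapB r b W ((sup (range l) - l m.+1) / word_ratio r W) 0.
rewrite subr0 [X in _ = X]mulrC divfK ?gt_eqF// => /eqP; rewrite subr_eq => /eqP ->.
by rewrite -/(l m.+1) subrK.
Qed.

(* A cylinder meeting little mass contains a child meeting proportionally
   little mass, because a set too small for the gap meets a single child; a
   point of the nested cylinders so obtained escapes every [U i]. *)
Lemma separated_cover_lower_bound {R : realType} (r b : nat -> R) (rho t delta : R)
    (A : set R) (I : finType) (g : I -> seq nat) (U : nat -> set R) :
  good_ifs r b rho ->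
  (forall w : nat -> nat, (forall i, (0 < w i)%N) -> exists2 x, A x &
    forall m, (cylinder_map (ifs_map r b) w m @` `[0, 1]) x) ->
  0 < t -> 0 < delta ->
  (forall i, pos_word (g i)) -> (forall i, (0 < size (g i))%N) ->
  1 <= \sum_i word_ratio r (g i) `^ t ->
  (forall i j x y, i != j -> 0 <= x <= 1 -> 0 <= y <= 1 ->
    delta <= `|word_map r b (g i) x - word_map r b (g j) y|) ->
  A `<=` \bigcup_i U i ->
  ((delta `^ t)%:E <= \sum_(0 <= i <oo) diam_pow t (U i))%E.
Proof.
move=> G HA t0 d0 gpos gsz sum1 gap AU; rewrite leNgt; apply/negP => lt_dt.
set S := (\sum_(0 <= i <oo) diam_pow t (U i))%E in lt_dt.
have S0 : (0 <= S)%E by apply: nneseries_ge0 => *; exact: diam_pow_ge0.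
have Sfin : S \is a fin_num by rewrite ge0_fin_numE// (lt_trans lt_dt)// ltry.
pose q := (delta `^ t - fine S) / 2.
have q0 : 0 < q by rewrite divr_gt0// subr_gt0 -lte_fin fineK.
(* The added positive weights have total at most q. They charge even sets of weight 0, so that a set
   meeting all the nested cylinders leads to a contradiction. *)
pose p i := (diam_pow t (U i) + (q / (2 ^ i.+1)%:R)%:E)%E.
have qi i : 0 < q / (2 ^ i.+1)%:R by rewrite divr_gt0// ltr0n expn_gt0.
have p0 i : (0 <= p i)%E by rewrite adde_ge0 ?diam_pow_ge0// lee_fin ltW.
have dp i : (diam_pow t (U i) <= p i)%E by rewrite leeDl// lee_fin ltW.
pose meet W i := `[< (U i `&` word_map r b W @` `[0, 1]) !=set0 >].
pose mass W := (\sum_(0 <= i <oo | meet W i) p i)%E.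
pose inv W := pos_word W /\ (mass W < (delta `^ t * word_ratio r W `^ t)%:E)%E.
have inv0 : inv [::].
  split => //; rewrite /word_ratio big_nil powR1 mulr1.
  apply: (@le_lt_trans _ _ (\sum_(0 <= i <oo) p i)%E).
    by apply: subset_lee_nneseries => // i _; exact: p0.
  rewrite nneseriesD; [|by move=> *; exact: diam_pow_ge0|by move=> i _; rewrite lee_fin ltW].
  apply: (@le_lt_trans _ _ (S + q%:E)%E).
    by rewrite leeD2l//; apply: (@epsilon_trick0 R q xpredT); exact: ltW.
  rewrite -(fineK Sfin) -EFinD lte_fin /q.
  have : fine S < delta `^ t by rewrite -lte_fin fineK.
  lra.
have step W : exists i, inv W -> inv (W ++ g i).
  apply: contrapT => /forallNP noi.
  (* If [inv W] failed, any index would satisfy the implication, and an index exists because the sum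
     in [sum1] is not empty. *)
  have invW : inv W by apply: contrapT => nW; case: (pselect (exists i : I, True)) => [[i _]|nI];
    [by apply: (noi i) => /nW|move: sum1; rewrite big1 ?ler10// => i; case: nI; exists i].
  have noi' i : ~ inv (W ++ g i) by move=> h; apply: (noi i).
  case: invW => Wpos massW.
  have /andP[rW0 _] := word_ratio_gt0 _ _ _ _ G Wpos.
  have catpos i : pos_word (W ++ g i) by rewrite /pos_word all_cat; apply/andP; split => //; exact: gpos.
  have rcat i : word_ratio r (W ++ g i) = word_ratio r W * word_ratio r (g i).
    by rewrite /word_ratio big_cat.
  have big_i i : ((delta `^ t * word_ratio r W `^ t * word_ratio r (g i) `^ t)%:E <= mass (W ++ g i))%E.
    rewrite leNgt; apply/negP => h; apply: (noi' i); split => //.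
    have /andP[rg0 _] := word_ratio_gt0 _ _ _ _ G (gpos i).
    by rewrite rcat powRM ?(ltW rW0) ?(ltW rg0)// mulrA.
  (* If no child were light, [sum1] would make the children together heavier than W. This is refuted
     by showing that each U k is counted for at most one child. *)
  have : (mass W < \sum_(i : I) mass (W ++ g i))%E.
    apply: (lt_le_trans massW).
    apply: (@le_trans _ _ (\sum_(i : I) (delta `^ t * word_ratio r W `^ t * word_ratio r (g i) `^ t)%:E)%E).
      by rewrite sumEFin -mulr_sumr lee_fin ler_peMr// mulr_ge0// powR_ge0.
    by apply: lee_sum => i _; exact: big_i.
  apply/negP; rewrite -leNgt /mass.
  under eq_bigr do rewrite eseries_mkcond.
  rewrite -nneseries_sum; last by move=> i j _; case: ifP.
  rewrite [leRHS]eseries_mkcond; apply: lee_nneseries.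
    by move=> i _ _; apply: sume_ge0 => j _; case: ifP.
  move=> k _.
  case: (pselect (exists i, meet (W ++ g i) k)) => [[i mi]|nom]; last first.
    rewrite big1 => [|i _]; first by case: ifP.
    by case: ifP => // mi; case: nom; exists i.
  have mW : meet W k.
    move/asboolP: mi => [x [Ux [z z01 zx]]]; apply/asboolP; exists x; split => //.
    exists (word_map r b (g i) z); last by rewrite -word_map_cat.
    move: z01; rewrite /= !in_itv /= => z01.
    exact: word_map_itv G (gpos i) z01.
  have pk : (p k < (delta `^ t * word_ratio r W `^ t)%:E)%E.
    apply: le_lt_trans massW; rewrite /mass (nneseriesD1 (fun i _ => p0 i) mW).
    by rewrite leeDl// nneseries_ge0.
  rewrite mW (bigD1 i)//= mi big1 ?adde0// => j ji; case: ifP => // mj; exfalso.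
  move/asboolP: mi => [x [Ux [x' x'01 xE]]]; move/asboolP: mj => [y [Uy [y' y'01 yE]]].
  move: x'01 y'01; rewrite /= !in_itv /= => x'01 y'01.
  (* A set meeting two children is at least as wide as the scaled gap, so its own weight reaches the
     bound on the mass of W, against [pk]. *)
  have big_diam : ((delta * word_ratio r W)%:E <= diam (U k))%E.
    apply: le_trans (dist_le_diam _ _ _ Ux Uy).
    rewrite lee_fin -xE -yE !word_map_cat word_mapB normrM (gtr0_norm rW0) mulrC.
    by rewrite ler_pM2l//; apply: gap => //; rewrite eq_sym.
  have : (p k < p k)%E; last by rewrite ltxx.
  apply: lt_le_trans pk _; apply: le_trans (dp k).
  have dW0 : 0 <= delta * word_ratio r W by rewrite mulr_ge0// ltW.
  rewrite diam_pow_neq0; last by exists x.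
  rewrite -powRM ?(ltW d0) ?(ltW rW0)// -poweR_EFin; apply: gt0_ler_poweR => //.
  - exact: ltW.
  - by rewrite in_itv /= lee_fin dW0 leey.
  - by rewrite in_itv /= diam_ge0 leey.
have [h hP] := choice step.
pose Wk := fix Wk k := if k is k'.+1 then Wk k' ++ g (h (Wk k')) else [::].
have Winv k : inv (Wk k) by elim: k => //= k; exact: hP.
have Wsz k : (k <= size (Wk k))%N.
  elim: k => //= k IH; rewrite size_cat -addn1; apply: leq_add => //; exact: gsz.
have Wpre k m : (k <= m)%N -> exists V, Wk m = Wk k ++ V.
  elim: m => [|m IH]; first by rewrite leqn0 => /eqP ->; exists [::].
  rewrite leq_eqVlt => /predU1P[->|/IH[V VE]]; first by exists [::]; rewrite cats0.
  by exists (V ++ g (h (Wk m))); rewrite /= VE catA -VE.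
have Wnth k m i : (i < size (Wk k))%N -> (i < size (Wk m))%N ->
    nth 1%N (Wk k) i = nth 1%N (Wk m) i.
  move=> ik im; have [/Wpre[V ->]|/ltnW/Wpre[V ->]] := leqP k m.
    by rewrite nth_cat ik.
  by rewrite nth_cat im.
pose w i := nth 1%N (Wk i.+1) i.
have w0 i : (0 < w i)%N.
  have [/allP Wp _] := Winv i.+1; apply: Wp; apply: mem_nth; exact: Wsz.
have wW k : mkseq w (size (Wk k)) = Wk k.
  apply: (@eq_from_nth _ 1%N); rewrite ?size_mkseq// => i ik.
  by rewrite nth_mkseq// /w; apply: Wnth => //; exact: Wsz.
have [x Ax xw] := HA w w0.
have [i _ Ux] := AU x Ax.
have meetk k : meet (Wk k.+1) i.
  apply/asboolP; exists x; split => //.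
  have [z z01 zx] := xw (size (Wk k.+1)).-1.
  exists z => //; rewrite -zx cylinder_map_word prednK ?wW//.
  exact: leq_ltn_trans (Wsz k.+1).
have rho1 := good_lt1 _ _ _ G.
have rho0 : 0 < rho.
  by have /andP[h1 h2] := good_ratio _ _ _ G 1%N isT; apply: lt_le_trans h2.
(* The set U i meets every chosen cylinder, whose mass therefore contains the fixed charge of U i
   but is bounded by a geometric sequence. *)
have small k : q / (2 ^ i.+1)%:R < delta `^ t * (rho `^ t) ^+ k.+1.
  have [Wp mW] := Winv k.+1.
  have /andP[rW0 rWle] := word_ratio_gt0 _ _ _ _ G Wp.
  apply: (@lt_le_trans _ _ (delta `^ t * word_ratio r (Wk k.+1) `^ t)); last first.
    rewrite ler_wpM2l ?powR_ge0// -powR_mulrn ?powR_ge0// -powRrM mulrC powRrM.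
    rewrite powR_mulrn ?(ltW rho0)//.
    apply: ge0_ler_powR; rewrite ?nnegrE ?(ltW t0) ?(ltW rW0) ?exprn_ge0 ?(ltW rho0)//.
    apply: le_trans rWle _; apply: ler_wiXn2l; [exact: ltW..|exact: Wsz].
  rewrite -lte_fin; apply: le_lt_trans mW; rewrite /mass (nneseriesD1 (fun i _ => p0 i) (meetk k)).
  apply: (@le_trans _ _ (p i)); first by rewrite leeDr// diam_pow_ge0.
  by rewrite leeDl// nneseries_ge0.
have rt1 : `|rho `^ t| < 1.
  have := @gt0_ltr_powR R t t0 rho 1; rewrite powR1 ger0_norm ?powR_ge0//.
  by apply; rewrite ?nnegrE// ltW.
have /cvgrPdist_lt := cvg_geometric (delta `^ t) rt1.
move=> /(_ _ (qi i)) [N _ /(_ N.+1 (leqnSn N))] /=.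
rewrite sub0r normrN ger0_norm; last by rewrite mulr_ge0// ?exprn_ge0// powR_ge0.
by move=> /lt_trans/(_ (small N)); rewrite ltxx.
Qed.

Lemma cover_lower_bound {R : realType} (r b : nat -> R) (rho t : R) (N : nat) (A : set R) :
  good_ifs r b rho ->
  (forall w : nat -> nat, (forall i, (0 < w i)%N) -> exists2 x, A x &
    forall m, (cylinder_map (ifs_map r b) w m @` `[0, 1]) x) ->
  0 < t -> 1 < \sum_(1 <= e < N.+1) r e `^ t ->
  exists2 c : R, 0 < c & forall U : nat -> set R, A `<=` \bigcup_i U i ->
    (c%:E <= \sum_(0 <= i <oo) diam_pow t (U i))%E.
Proof.
move=> G HA t0; set P := \sum_(1 <= e < N.+1) _ => P1.
have [u u0 bu] := good_ifs_exists_pos _ _ _ G.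
have /andP[ru _] := good_ratio _ _ _ G _ u0; have [bu0 bu1] := good_itv _ _ _ G _ u0.
have [n Pn] : exists n, 1 <= P ^+ n * r u `^ t.
  have P0 : 0 < P^-1 by rewrite invr_gt0 (lt_trans ltr01).
  have P1' : `|P^-1| < 1 by rewrite gtr0_norm// invf_lt1// (lt_trans ltr01).
  have rut : 0 < r u `^ t by rewrite powR_gt0.
  have /cvgrPdist_le/(_ _ rut)[n _ /(_ n (leqnn n))] := @cvg_expr R P^-1 P1'.
  rewrite sub0r normrN ger0_norm ?exprn_ge0 ?(ltW P0)// exprVn => h; exists n.
  by rewrite mulrC -ler_pdivrMr ?div1r// exprn_gt0// (lt_trans ltr01).
pose pre (f : {ffun 'I_n -> 'I_N}) := [seq (f i).+1 | i <- enum 'I_n].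
pose g f := rcons (pre f) u.
have prepos f : pos_word (pre f) by apply/allP => _ /mapP[i _ ->].
have gpos f : pos_word (g f) by rewrite /pos_word all_rcons u0; exact: prepos.
have gapE f x : word_map r b (g f) x = word_map r b (pre f) (ifs_map r b u x).
  by rewrite /word_map foldr_rcons.
(* Distinct prefixes have ordered images, and the final letter pushes the right-hand one at least
   [word_ratio r (pre f) * b u] off its left end. The minimum over finitely many words makes the gap
   uniform. *)
have [delta d0 dP] : exists2 delta : R, 0 < delta &
    forall f, delta <= word_ratio r (pre f) * b u.
  have F0 f : 0 < word_ratio r (pre f) * b u.
    by rewrite mulr_gt0//; have /andP[] := word_ratio_gt0 _ _ _ _ G (prepos f).
  exists (\big[Num.min/1]_(f : {ffun 'I_n -> 'I_N}) (word_ratio r (pre f) * b u)).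
    by elim/big_ind: _ => // x y x0 y0; rewrite lt_min x0.
  by move=> f; apply: bigmin_le_cond.
exists (delta `^ t) => [|U AU]; first by rewrite powR_gt0.
apply: (@separated_cover_lower_bound _ r b rho t delta A _ g) => //.
- by move=> f; rewrite size_rcons.
- apply: le_trans Pn _.
  have -> : \sum_f word_ratio r (g f) `^ t =
      \sum_(f : {ffun 'I_n -> 'I_N}) (\prod_(i < n) r (f i).+1 `^ t) * r u `^ t.
    apply: eq_bigr => f _; rewrite (word_ratio_powR _ _ _ _ _ G (gpos f)).
    by rewrite /g -cats1 big_cat big_seq1 /= /pre big_map big_enum.
  rewrite -mulr_suml -(bigA_distr_bigA (fun _ (j : 'I_N) => r j.+1 `^ t)) /=.
  by rewrite prodr_const card_ord /P big_add1 big_mkord.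
- move=> f f' x y ff' /andP[x0 x1] /andP[y0 y1].
  have itv z : 0 <= z <= 1 -> b u <= ifs_map r b u z <= 1.
    move=> /andP[z0 z1]; rewrite /ifs_map lerDr mulr_ge0 ?(ltW ru)//=.
    by rewrite (le_trans _ bu1)// addrC lerD2l ler_piMr// ltW.
  have pre_inj : pre f <> pre f'.
    move=> E; move/eqP: ff'; apply; apply/ffunP => i.
    have : nth 0%N (pre f) i = nth 0%N (pre f') i by rewrite E.
    rewrite !(nth_map i) -?enumT ?size_enum_ord// nth_ord_enum => -[] /val_inj //.
  have szE : size (pre f) = size (pre f') by rewrite !size_map.
  have key V W z z' : pos_word V -> pos_word W -> delta <= word_ratio r W * b u ->
      word_map r b V 1 <= word_map r b W 0 -> z <= 1 -> b u <= z' ->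
      delta <= word_map r b W z' - word_map r b V z.
    move=> Vp Wp dW h z1 z'b.
    have /andP[V0 _] := word_ratio_gt0 _ _ _ _ G Vp.
    have /andP[W0 _] := word_ratio_gt0 _ _ _ _ G Wp.
    have e1 := word_mapB r b W z' 0; have e2 := word_mapB r b V 1 z.
    have i1 : word_ratio r W * b u <= word_ratio r W * (z' - 0).
      by rewrite subr0 ler_pM2l.
    have i2 : 0 <= word_ratio r V * (1 - z) by rewrite mulr_ge0 ?subr_ge0// ltW.
    lra.
  rewrite !gapE.
  have /andP[ix0 ix1] : b u <= ifs_map r b u x <= 1 by apply: itv; rewrite x0.
  have /andP[iy0 iy1] : b u <= ifs_map r b u y <= 1 by apply: itv; rewrite y0.
  have [h|h] := word_map_disj _ _ _ _ _ G (prepos f) (prepos f') szE pre_inj.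
  + by rewrite distrC; apply: le_trans (ler_norm _); apply: key.
  + by apply: le_trans (ler_norm _); apply: key.
Qed.

Lemma hausdorff_dim_ifs {R : realType} (r b : nat -> R) (rho s0 : R) (A : set R) :
  good_ifs r b rho -> A `<=` ifs_points r b ->
  (forall w : nat -> nat, (forall i, (0 < w i)%N) -> exists2 x, A x &
    forall m, (cylinder_map (ifs_map r b) w m @` `[0, 1]) x) ->
  0 < s0 -> sums (fun e => r e `^ s0) 1 -> hausdorff_dim A = s0.
Proof.
move=> G AK HA s00 rs0.
have rho1 := good_lt1 _ _ _ G.
have rho0 : 0 < rho.
  by have /andP[h1 h2] := good_ratio _ _ _ G 1%N isT; apply: lt_le_trans h2.
have rpow x : 0 < x -> rho `^ x < 1.
  move=> x0; have := @gt0_ltr_powR R x x0 rho 1; rewrite powR1.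
  by apply; rewrite ?nnegrE// ltW.
have rdiff e x : (0 < e)%N -> 0 <= x -> 0 < r e `^ x <= rho `^ x.
  move=> e0 x0; have /andP[h1 h2] := good_ratio _ _ _ G _ e0.
  by rewrite powR_gt0//=; apply: ge0_ler_powR; rewrite ?nnegrE// ltW.
have above t : s0 < t -> hausdorff_measure t A = 0%E.
  move=> st; have t0 : 0 <= t by lra.
  have ts : 0 < t - s0 by lra.
  have [e e0|L rL /andP[L0 L1]] := sums_comp_ge0 (fun e => r e `^ t)
      (fun e => rho `^ (t - s0) * r e `^ s0) _ _ (sumsZ _ _ _ rs0).
    rewrite powR_ge0 /= -[in leLHS](subrK s0 t) (@powRD _ (r e)); last first.
      by have /andP[h1 _] := good_ratio _ _ _ G _ e0; rewrite [r e == 0]gt_eqF//; apply/implyP.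
    by rewrite ler_wpM2r ?powR_ge0//; have /andP[] := rdiff _ _ e0 (ltW ts).
  apply: (@hausdorff_measure_eq0 _ r b rho t L) => //.
  by apply: le_lt_trans L1 _; rewrite mulr1 rpow.
have below s : 0 <= s -> hausdorff_measure s A = 0%E -> s0 <= s.
  move=> s1 Hs; rewrite leNgt; apply/negP => ss0.
  (* The midpoint is a positive exponent even when s = 0. *)
  pose t := (s + s0) / 2; have st : s < t by rewrite /t; lra.
  have ts0 : t < s0 by rewrite /t; lra.
  have t0 : 0 < t by lra.
  clearbody t.
  have [N N1] : exists N, 1 < \sum_(1 <= e < N.+1) r e `^ t.
    have d0 : 0 < s0 - t by rewrite subr_gt0.
    have d1 := rpow _ d0.
    have e0 : 0 < 1 - rho `^ (s0 - t) by rewrite subr_gt0.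
    have /cvgrPdist_lt/(_ _ e0)[N _ /(_ N.+1 (leqnSn N))] := rs0.
    move=> hN; exists N.
    have : rho `^ (s0 - t) < \sum_(1 <= e < N.+1) r e `^ s0.
      by move: hN; rewrite ltr_norml => /andP[_]; lra.
    rewrite -[X in X < _]mulr1 => hN'; rewrite -(ltr_pM2l (powR_gt0 (s0 - t) rho0)).
    apply: lt_le_trans hN' _; rewrite mulr_sumr big_nat [leRHS]big_nat; apply: ler_sum => e /andP[e1 _].
    rewrite -[in leLHS](subrK t s0) (@powRD _ (r e)); last first.
      by have /andP[h1 _] := good_ratio _ _ _ G _ e1; rewrite [r e == 0]gt_eqF//; apply/implyP.
    by rewrite ler_wpM2r ?powR_ge0//; have /andP[] := rdiff _ _ e1 (ltW d0).
  have [c c0 cU] := cover_lower_bound _ _ _ _ _ _ G HA t0 N1.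
  (* Mesh 1 suffices: for sets of diameter at most 1 the weight with exponent s dominates the one
     with exponent t, which is at least c. *)
  have : (hausdorff_premeasure s 1 A < c%:E)%E.
    apply: (@le_lt_trans _ _ 0%E); last by rewrite lte_fin.
    by rewrite -Hs; apply: ereal_sup_ubound; exists 1 => /=.
  move=> /ereal_inf_lt[_ [U [AU U1] <-]]; apply/negP; rewrite -leNgt.
  apply: le_trans (cU U AU) _; apply: lee_nneseries => [*|i _]; first exact: diam_pow_ge0.
  by apply: diam_pow_le => //; rewrite s1 ltW.
rewrite /hausdorff_dim; set S := [set s | _].
have Slb : lbound S s0 by move=> s [s1 Hs]; exact: below.
have Sin t : s0 < t -> S t by move=> st; split; [lra|exact: above].
apply/eqP; rewrite eq_le; apply/andP; split.
  apply/ler_addgt0Pr => e e0; apply: ge_inf; first by exists s0.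
  by apply: Sin; rewrite ltrDl.
by apply: lb_le_inf => //; exists (s0 + 1); apply: Sin; rewrite ltrDl.
Qed.

(** * From the open set condition to the dimension of the limit set *)

(** The inclusions concern the open interval, so the conditions on its ends are recovered from test
    points: if an end of the image lay outside [0, 1], an explicit point of (0, 1) would be mapped
    outside (0, 1). *)
Lemma good_ifs_osc {R : realType} (r b : nat -> R) (rho : R) :
  rho < 1 -> (forall e, (0 < e)%N -> 0 < r e <= rho) ->
  (forall e, alphabet e -> ifs_map r b e @` `]0, 1[ `<=` `]0, 1[) ->
  trivIset alphabet (fun e => ifs_map r b e @` `]0, 1[) -> good_ifs r b rho.
Proof.
move=> rho1 hr hin hdisj; split => //.
- move=> e e0; have /andP[r0 _] := hr e e0.
  have sub x : 0 < x < 1 -> 0 < r e * x + b e < 1.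
    by move=> x01; have := hin e e0 (ifs_map r b e x); rewrite /= !in_itv /=; apply; exists x; rewrite /= ?in_itv.
  split; rewrite leNgt; apply/negP => h.
  + have d0 : 0 < r e - b e by lra.
    have /sub/andP[+ _] : 0 < - b e / (r e - b e) < 1.
      by rewrite divr_gt0 ?oppr_gt0//= ltr_pdivrMr//; lra.
    have -> : r e * (- b e / (r e - b e)) + b e = - (b e ^+ 2 / (r e - b e)).
      by field; rewrite gt_eqF.
    by rewrite oppr_gt0 ltNge divr_ge0 ?sqr_ge0// ltW.
  + pose c := b e + r e - 1; have c0 : 0 < c by rewrite /c; lra.
    have d0 : 0 < r e + c by lra.
    have /sub/andP[_] : 0 < r e / (r e + c) < 1.
      by rewrite divr_gt0//= ltr_pdivrMr//; lra.
    have -> : r e * (r e / (r e + c)) + b e = 1 + c ^+ 2 / (r e + c).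
      have -> : b e = c + 1 - r e by rewrite /c; ring.
      by field; rewrite gt_eqF.
    by rewrite ltNge lerDl divr_ge0 ?sqr_ge0// ltW.
- move=> e e' e0 e'0 ee'; case: (lerP (b e + r e) (b e')) => h1; first by left.
  case: (lerP (b e' + r e') (b e)) => h2; first by right.
  exfalso; apply: ee'; apply: hdisj => //.
  have /andP[r0 _] := hr e e0; have /andP[r'0 _] := hr e' e'0.
  have inn f x : 0 < r f -> b f < x -> x < b f + r f -> (ifs_map r b f @` `]0, 1[) x.
    move=> rf bx xb; exists ((x - b f) / r f); last by rewrite /ifs_map mulrCA divff ?gt_eqF// mulr1 subrK.
    by rewrite /= in_itv /= divr_gt0 ?subr_gt0//= ltr_pdivrMr//; lra.
  pose lo := Num.max (b e) (b e'); pose hi := Num.min (b e + r e) (b e' + r e').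
  have lohi : lo < hi by rewrite /lo /hi lt_min !gt_max; apply/andP; split; apply/andP; split; lra.
  have lo1 : b e <= lo by rewrite le_max lexx.
  have lo2 : b e' <= lo by rewrite le_max lexx orbT.
  have hi1 : hi <= b e + r e by rewrite ge_min lexx.
  have hi2 : hi <= b e' + r e' by rewrite ge_min lexx orbT.
  by exists ((lo + hi) / 2); split; apply: inn => //; lra.
Qed.

Lemma dim_limit_setE {R : realType} (a : R) (b : nat -> R) (eps rho s0 : R) :
  let r e := (5 ^+ e)^-1 + (a ^+ e)^-1 * eps in
  rho < 1 -> (forall e, (0 < e)%N -> 0 < r e <= rho) ->
  (forall e, alphabet e -> T a b eps e @` `]0, 1[ `<=` `]0, 1[) ->
  trivIset alphabet (fun e => T a b eps e @` `]0, 1[) ->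
  0 < s0 -> sums (fun e => r e `^ s0) 1 -> dim_limit_set a b eps = s0.
Proof.
move=> r rho1 hr hin hd s00 hs.
have G : good_ifs r b rho by exact: good_ifs_osc.
have Hc w : (forall i, (0 < w i)%N) -> forall m,
    (cylinder_map (T a b eps) w m @` `[0, 1]) (coding_map a b eps w).
  move=> w0 m; have /cid[x xw] := cylinders_meet _ _ _ w G w0.
  have := @getPex _ (\bigcap_m (cylinder_map (T a b eps) w m @` `[0, 1])) (ex_intro _ x xw).
  exact.
apply: (@hausdorff_dim_ifs _ r b rho) => //.
- by move=> _ [w w0 <-]; exists w => // m; exact: Hc.
- by move=> w w0; exists (coding_map a b eps w); [exists w|exact: Hc].
Qed.

(** * The formal expansion *)

Lemma coef_exp_congr {R : comNzRingType} (p p' : {poly R}) n :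
  (forall j, (j < n)%N -> p`_j = p'`_j) ->
  forall q j, (j < n)%N -> (p ^+ q)`_j = (p' ^+ q)`_j.
Proof.
move=> pp'; elim=> [|q IH] j jn; first by rewrite !expr0.
rewrite !exprS !coefM; apply: eq_bigr => i _.
rewrite pp' ?IH//; first by apply: leq_ltn_trans jn; rewrite leq_subr.
by apply: leq_ltn_trans jn; rewrite -ltnS.
Qed.

Lemma coef_exp_lt {R : comNzRingType} (p : {poly R}) : p`_0 = 0 ->
  forall q i, (i < q)%N -> (p ^+ q)`_i = 0.
Proof.
move=> p0; elim=> // q IH i iq; rewrite exprS coefM big1// => -[[|j] ji] _ /=.
  by rewrite p0 mul0r.
by rewrite IH ?mulr0//; lia.
Qed.

(** Without constant terms, a product of two or more factors reaches degree n through coefficients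
    of degree below n only. Hence the recursion for s_k involves s_k itself in the excluded pair (0,
    1) alone. *)
Lemma coef_exp2_congr {R : comNzRingType} (p p' : {poly R}) n :
  p`_0 = 0 -> p'`_0 = 0 -> (forall j, (j < n)%N -> p`_j = p'`_j) ->
  forall q, (p ^+ q.+2)`_n = (p' ^+ q.+2)`_n.
Proof.
move=> p0 p'0 pp' q; rewrite exprS [in RHS]exprS !coefM; apply: eq_bigr => -[[|i] ni] _ /=.
  by rewrite p0 p'0 !mul0r.
move: ni; rewrite ltnS leq_eqVlt => /predU1P[ni|ni].
  by rewrite -ni subnn !coef_exp_lt ?mulr0.
by rewrite pp'// (coef_exp_congr _ _ _ pp')//; lia.
Qed.

(** Course-of-values recursion: [G n] has its terms up to n settled, and the diagonal solves the
    equations because [Phi c k] looks only at indices strictly between 0 and k. *)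
Lemma recursive_sequence {R : realType} (Phi : (nat -> R) -> nat -> R) :
  (forall c c' k, (0 < k)%N -> (forall j, (0 < j < k)%N -> c j = c' j) -> Phi c k = Phi c' k) ->
  exists c : nat -> R, forall k, (0 < k)%N -> c k = Phi c k.
Proof.
move=> loc.
pose G := fix G n : nat -> R := if n is n'.+1 then
   (fun j => if j == n'.+1 then Phi (G n') n'.+1 else G n' j) else fun=> 0.
have Gs j n : (j <= n)%N -> G n j = G j j.
  elim: n => [|n IH]; first by rewrite leqn0 => /eqP ->.
  rewrite leq_eqVlt => /predU1P[->//|jn] /=.
  by rewrite ltn_eqF// IH.
exists (fun k => G k k) => -[//|k] _ /=; rewrite eqxx.
by apply: loc => // j /andP[_ jk]; apply: Gs.
Qed.

Definition seq_poly {R : realType} (c : nat -> R) (n : nat) : {poly R} :=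
  \sum_(1 <= j < n.+1) c j *: 'X^j.

Lemma coef_seq_poly {R : realType} (c : nat -> R) n j :
  (seq_poly c n)`_j = if (0 < j <= n)%N then c j else 0.
Proof.
rewrite /seq_poly coef_sum; case: ifP => jn; last first.
  rewrite big_nat big1// => i iN; rewrite coefZ coefXn.
  by case: eqP => [ji|_]; [move: jn; lia|rewrite mulr0].
have jI : j \in index_iota 1 n.+1 by rewrite mem_index_iota; lia.
rewrite (bigD1_seq j) ?iota_uniq//= coefZ coefXn eqxx mulr1 big1 ?addr0// => i ij.
by rewrite coefZ coefXn eq_sym (negbTE ij) mulr0.
Qed.

Lemma spow_seq_poly {R : realType} (c : nat -> R) q i n : (i <= n)%N ->
  spow c q i = (seq_poly c n ^+ q)`_i.
Proof.
move=> iN; apply: (coef_exp_congr _ _ i.+1) => // j ji.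
rewrite -/(seq_poly c i) !coef_seq_poly; congr (if _ then _ else _); lia.
Qed.

Lemma spow1 {R : realType} (c : nat -> R) i : (0 < i)%N -> spow c 1 i = c i.
Proof. by move=> i0; rewrite (spow_seq_poly _ _ _ i)// expr1 coef_seq_poly i0 leqnn. Qed.

Lemma spow_local {R : realType} (c c' : nat -> R) k v q : (v <= k)%N -> (v, q) != (0, 1)%N ->
  (forall j, (0 < j < k)%N -> c j = c' j) -> spow c q (k - v) = spow c' q (k - v).
Proof.
move=> vk vq cc'; rewrite !(spow_seq_poly _ _ _ k) ?leq_subr//.
have agree j : (j < k)%N -> (seq_poly c k)`_j = (seq_poly c' k)`_j.
  by move=> jk; rewrite !coef_seq_poly; case: ifP => // jk'; apply: cc'; lia.
case: v vk vq => [_|v vk _]; last by apply: (coef_exp_congr _ _ k agree); lia.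
rewrite subn0; case: q => [|[|q]] // _.
by apply: coef_exp2_congr => //; rewrite coef_seq_poly.
Qed.

(** For a < 5 the inner series diverge for large v, where the limit notation still denotes some
    number; the expansion then uses only indices up to the k for which all of them converge. *)
Lemma coef_rhs_sequence {R : realType} (a s0 : R) :
  exists c : nat -> R, forall k, (0 < k)%N -> c k = coef_rhs a s0 c k.
Proof.
apply: recursive_sequence => c c' k k0 cc'; rewrite /coef_rhs; congr (_ * _).
apply: eq_big_nat => v /andP[_ vk]; apply: eq_bigr => q vq; apply: eq_bigr => j _.
by rewrite (spow_local c c').
Qed.

Definition geo_moment {R : realType} (a : R) (v m : nat) : R :=
  \big[+%R/0]_(1 <= e <oo) (e%:R ^+ m * (5 ^+ v / (2 * a ^+ v)) ^+ e).

(** The coefficient of u^m in the sum over e of (5^v / (2 a^v))^e 5^(-e u). *)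
Definition exp_coef {R : realType} (a : R) (v m : nat) : R :=
  (- ln 5) ^+ m / m`!%:R * geo_moment a v m.

(** The coefficient of eps^v u^q in the formal expansion of the pressure at s0 + u: the binomial
    polynomial in u times the exponential series. *)
Definition press_coef {R : realType} (a s0 : R) (v q : nat) : R :=
  \sum_(0 <= j < (minn v q).+1) abinom v j s0 * exp_coef a v (q - j).

Lemma coef_rhsE {R : realType} (a s0 : R) c k :
  coef_rhs a s0 c k = (2 * ln 5)^-1 *
  \sum_(0 <= v < k.+1) \sum_(0 <= q < (k - v).+1 | (v, q) != (0%N, 1%N))
     spow c q (k - v) * press_coef a s0 v q.
Proof.
congr (_ * _); apply: eq_bigr => v _; apply: eq_bigr => q _.
rewrite /press_coef mulr_sumr; apply: eq_bigr => j _.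
by rewrite /exp_coef /geo_moment; ring.
Qed.

Definition press_trunc {R : realType} (a s0 : R) (k : nat) (eps u : R) : R :=
  \sum_(v < k.+1) \sum_(q < k.+2) press_coef a s0 v q * eps ^+ v * u ^+ q.

Lemma poly_bounded {R : realType} (p : {poly R}) :
  exists2 C, 0 <= C & forall x : R, 0 <= x <= 1 -> `|p.[x]| <= C.
Proof.
exists (\sum_(i < size p) `|p`_i|); first by apply: sumr_ge0.
move=> x /andP[x0 x1]; rewrite horner_coef.
apply: le_trans (ler_norm_sum _ _ _) _; apply: ler_sum => i _.
rewrite normrM ler_piMr// ger0_norm ?exprn_ge0//.
by apply: exprn_ile1.
Qed.

Lemma poly_low_bound {R : realType} (p : {poly R}) n :
  exists2 C, 0 <= C & forall x : R, 0 <= x <= 1 ->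
    `|p.[x] - \sum_(i < n) p`_i * x ^+ i| <= C * x ^+ n.
Proof.
have [C C0 Cp] := poly_bounded (drop_poly n p); exists C => // x x01.
rewrite -[in p.[x]](poly_take_drop n p) hornerD hornerM hornerXn.
have -> : (take_poly n p).[x] = \sum_(i < n) p`_i * x ^+ i.
  by rewrite /take_poly horner_poly.
rewrite addrC addKr normrM.
have /andP[x0 _] := x01.
by rewrite [`|x ^+ n|]ger0_norm ?exprn_ge0// ler_wpM2r ?exprn_ge0// Cp.
Qed.

Lemma press_trunc_seq {R : realType} (a s0 : R) (c : nat -> R) k :
  press_coef a s0 0 0 = 1 -> press_coef a s0 0 1 = - (2 * ln 5) ->
  (forall i, (0 < i <= k)%N -> c i = coef_rhs a s0 c i) ->
  exists2 C, 0 <= C & forall eps : R, 0 <= eps <= 1 ->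
    `|press_trunc a s0 k eps (seq_poly c k).[eps] - 1| <= C * eps ^+ k.+1.
Proof.
move=> p00 p01 hc; pose W := seq_poly c k.
pose P := \sum_(v < k.+1) \sum_(q < k.+2) press_coef a s0 v q *: ('X^v * W ^+ q).
have [C C0 CP] := poly_low_bound P k.+1; exists C => // eps eps01.
have -> : press_trunc a s0 k eps W.[eps] = P.[eps].
  rewrite [RHS]horner_sum; apply: eq_bigr => v _; rewrite [RHS]horner_sum; apply: eq_bigr => q _.
  by rewrite hornerZ hornerM hornerXn horner_exp mulrA.
suff -> : 1 = \sum_(i < k.+1) P`_i * eps ^+ i by exact: CP.
(* The factor X^v kills v > i, and W^q kills q > i - v because W has no constant term; both cut-offs
   of [press_trunc] lie beyond these ranges. *)
have PE i : (i <= k)%N -> P`_i = \sum_(0 <= v < i.+1) \sum_(0 <= q < (i - v).+1)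
    spow c q (i - v) * press_coef a s0 v q.
  move=> ik; rewrite coef_sum -(big_mkord xpredT (fun v => (\sum_(q < k.+2) press_coef a s0 v q *: ('X^v * W ^+ q))`_i)).
  rewrite (big_cat_nat _ (n := i.+1))//= [X in _ + X]big_nat [X in _ + X]big1 ?addr0; last first.
    move=> v /andP[iv _]; rewrite coef_sum big1// => q _.
    by rewrite coefZ coefXnM iv mulr0.
  apply: eq_big_nat => v /andP[_ vi]; rewrite coef_sum.
  rewrite -(big_mkord xpredT (fun q => (press_coef a s0 v q *: ('X^v * W ^+ q))`_i)).
  rewrite (big_cat_nat _ (n := (i - v).+1))//=; last by lia.
  rewrite [X in _ + X]big_nat [X in _ + X]big1 ?addr0; last first.
    move=> q /andP[iq _]; rewrite coefZ coefXnM ltnNge -ltnS vi /=.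
    by rewrite coef_exp_lt ?mulr0// coef_seq_poly.
  apply: eq_big_nat => q _; rewrite coefZ coefXnM ltnNge -ltnS vi /= mulrC.
  by rewrite (spow_seq_poly _ _ _ k)//; lia.
rewrite big_ord_recl /= expr0 mulr1 PE// big_nat1 big_nat1 /spow expr0 coef1 eqxx mul1r p00.
rewrite big1 ?addr0// => i _; rewrite /bump /= add1n; set j := i.+1.
have jk : (0 < j <= k)%N by rewrite /j /=.
suff -> : P`_j = 0 by rewrite mul0r.
rewrite PE; last by have /andP[] := jk.
have ln5 : ln 5 != 0 :> R by rewrite gt_eqF// ln_gt0// ltr1n.
have := hc j jk; rewrite coef_rhsE => /(congr1 (fun x => 2 * ln 5 * x)).
rewrite mulrA divff ?mulf_neq0// mul1r => hcj.
(* The pair (0, 1) contributes - 2 ln 5 times c j, and the recursion says that the other pairs add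
   up to 2 ln 5 times c j. *)
rewrite big_ltn// subn0 (bigD1_seq 1%N) ?iota_uniq ?mem_index_iota//= p01 spow1//.
rewrite big_ltn// subn0 -/j in hcj; move: hcj.
have -> : \sum_(0 <= q < j.+1 | (0%N, q) != (0%N, 1%N)) spow c q j * press_coef a s0 0 q =
   \sum_(0 <= q < j.+1 | q != 1%N) spow c q j * press_coef a s0 0 q.
  by apply: eq_bigl.
have -> : \sum_(1 <= v < j.+1) \sum_(0 <= q < (j - v).+1 | (v, q) != (0%N, 1%N))
    spow c q (j - v) * press_coef a s0 v q =
  \sum_(1 <= v < j.+1) \sum_(0 <= q < (j - v).+1) spow c q (j - v) * press_coef a s0 v q.
  by apply: eq_big_nat => -[//|v] _; apply: eq_bigl.
by move=> hcj; rewrite -addrA -hcj mulrN [c j * _]mulrC addNr.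
Qed.

(** Once u - w is factored out of a monomial other than u itself, at least one factor eps, u or w
    remains, and each is at most h. *)
Lemma press_trunc_lipschitz {R : realType} (a s0 : R) k :
  press_coef a s0 0 1 = - (2 * ln 5) ->
  exists2 C, 0 <= C & forall h eps u w : R, 0 <= eps <= h -> h <= 1 -> `|u| <= h -> `|w| <= h ->
    `|press_trunc a s0 k eps u - press_trunc a s0 k eps w + 2 * ln 5 * (u - w)|
      <= C * h * `|u - w|.
Proof.
move=> p01; pose K v q := `|press_coef a s0 v q| * q%:R.
have K0 v q : 0 <= K v q by rewrite mulr_ge0.
exists (\sum_(v < k.+1) \sum_(q < k.+2) K v q).
  by apply: sumr_ge0 => v _; apply: sumr_ge0 => q _; exact: K0.
move=> h eps u w /andP[e0 eh] h1 uh wh.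
have h0 : 0 <= h := le_trans e0 eh.
have powB q : `|u ^+ q.+1 - w ^+ q.+1| <= q.+1%:R * h ^+ q * `|u - w|.
  rewrite subrXX normrM mulrC ler_wpM2r//.
  apply: le_trans (ler_norm_sum _ _ _) _.
  rewrite mulr_natl -[X in _ *+ X](card_ord q.+1) -sumr_const; apply: ler_sum => i _.
  rewrite normrM !normrX.
  have -> : h ^+ q = h ^+ (q.+1.-1 - i) * h ^+ i by rewrite -exprD subnK// -ltnS.
  by apply: ler_pM; rewrite ?exprn_ge0//; apply: lerXn2r; rewrite ?nnegrE.
have term v q : (v, q) != (0%N, 1%N) ->
    `|press_coef a s0 v q * eps ^+ v * (u ^+ q - w ^+ q)| <= K v q * h * `|u - w|.
  move=> vq; rewrite !normrM (ger0_norm (exprn_ge0 _ e0)).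
  case: q vq => [|q] vq; first by rewrite !expr0 subrr normr0 mulr0 mulr_ge0// mulr_ge0.
  rewrite /K -!mulrA ler_wpM2l//.
  apply: (@le_trans _ _ (eps ^+ v * (q.+1%:R * h ^+ q * `|u - w|))).
    by rewrite ler_wpM2l ?exprn_ge0// powB.
  have -> : eps ^+ v * (q.+1%:R * h ^+ q * `|u - w|) = q.+1%:R * (eps ^+ v * h ^+ q * `|u - w|) by ring.
  rewrite ler_wpM2l// ler_wpM2r//.
  apply: (@le_trans _ _ (h ^+ v * h ^+ q)).
    by rewrite ler_wpM2r ?exprn_ge0//; apply: lerXn2r; rewrite ?nnegrE.
  rewrite -exprD -[leRHS]expr1; apply: ler_wiXn2l => //.
  by case: v vq => [|v] //; case: q.
rewrite /press_trunc -sumrB.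
under eq_bigr do rewrite -sumrB.
under eq_bigr => v _ do under eq_bigr => q _ do rewrite -mulrBr.
rewrite (bigD1 ord0)//= (bigD1 (Ordinal (isT : (1 < k.+2)%N)))//= p01 expr0 mulr1 !expr1.
rewrite [leRHS](_ : _ = \sum_(v < k.+1) \sum_(q < k.+2) K v q * h * `|u - w|); last first.
  rewrite -mulrA mulr_suml; apply: eq_bigr => v _; rewrite mulr_suml.
  by apply: eq_bigr => q _; rewrite mulrA.
set X := \sum_(i < k.+2 | _) _; set Y := \sum_(i < k.+1 | i != ord0) _.
have -> : - (2 * ln 5) * (u - w) + X + Y + 2 * ln 5 * (u - w) = X + Y by ring.
apply: le_trans (ler_normD _ _) _.
rewrite [leRHS](bigD1 ord0)//=; apply: lerD.
- apply: le_trans (ler_norm_sum _ _ _) _.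
  rewrite [leRHS](bigD1 (Ordinal (isT : (1 < k.+2)%N)))//=.
  apply: ler_wpDl; first by rewrite !mulr_ge0.
  by apply: ler_sum => q q1; apply: term; apply: contra q1 => /eqP[q1]; apply/eqP/val_inj.
- apply: le_trans (ler_norm_sum _ _ _) _; apply: ler_sum => v v0.
  apply: le_trans (ler_norm_sum _ _ _) _; apply: ler_sum => q _; apply: term.
  by apply: contra v0 => /eqP[v0 _]; apply/eqP/val_inj.
Qed.

Lemma abinom_gt {R : realType} (s0 : R) v j : (v < j)%N -> abinom v j s0 = 0.
Proof.
move=> vj; rewrite /abinom nth_default// size_comp_poly2 ?size_XaddC//.
apply: leq_trans vj; apply: leq_trans (size_scale_leq _ _) _.
by rewrite size_prod_XsubC /index_enum -enumT size_enum_ord.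
Qed.

(** The sum up to min (v, q) in [press_coef] is a full Cauchy product, since [abinom v j s0]
    vanishes for j > v. *)
Lemma press_coef_product {R : realType} (a s0 : R) k v :
  exists2 C, 0 <= C & forall u : R, 0 <= u <= 1 ->
    `|binom (s0 + u) v * (\sum_(m < k.+2) exp_coef a v m * u ^+ m)
      - \sum_(q < k.+2) press_coef a s0 v q * u ^+ q| <= C * u ^+ k.+2.
Proof.
pose P := binomial_poly v \Po ('X + s0%:P); pose Q := \poly_(m < k.+2) exp_coef a v m.
have [C C0 CP] := poly_low_bound (P * Q) k.+2; exists C => // u u01.
have := CP u u01; rewrite hornerM horner_comp hornerD hornerX hornerC horner_poly [u + s0]addrC -/(binom _ _).
suff -> : \sum_(i < k.+2) (P * Q)`_i * u ^+ i =
  \sum_(q < k.+2) press_coef a s0 v q * u ^+ q by [].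
apply: eq_bigr => q _; congr (_ * _); rewrite coefM /press_coef.
rewrite -(big_mkord xpredT (fun j => P`_j * Q`_(q - j))).
rewrite (big_cat_nat _ (n := (minn v q).+1))//=; last by rewrite ltnS geq_minr.
rewrite [X in _ + X]big_nat [X in _ + X]big1 ?addr0; last first.
  by move=> j /andP[vj jq]; rewrite -/(abinom v j s0) abinom_gt ?mul0r//; lia.
apply: eq_bigr => j _; rewrite coef_poly ifT//.
by apply: leq_ltn_trans (ltn_ord q); rewrite leq_subr.
Qed.

Lemma seq_poly_linear_bound {R : realType} (c : nat -> R) k :
  exists2 C, 0 <= C & forall eps : R, 0 <= eps <= 1 -> `|(seq_poly c k).[eps]| <= C * eps.
Proof.
have [C C0 hC] := poly_low_bound (seq_poly c k) 1; exists C => // eps e01.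
by have := hC eps e01; rewrite big_ord1 coef_seq_poly /= mul0r subr0 expr1.
Qed.

Lemma horner_seq_poly {R : realType} (c : nat -> R) k (eps : R) :
  (seq_poly c k).[eps] = \sum_(1 <= i < k.+1) c i * eps ^+ i.
Proof. by rewrite horner_sum; apply: eq_bigr => i _; rewrite hornerZ hornerXn. Qed.

(** * The pressure equation *)

(** A fraction z / (x + y) in [0, 1] is at most its power t; the two fractions add up to 1.
    Subadditivity bounds the pressure by two geometric series. *)
Lemma powR_subadd {R : realType} (x y t : R) : 0 <= x -> 0 <= y -> 0 <= t <= 1 ->
  (x + y) `^ t <= x `^ t + y `^ t.
Proof.
move=> x0 y0 /andP[t0 t1].
have [xy|xy] := eqVneq (x + y) 0.
  have -> : x = 0 by lra.
  by rewrite add0r lerDr powR_ge0.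
have xy0 : 0 < x + y by rewrite lt_neqAle eq_sym xy addr_ge0.
have key z : 0 <= z -> z <= x + y -> z / (x + y) * (x + y) `^ t <= z `^ t.
  move=> z0 zxy; have [->|zn] := eqVneq z 0; first by rewrite !mul0r powR_ge0.
  have zp : 0 < z by rewrite lt_neqAle eq_sym zn.
  rewrite -[in leRHS](divfK xy z) powRM ?divr_ge0 ?(ltW xy0)// ler_wpM2r ?powR_ge0//.
  by apply: ger1_powR => //; rewrite divr_gt0//= ler_pdivrMr// mul1r.
apply: le_trans (lerD (key x x0 _) (key y y0 _)); rewrite ?lerDl ?lerDr//.
by rewrite -mulrDl -mulrDl divff// mul1r.
Qed.

(** A Lipschitz bound in the exponent costs a factor |ln x|, unbounded over the letters. The spare
    exponent tau < s absorbs it, as y exp (- (s - tau) y) <= 1 / (s - tau). *)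
Lemma press_lipschitz {R : realType} (x tau s t t' : R) : 0 < x <= 1 -> tau < s ->
  s <= t -> t <= t' -> 0 <= x `^ t - x `^ t' <= (t' - t) * ((s - tau)^-1 * x `^ tau).
Proof.
move=> /andP[x0 x1] ts st tt'.
rewrite subr_ge0 ger_powR ?x0//=.
pose y := - ln x; have y0 : 0 <= y by rewrite oppr_ge0 ln_le0.
have xE z : x `^ z = expR (- (z * y)).
  by rewrite /powR gt_eqF// /y mulrN opprK.
have h1 : 1 - expR (- ((t' - t) * y)) <= (t' - t) * y.
  by have := expR_ge1Dx (- ((t' - t) * y)); lra.
have h2 : expR (- ((t - tau) * y)) * y <= (s - tau)^-1.
  rewrite mulrC -ler_pdivlMr ?expR_gt0// -expRN opprK ler_pdivlMl ?subr_gt0//.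
  have := expR_ge1Dx ((t - tau) * y).
  have : (s - tau) * y <= (t - tau) * y by rewrite ler_wpM2r// lerD2r.
  lra.
have e1 : x `^ t' = x `^ t * expR (- ((t' - t) * y)).
  by rewrite !xE -expRD; congr expR; ring.
have e2 : x `^ t = x `^ tau * expR (- ((t - tau) * y)).
  by rewrite !xE -expRD; congr expR; ring.
have -> : x `^ t - x `^ t' = x `^ t * (1 - expR (- ((t' - t) * y))) by rewrite e1; ring.
apply: (@le_trans _ _ (x `^ t * ((t' - t) * y))); first by rewrite ler_wpM2l ?powR_ge0.
have -> : x `^ t * ((t' - t) * y) = (t' - t) * (expR (- ((t - tau) * y)) * y * x `^ tau).
  by rewrite e2; ring.
by rewrite ler_wpM2l ?subr_ge0// ler_wpM2r ?powR_ge0.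
Qed.

Lemma press_root {R : realType} (r : nat -> R) (tau s t L L' M : R) :
  (forall e, (0 < e)%N -> 0 < r e <= 1) -> tau < s -> s <= t ->
  sums (fun e => r e `^ tau) M -> sums (fun e => r e `^ s) L ->
  sums (fun e => r e `^ t) L' -> 1 <= L -> L' <= 1 ->
  exists2 x, s <= x <= t & sums (fun e => r e `^ x) 1.
Proof.
move=> hr taus st hM hL hL' L1 L'1.
(* For x >= s the series is dominated by the one at tau; elsewhere the value is a dummy. *)
have ex x : exists l, s <= x -> sums (fun e => r e `^ x) l.
  case: (lerP s x) => sx; last by exists 0.
  have [e e0|l hl _] := sums_comp_ge0 (fun e => r e `^ x) _ _ _ hM; last by exists l.
  by rewrite powR_ge0 ger_powR ?hr//; lra.
have [P hP] := choice ex.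
have PB x y : s <= x -> x <= y -> 0 <= P x - P y <= (y - x) * ((s - tau)^-1 * M).
  move=> sx xy; have sy := le_trans sx xy.
  have h1 := sumsB _ _ _ _ (hP x sx) (hP y sy).
  have h2 := sumsZ (y - x) _ _ (sumsZ (s - tau)^-1 _ _ hM).
  apply/andP; split.
    by apply: sums_le sums0 h1 => e e0; have /andP[] := press_lipschitz _ _ _ _ _ (hr e e0) taus sx xy.
  by apply: sums_le h1 h2 => e e0; have /andP[] := press_lipschitz _ _ _ _ _ (hr e e0) taus sx xy.
have PL : P s = L by apply: sums_unique (hP s (lexx s)) hL.
have PL' : P t = L' by apply: sums_unique (hP t st) hL'.
set K := (s - tau)^-1 * M in PB.
have K0 : 0 <= K.
  rewrite mulr_ge0 ?invr_ge0 ?subr_ge0 ?(ltW taus)//.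
  by apply: sums_le sums0 hM => e _; exact: powR_ge0.
(* Constant continuation to the left of s, which makes the pressure continuous on the whole line. *)
pose Q x := P (Num.max s x).
have QB x y : x <= y -> `|Q x - Q y| <= (y - x) * K.
  move=> xy; have mxy : Num.max s x <= Num.max s y by rewrite ge_max !le_max lexx xy orbT.
  have sx : s <= Num.max s x by rewrite le_max lexx.
  have /andP[h1 h2] := PB _ _ sx mxy.
  rewrite /Q ger0_norm//; apply: le_trans h2 _; apply: ler_wpM2r => //.
  by case: (lerP s x) => h; case: (lerP s y) => h'; lra.
have Qc : continuous Q.
  move=> x; apply/cvgrPdist_le => e e0.
  have d0 : 0 < e / (K + 1) by rewrite divr_gt0// ltr_wpDl.
  near=> y.
  have yd : `|x - y| <= e / (K + 1) by near: y; exact: cvgr_dist_le.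
  apply: (@le_trans _ _ (`|x - y| * K)).
    case: (lerP x y) => xy; first exact: QB.
    by rewrite distrC; apply: QB; exact: ltW.
  apply: (@le_trans _ _ (e / (K + 1) * K)); first by rewrite ler_wpM2r.
  rewrite -mulrA ler_piMr ?(ltW e0)// mulrC ler_pdivrMr ?ltr_wpDl// mul1r; lra.
have [|x xst Px] := @IVT _ Q s t 1 st (continuous_subspaceT Qc).
  rewrite /Q maxxx (max_r st) PL PL' ge_min le_max L'1 L1 orbT//.
have /andP[sx xt] : s <= x <= t by move: xst; rewrite in_itv.
exists x; first by rewrite sx.
by rewrite -Px /Q (max_r sx); apply: hP.
Unshelve. all: by end_near. Qed.

Lemma ln5_gt0 {R : realType} : 0 < ln 5 :> R.
Proof. by rewrite ln_gt0// ltr1n. Qed.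

Lemma dim0_bounds {R : realType} : 0 < (ln 2 / ln 5 : R) < 1.
Proof.
rewrite divr_gt0 ?ln5_gt0 ?ln_gt0 ?ltr1n//= ltr_pdivrMr ?ln5_gt0// mul1r.
by rewrite ltr_ln ?posrE// ltr_nat.
Qed.

Lemma powR5_dim0 {R : realType} : 5 `^ (- (ln 2 / ln 5)) = 2^-1 :> R.
Proof.
rewrite powRN; congr (_^-1); rewrite /powR pnatr_eq0 /= divfK ?gt_eqF ?ln5_gt0//.
by rewrite lnK// posrE.
Qed.

Lemma powR_expV {R : realType} (x t : R) e : 0 < x -> (x ^+ e)^-1 `^ t = (x `^ (- t)) ^+ e.
Proof.
move=> x0; have xe : 0 < x ^+ e by rewrite exprn_gt0.
rewrite /powR !gt_eqF ?invr_gt0// lnV ?posrE// lnXn// -expRM_natl -mulr_natl.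
by congr expR; ring.
Qed.

Definition ratio {R : realType} (a eps : R) (e : nat) : R :=
  (5 ^+ e)^-1 + (a ^+ e)^-1 * eps.

(** The bound 7/10 is 1/5 + 1/2, a contraction rate valid for all letters and all small eps. *)
Lemma ratio_bounds {R : realType} (a eps : R) e : 1 < a -> 0 <= eps <= 1 / 2 ->
  (0 < e)%N -> 0 < ratio a eps e <= 7 / 10.
Proof.
move=> a1 /andP[e0 e1]; case: e => // n _.
have inv_le (x : R) : 1 < x -> 0 < (x ^+ n.+1)^-1 <= x^-1.
  move=> x1; have x0 : 0 < x by lra.
  rewrite invr_gt0 exprn_gt0//= lef_pV2 ?posrE ?exprn_gt0//.
  by rewrite exprS ler_peMr ?(ltW x0)// exprn_ege1// ltW.
have /andP[h1 h2] := inv_le 5 (ltac:(by rewrite ltr1n)).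
have /andP[h3 h4] := inv_le a a1.
have h5 : a^-1 <= 1 by rewrite invf_le1 ?(ltW a1)// (lt_trans ltr01).
have h6 : 0 <= (a ^+ n.+1)^-1 * eps by rewrite mulr_ge0// ltW.
have h7 : (a ^+ n.+1)^-1 * eps <= 1 * eps by rewrite ler_wpM2r// (le_trans h4).
rewrite /ratio; apply/andP; split; first lra.
have : (5 : R)^-1 = 2 / 10 by field.
lra.
Qed.

Lemma ratio_powR_le {R : realType} (a eps t : R) e : 1 < a -> 0 <= eps -> 0 < t <= 1 ->
  ratio a eps e `^ t <= (5 `^ (- t)) ^+ e + eps `^ t * (a `^ (- t)) ^+ e.
Proof.
move=> a1 e0 /andP[t0 t1]; have a0 : 0 < a := lt_trans ltr01 a1.
have ae : 0 <= (a ^+ e)^-1 by rewrite invr_ge0 exprn_ge0// ltW.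
apply: le_trans (powR_subadd _ _ _ _ _ _) _; rewrite ?invr_ge0 ?exprn_ge0 ?mulr_ge0 ?(ltW t0)//.
by rewrite powRM// !powR_expV// mulrC.
Qed.

Lemma powRN_lt1 {R : realType} (x t : R) : 1 < x -> 0 < t -> 0 < x `^ (- t) < 1.
Proof.
move=> x1 t0; have x0 : 0 < x := lt_trans ltr01 x1.
rewrite powR_gt0//= powRN invf_lt1 ?powR_gt0//.
have := @gt0_ltr_powR R t t0 1 x; rewrite powR1; apply; rewrite ?nnegrE// ltW//.
Qed.

Lemma press_sums {R : realType} (a eps t : R) : 1 < a -> 0 <= eps -> 0 < t <= 1 ->
  exists2 l, sums (fun e => ratio a eps e `^ t) l &
    l <= 5 `^ (- t) / (1 - 5 `^ (- t)) + eps `^ t * (a `^ (- t) / (1 - a `^ (- t))).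
Proof.
move=> a1 e0 t01; have /andP[t0 t1] := t01.
have /andP[f0 f1] := @powRN_lt1 R 5 t (ltac:(by rewrite ltr1n)) t0.
have /andP[g0 g1] := powRN_lt1 _ _ a1 t0.
have h5 := sums_geo (5 `^ (- t)) (ltac:(by rewrite gtr0_norm)).
have ha := sums_geo (a `^ (- t)) (ltac:(by rewrite gtr0_norm)).
have [e _|l hl /andP[_ ll]] := sums_comp_ge0 (fun e => ratio a eps e `^ t) _ _ _
   (sumsD _ _ _ _ h5 (sumsZ (eps `^ t) _ _ ha)); last by exists l.
by rewrite powR_ge0 ratio_powR_le.
Qed.

(** The root is bracketed. At s0 the sum is at least 1 because eps >= 0 only enlarges the ratios;
    slightly above s0 the unperturbed sum is below 1 and leaves room for the perturbation. *)
Lemma press_solution {R : realType} (a d : R) : 1 < a -> 0 < d ->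
  exists2 h : R, 0 < h & forall eps, 0 <= eps <= h ->
    exists2 u, 0 <= u <= d & sums (fun e => ratio a eps e `^ (ln 2 / ln 5 + u)) 1.
Proof.
move=> a1 d0; have /andP[s0 s1] := @dim0_bounds R.
have s5 := @powR5_dim0 R; move: s0 s1 s5; set s := ln 2 / ln 5 => s0 s1 s5.
(* Keeps the upper end t of the bracket at most 1, as subadditivity of the power requires. *)
pose d' := Num.min d (1 - s).
have d'0 : 0 < d' by rewrite lt_min d0 subr_gt0.
have d'd : d' <= d by rewrite ge_min lexx.
have d's : d' <= 1 - s by rewrite ge_min lexx orbT.
clearbody d'.
pose t := s + d'; have t01 : 0 < t <= 1 by rewrite /t; lra.
have st : s < t by rewrite /t; lra.
have /andP[t0 t1] := t01.
have /andP[g0 g1] := powRN_lt1 _ _ a1 t0.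
have z2 : 5 `^ (- t) < 2^-1 :> R.
  rewrite -s5 !powRN ltf_pV2 ?posrE ?powR_gt0//.
  have h1 : (1 : R) < 5 by rewrite ltr1n.
  rewrite /powR pnatr_eq0 /= ltr_expR ltr_pM2r ?ln5_gt0//.
have z0 : 0 < 5 `^ (- t) :> R by rewrite powR_gt0.
set A := a `^ (- t) / (1 - a `^ (- t)); have A0 : 0 < A by rewrite divr_gt0 ?subr_gt0.
pose g := 1 - 5 `^ (- t) / (1 - 5 `^ (- t)).
have gp : 0 < g by rewrite subr_gt0 ltr_pdivrMr; lra.
(* Here g is the slack of the unperturbed sum at t, and A eps^t bounds the perturbation; the second
   term solves A h^t = g. *)
pose h := Num.min (1 / 2) ((g / A) `^ (t^-1)).
have h0 : 0 < h by rewrite lt_min !divr_gt0 ?ltr01//= powR_gt0// divr_gt0.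
exists h => // eps /andP[e0 eh].
have e12 : eps <= 1 / 2 by apply: le_trans eh _; rewrite ge_min lexx.
have r01 e : (0 < e)%N -> 0 < ratio a eps e <= 1.
  move=> e1; have /andP[-> h2] /= := @ratio_bounds _ a eps e a1 (ltac:(by rewrite e0)) e1.
  by apply: le_trans h2 _; lra.
have [M hM _] := @press_sums _ a eps (s / 2) a1 e0 (ltac:(lra)).
have [L hL _] := @press_sums _ a eps s a1 e0 (ltac:(lra)).
have [L' hL' L'le] := @press_sums _ a eps t a1 e0 t01.
have L1 : 1 <= L.
  apply: sums_le (@sums_geo_half R) hL => e e1.
  rewrite -s5 -powR_expV//; apply: ge0_ler_powR; rewrite ?nnegrE ?invr_ge0 ?exprn_ge0 ?(ltW s0)//.
    by have /andP[/ltW] := r01 e e1.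
  by rewrite /ratio lerDl mulr_ge0// invr_ge0 exprn_ge0// (le_trans ler01)// ltW.
have L'1 : L' <= 1.
  apply: le_trans L'le _; rewrite -/A.
  suff : eps `^ t * A <= g by rewrite /g; lra.
  rewrite -ler_pdivlMr//.
  apply: (@le_trans _ _ (((g / A) `^ (t^-1)) `^ t)).
    apply: ge0_ler_powR; rewrite ?nnegrE ?powR_ge0 ?(ltW t0)//.
    by apply: le_trans eh _; rewrite ge_min lexx orbT.
  by rewrite -powRrM mulVf ?gt_eqF// powRr1// divr_ge0// ltW.
have [x /andP[sx xt] hx] := press_root _ _ _ _ _ _ _ r01 (ltac:(lra) : s / 2 < s) (ltW st) hM hL hL' L1 L'1.
exists (x - s); last by rewrite addrC subrK.
by rewrite subr_ge0 sx /=; rewrite /t in xt; lra.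
Qed.

Lemma dim_limit_set_near {R : realType} (a : R) (b : nat -> R) : 1 < a -> ifs_osc a b ->
  forall d : R, 0 < d -> exists2 h : R, 0 < h & forall eps, 0 <= eps <= h ->
    exists2 u, 0 <= u <= d & dim_limit_set a b eps = ln 2 / ln 5 + u /\
      sums (fun e => ratio a eps e `^ (ln 2 / ln 5 + u)) 1.
Proof.
move=> a1 [eta eta0 /nbhs_ballP[h1 /= h10 hb]] d d0.
have [h2 h20 hs] := press_solution _ _ a1 d0.
pose h := Num.min (h1 / 2) (Num.min h2 (1 / 2)).
have hh1 : h <= h1 / 2 by rewrite ge_min lexx.
have hh2 : h <= h2 by rewrite !ge_min lexx orbT.
have hh3 : h <= 1 / 2 by rewrite !ge_min lexx !orbT.
exists h; first by rewrite !lt_min h20 !divr_gt0.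
move=> eps /andP[e0 eh].
have [u /andP[u0 ud] hu] := hs eps (ltac:(apply/andP; split; lra)).
exists u; first by rewrite u0.
split => //.
have [hin _ hd] := hb eps (ltac:(rewrite /ball /= sub0r normrN ger0_norm//; lra)) e0.
have /andP[s0 _] := @dim0_bounds R.
apply: (@dim_limit_setE _ a b eps (7 / 10)) => //; [lra| |lra].
by move=> e e1; apply: ratio_bounds => //; apply/andP; split; lra.
Qed.

(** At eps = 0 the preceding estimate holds for every d > 0, which squeezes the dimension to s0. *)
Lemma dim_limit_set_at0 {R : realType} (a : R) (b : nat -> R) : 1 < a -> ifs_osc a b ->
  dim_limit_set a b 0 = ln 2 / ln 5.
Proof.
move=> a1 hb; apply/eqP; rewrite eq_le; apply/andP; split.
  apply/ler_addgt0Pr => d d0; have [h h0 H] := dim_limit_set_near _ _ a1 hb _ d0.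
  have [u /andP[_ ud] [-> _]] := H 0 (ltac:(by rewrite lexx ltW)).
  by rewrite lerD2l.
have [h h0 H] := dim_limit_set_near _ _ a1 hb _ ltr01.
have [u /andP[u0 _] [-> _]] := H 0 (ltac:(by rewrite lexx ltW)).
by rewrite lerDl.
Qed.

Lemma ratio_powRE {R : realType} (a eps u : R) e : 1 < a -> 0 <= eps ->
  ratio a eps e `^ (ln 2 / ln 5 + u) =
  2^-1 ^+ e * expR (- (e%:R * (u * ln 5))) * (1 + (5 / a) ^+ e * eps) `^ (ln 2 / ln 5 + u).
Proof.
move=> a1 e0; have a0 : 0 < a := lt_trans ltr01 a1.
have -> : ratio a eps e = (5 ^+ e)^-1 * (1 + (5 / a) ^+ e * eps).
  rewrite /ratio expr_div_n; field; rewrite !expf_neq0 ?gt_eqF//.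
have p0 : 0 <= 1 + (5 / a) ^+ e * eps.
  by rewrite addr_ge0// mulr_ge0// exprn_ge0// divr_ge0// ltW.
rewrite powRM ?invr_ge0 ?exprn_ge0//; congr (_ * _).
rewrite powR_expV// opprD powRD ?pnatr_eq0 ?implybT// powR5_dim0 exprMn; congr (_ * _).
by rewrite /powR pnatr_eq0 /= -expRM_natl; congr expR; ring.
Qed.

(** * Expansion of the pressure through moments *)

(** Taylor expansion under the sum: the remainder for letter e is at most (e v)^n / n!, so the
    remainders sum to the moment of order n. *)
Lemma exp_moment {R : realType} (z v : R) (B : nat -> R) (n : nat) : 0 < z < 1 -> 0 <= v ->
  (forall m, sums (fun e => e%:R ^+ m * z ^+ e) (B m)) ->
  exists2 S, sums (fun e => z ^+ e * expR (- (e%:R * v))) S &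
    `|S - \sum_(m < n) (-1) ^+ m / m`!%:R * B m * v ^+ m| <= v ^+ n / n`!%:R * B n.
Proof.
move=> /andP[z0 z1] v0 hB.
have hrem : forall e, (0 < e)%N -> `|z ^+ e * expN_rem n (e%:R * v)| <=
    v ^+ n / n`!%:R * (e%:R ^+ n * z ^+ e).
  move=> e _; rewrite normrM ger0_norm ?exprn_ge0 ?(ltW z0)//.
  have -> : v ^+ n / n`!%:R * (e%:R ^+ n * z ^+ e) = z ^+ e * ((e%:R * v) ^+ n / n`!%:R).
    by rewrite exprMn; ring.
  rewrite ler_wpM2l ?exprn_ge0 ?(ltW z0)//.
  have /andP[h1 h2] := expN_rem_bounds n (e%:R * v) (ltac:(by rewrite mulr_ge0)).
  have <- : `|(-1) ^+ n * expN_rem n (e%:R * v)| = `|expN_rem n (e%:R * v)|.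
    by rewrite normrM normrX normrN1 expr1n mul1r.
  by rewrite ger0_norm.
have [l hl lle] := sums_comp _ _ _ hrem (sumsZ (v ^+ n / n`!%:R) _ _ (hB n)).
have hs := @sums_sum R _ (index_enum 'I_n)
  (fun m e => (-1) ^+ m / m`!%:R * v ^+ m * (e%:R ^+ m * z ^+ e)) _ (fun m => sumsZ _ _ _ (hB m)).
exists (l + \sum_(m < n) (-1) ^+ m / m`!%:R * B m * v ^+ m); last by rewrite addrK.
have -> : \sum_(m < n) (-1) ^+ m / m`!%:R * B m * v ^+ m =
   \sum_(m < n) (-1) ^+ m / m`!%:R * v ^+ m * B m.
  by apply: eq_bigr => m _; rewrite mulrAC.
apply: eq_sums (sumsD _ _ _ _ hl hs) => e _.
rewrite /expN_rem mulrBr mulr_sumr.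
have -> : \sum_(i < n) z ^+ e * ((-1) ^+ i / i`!%:R * (e%:R * v) ^+ i) =
   \sum_(m < n) (-1) ^+ m / m`!%:R * v ^+ m * (e%:R ^+ m * z ^+ e).
  by apply: eq_bigr => i _; rewrite exprMn; ring.
by rewrite subrK.
Qed.

Lemma moment_base {R : realType} (a : R) v : 1 < a -> (5 / a) ^+ v < 2 ->
  0 < 5 ^+ v / (2 * a ^+ v) < 1.
Proof.
move=> a1; have a0 : 0 < a := lt_trans ltr01 a1.
rewrite expr_div_n => h.
have av : 0 < a ^+ v by rewrite exprn_gt0.
by rewrite divr_gt0 ?exprn_gt0 ?mulr_gt0//= ltr_pdivrMr ?mulr_gt0// mul1r -ltr_pdivrMr.
Qed.

Lemma geo_momentP {R : realType} (a : R) v m : 1 < a -> (5 / a) ^+ v < 2 ->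
  sums (fun e => e%:R ^+ m * (5 ^+ v / (2 * a ^+ v)) ^+ e) (geo_moment a v m).
Proof.
move=> a1 hv; have [l hl _] := sums_pow_geo m _ (moment_base _ _ a1 hv).
by rewrite /geo_moment (sums_lim _ _ hl).
Qed.

Lemma abinom00 {R : realType} (s0 : R) : abinom 0 0 s0 = 1.
Proof.
by rewrite /abinom /binomial_poly big_ord0 fact0 invr1 scale1r -polyC1 comp_polyC coefC eqxx.
Qed.

Lemma press_coef00 {R : realType} (a s0 : R) : press_coef a s0 0 0 = 1.
Proof.
rewrite /press_coef big_nat1 abinom00 subn0 mul1r /exp_coef !(expr0, fact0, divr1, invr1, mul1r).
apply: sums_lim; apply: eq_sums (@sums_geo_half R) => e _.
by rewrite !(expr0, mulr1, mul1r, div1r).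
Qed.

Lemma press_coef01 {R : realType} (a s0 : R) : press_coef a s0 0 1 = - (2 * ln 5).
Proof.
rewrite /press_coef big_nat1 abinom00 subn0 mul1r /exp_coef expr1 divr1 /geo_moment.
rewrite (sums_lim _ (2 : R)); first by rewrite mulNr mulrC.
apply: eq_sums (@sums_id_geo_half R) => e _.
by rewrite expr1 !(expr0, mulr1, mul1r, div1r).
Qed.

Lemma binom_bounded {R : realType} (s0 : R) v :
  exists2 C, 0 <= C & forall u : R, 0 <= u <= 1 -> `|binom (s0 + u) v| <= C.
Proof.
have [C C0 hC] := poly_bounded (binomial_poly v \Po ('X + s0%:P)).
exists C => // u u01; have := hC u u01.
by rewrite horner_comp hornerD hornerX hornerC [u + s0]addrC.
Qed.

Lemma uniform_bound {R : realType} (T : Type) n (f g : nat -> T -> R) (D : T -> Prop) :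
  (forall v, (v < n)%N -> exists2 C, 0 <= C & forall x, D x -> f v x <= C * g v x) ->
  (forall v x, D x -> 0 <= g v x) ->
  exists2 C, 0 <= C & forall v x, (v < n)%N -> D x -> f v x <= C * g v x.
Proof.
move=> + g0; elim: n => [_|n IH h]; first by exists 0.
have [C C0 hC] := IH (fun v vn => h v (ltnW vn)).
have [C' C'0 hC'] := h n (ltnSn n).
exists (C + C'); first by rewrite addr_ge0.
move=> v x; rewrite ltnS leq_eqVlt => /predU1P[->|vn] Dx.
  by apply: le_trans (hC' _ Dx) _; rewrite ler_wpM2r ?g0// lerDr.
by apply: le_trans (hC _ _ vn Dx) _; rewrite ler_wpM2r ?g0// lerDl.
Qed.

Definition press_rem {R : realType} (a : R) (k : nat) (eps u : R) (e : nat) : R :=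
  2^-1 ^+ e * expR (- (e%:R * (u * ln 5))) *
  binom_rem (ln 2 / ln 5 + u) k.+1 ((5 / a) ^+ e * eps).

Lemma press_expansion {R : realType} (a : R) k : 1 < a ->
  (forall v, (v <= k)%N -> (5 / a) ^+ v < 2) ->
  exists2 C, 0 <= C & forall eps u : R, 0 <= eps <= 1 -> 0 <= u <= 1 ->
    sums (fun e => ratio a eps e `^ (ln 2 / ln 5 + u)) 1 ->
    exists2 X, sums (press_rem a k eps u) X &
      `|X - (1 - press_trunc a (ln 2 / ln 5) k eps u)| <= C * u ^+ k.+2.
Proof.
move=> a1 hk; set s0 := ln 2 / ln 5.
pose z v := 5 ^+ v / (2 * a ^+ v).
pose Sp v u S := sums (fun e => z v ^+ e * expR (- (e%:R * (u * ln 5)))) S.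
have [C C0 hC] : exists2 C, 0 <= C & forall v u, (v < k.+1)%N -> 0 <= u <= 1 ->
    exists2 S, Sp v u S & `|binom (s0 + u) v * S - \sum_(q < k.+2) press_coef a s0 v q * u ^+ q|
      <= C * u ^+ k.+2.
  (* The sums are chosen as one function of (v, u), with a dummy value outside the range, so that a
     single constant independent of eps can serve all v. *)
  have /choice[S hS] : forall vu : nat * R, exists S, (vu.1 < k.+1)%N -> 0 <= vu.2 <= 1 -> 
      Sp vu.1 vu.2 S /\ `|S - \sum_(m < k.+2) exp_coef a vu.1 m * vu.2 ^+ m| <=
       (ln 5) ^+ k.+2 / k.+2`!%:R * geo_moment a vu.1 k.+2 * vu.2 ^+ k.+2.
    move=> [v u] /=; case: (pselect ((v < k.+1)%N /\ 0 <= u <= 1)) => [[vk u01]|nvu]; last first.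
      by exists 0 => h1 h2; case: nvu.
    have /andP[u0 u1] := u01; have hv := hk v vk.
    have [S hS Sle] := exp_moment (z v) (u * ln 5) (geo_moment a v) k.+2 (moment_base _ _ a1 hv)
      (ltac:(by rewrite mulr_ge0// ltW// ln5_gt0)) (fun m => geo_momentP _ _ m a1 hv).
    exists S => _ _; split => //; move: Sle; rewrite exprMn.
    have -> : \sum_(m < k.+2) (-1) ^+ m / m`!%:R * geo_moment a v m * (u * ln 5) ^+ m =
       \sum_(m < k.+2) exp_coef a v m * u ^+ m.
      by apply: eq_bigr => m _; rewrite /exp_coef exprMn [(- ln 5) ^+ m]exprNn; ring.
    have -> : (ln 5) ^+ k.+2 / k.+2`!%:R * geo_moment a v k.+2 * u ^+ k.+2 =
      u ^+ k.+2 * (ln 5) ^+ k.+2 / k.+2`!%:R * geo_moment a v k.+2 by ring.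
    by [].
  pose f v u := `|binom (s0 + u) v * S (v, u) - \sum_(q < k.+2) press_coef a s0 v q * u ^+ q|.
  have [||C C0 hC] := @uniform_bound R R k.+1 f (fun _ u => u ^+ k.+2) (fun u => 0 <= u <= 1).
  - move=> v vk; have [B B0 hB] := binom_bounded s0 v.
    have [D D0 hD] := press_coef_product a s0 k v.
    pose G := (ln 5) ^+ k.+2 / k.+2`!%:R * geo_moment a v k.+2.
    exists (B * `|G| + D) => [|u u01]; first by rewrite addr_ge0// mulr_ge0.
    have /andP[u0 u1] := u01; have [_ Sle] := hS (v, u) vk u01.
    rewrite /f -(subrKA (binom (s0 + u) v * (\sum_(m < k.+2) exp_coef a v m * u ^+ m))).
    apply: le_trans (ler_normD _ _) _; rewrite mulrDl; apply: lerD; last exact: hD.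
    rewrite -mulrBr normrM -mulrA; apply: ler_pM => //; first exact: hB.
    by apply: le_trans Sle _; rewrite /= ler_wpM2r ?exprn_ge0//; exact: ler_norm.
  - by move=> v u /andP[u0 _]; rewrite exprn_ge0.
  exists C => // v u vk u01; exists (S (v, u)); last exact: hC.
  by have [] := hS (v, u) vk u01.
exists (k.+1%:R * C); first by rewrite mulr_ge0.
move=> eps u /andP[e0 e1] u01 hsum.
have /choice[S hS] : forall v, exists S, (v < k.+1)%N -> Sp v u S /\
    `|binom (s0 + u) v * S - \sum_(q < k.+2) press_coef a s0 v q * u ^+ q| <= C * u ^+ k.+2.
  move=> v; case: (ltnP v k.+1) => vk; last by exists 0.
  by have [S h1 h2] := hC v u vk u01; exists S.
have h1 := @sums_sum R _ (index_enum 'I_k.+1)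
   (fun (v : 'I_k.+1) e => binom (s0 + u) v * eps ^+ v * (z v ^+ e * expR (- (e%:R * (u * ln 5))))) _
   (fun v => sumsZ _ _ _ (hS v (ltn_ord v)).1).
exists (1 - \sum_(v < k.+1) binom (s0 + u) v * eps ^+ v * S v).
  apply: eq_sums (sumsB _ _ _ _ hsum h1) => e _.
  rewrite /press_rem ratio_powRE// /binom_rem mulrBr; congr (_ - _).
  rewrite mulr_sumr; apply: eq_bigr => v _.
  have -> : z v ^+ e = 2^-1 ^+ e * ((5 / a) ^+ e) ^+ v.
    have -> : z v = 2^-1 * (5 / a) ^+ v by rewrite /z expr_div_n invfM mulrCA.
    by rewrite exprMn -!exprM mulnC.
  by rewrite [((5 / a) ^+ e * eps) ^+ v]exprMn; ring.
have -> : 1 - \sum_(v < k.+1) binom (s0 + u) v * eps ^+ v * S v - (1 - press_trunc a s0 k eps u) =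
  \sum_(v < k.+1) - (eps ^+ v * (binom (s0 + u) v * S v -
     \sum_(q < k.+2) press_coef a s0 v q * u ^+ q)).
  rewrite opprB addrC addrA subrK /press_trunc -sumrB.
  apply: eq_bigr => v _; rewrite mulrBr opprB mulr_sumr; congr (_ - _); last by ring.
  by apply: eq_bigr => q _; ring.
apply: le_trans (ler_norm_sum _ _ _) _.
have -> : k.+1%:R * C * u ^+ k.+2 = \sum_(v < k.+1) C * u ^+ k.+2.
  by rewrite sumr_const card_ord -mulrA mulr_natl.
apply: ler_sum => v _; rewrite normrN normrM ger0_norm ?exprn_ge0//.
rewrite -[leRHS]mul1r; apply: ler_pM => //; rewrite ?exprn_ge0 ?exprn_ile1//.
by have [] := hS v (ltn_ord v).
Qed.

Lemma press_main_estimate {R : realType} (a : R) k (c : nat -> R) : 1 < a ->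
  (forall v, (v <= k)%N -> (5 / a) ^+ v < 2) ->
  (forall i, (0 < i <= k)%N -> c i = coef_rhs a (ln 2 / ln 5) c i) ->
  exists C h : R, [/\ 0 <= C, 0 < h, h <= 1 & forall eps u : R, 0 <= eps <= h -> 0 <= u <= h ->
    sums (fun e => ratio a eps e `^ (ln 2 / ln 5 + u)) 1 ->
    exists2 X, sums (press_rem a k eps u) X &
      `|X - 2 * ln 5 * (u - (seq_poly c k).[eps])| <=
         ln 5 * `|u - (seq_poly c k).[eps]| + C * eps ^+ k.+1].
Proof.
move=> a1 hk hc; set s0 := ln 2 / ln 5; pose w eps := (seq_poly c k).[eps].
have [C1 C10 h1] := press_expansion a k a1 hk.
have [C2 C20 h2] := press_trunc_seq _ _ _ _ (press_coef00 a s0) (press_coef01 a s0) hc.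
have [C3 C30 h3] := press_trunc_lipschitz a s0 k (press_coef01 a s0).
have [C4 C40 h4] := seq_poly_linear_bound c k.
pose m := Num.min 1 (ln 5 : R); have m0 : 0 < m by rewrite lt_min ltr01 ln5_gt0.
have m1 : m <= 1 by rewrite ge_min lexx.
have m5 : m <= ln 5 by rewrite ge_min lexx orbT.
(* Chosen so that (2 C1 + C3) H <= ln 5: half of the slope 2 ln 5 is spent on absorbing the errors
   proportional to |u - w|. *)
pose K := 2 * C1 + C3 + 1; have K1 : 1 <= K by rewrite /K; lra.
have K0 : 0 < K by lra.
pose H := m / K; have H0 : 0 < H by rewrite divr_gt0.
have HK : H * K = m by rewrite divfK// gt_eqF.
have H1 : H <= 1 by rewrite ler_pdivrMr// mul1r; lra.
have L0 : 0 < 1 + C4 by lra.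
(* The divisor 1 + C4 makes |w eps| <= C4 eps at most H as well. *)
pose h := H / (1 + C4); have h0 : 0 < h by rewrite divr_gt0.
have hL : h * (1 + C4) = H by rewrite divfK// gt_eqF.
have hH : h <= H by rewrite -hL ler_peMr ?(ltW h0)//; lra.
have hC4 : C4 * h <= H by rewrite -hL mulrC ler_wpM2l ?(ltW h0)//; lra.
clearbody m H h.
exists (C1 * (2 * C4) ^+ k.+2 + C2), h; split => //; [|lra|].
  by rewrite addr_ge0// mulr_ge0// exprn_ge0// mulr_ge0.
move=> eps u /andP[e0 eh] /andP[u0 uh] hsum.
have e01 : 0 <= eps <= 1 by apply/andP; split; lra.
have u01 : 0 <= u <= 1 by apply/andP; split; lra.
have [X hX Xle] := h1 eps u e01 u01 hsum; exists X => //.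
have wle : `|w eps| <= H.
  by apply: le_trans (h4 _ e01) _; apply: le_trans hC4; rewrite ler_wpM2l.
have F1 := h2 eps e01.
have F2 := h3 H eps u (w eps) (ltac:(apply/andP; split; lra)) H1
  (ltac:(rewrite ger0_norm//; lra)) wle.
rewrite -!/(w eps) in F1 *; set D := u - w eps in F2 *.
have U : u ^+ k.+2 <= 2 * H * `|D| + (2 * C4) ^+ k.+2 * eps ^+ k.+1.
  have T1 : 0 <= 2 * H * `|D| by rewrite mulr_ge0// mulr_ge0// ltW.
  have T2 : 0 <= (2 * C4) ^+ k.+2 * eps ^+ k.+1 by rewrite mulr_ge0// exprn_ge0// mulr_ge0.
  (* In the first case u <= 2 |D|, and the other k + 1 factors u are together at most H; in the
     second u <= 2 C4 eps. *)
  have [uw|uw] := lerP (2 * `|w eps|) u.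
    apply: (@le_trans _ _ (2 * H * `|D|)); last by rewrite lerDl.
    have uD : u <= 2 * `|D|.
      have : u <= `|D| + `|w eps|.
        by rewrite -[leLHS](ger0_norm u0) -[X in `|X|](subrK (w eps)) ler_normD.
      lra.
    rewrite exprS; apply: (@le_trans _ _ (2 * `|D| * u ^+ k.+1)).
      by rewrite ler_wpM2r ?exprn_ge0.
    rewrite mulrAC ler_wpM2r// ler_wpM2l//.
    have -> : H = H ^+ 1 by rewrite expr1.
    apply: (@le_trans _ _ (u ^+ 1)); first by apply: ler_wiXn2l => //; lra.
    by rewrite !expr1; lra.
  apply: (@le_trans _ _ ((2 * C4) ^+ k.+2 * eps ^+ k.+1)); last by rewrite lerDr.
  have uC : u <= 2 * C4 * eps by have := h4 _ e01; rewrite -/(w eps); lra.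
  apply: (@le_trans _ _ ((2 * C4 * eps) ^+ k.+2)).
    by apply: lerXn2r; rewrite ?nnegrE ?mulr_ge0.
  rewrite exprMn ler_wpM2l ?exprn_ge0 ?mulr_ge0//.
  by apply: ler_wiXn2l => //; lra.
set F := press_trunc a s0 k eps in Xle F1 F2.
have -> : X - 2 * ln 5 * D = (X - (1 - F u)) - (F (w eps) - 1) - (F u - F (w eps) + 2 * ln 5 * D) by ring.
apply: le_trans (ler_normB _ _) _.
have N1 := ler_normB (X - (1 - F u)) (F (w eps) - 1).
have U1 : C1 * u ^+ k.+2 <= C1 * (2 * H * `|D| + (2 * C4) ^+ k.+2 * eps ^+ k.+1).
  by rewrite ler_wpM2l.
have G : (2 * C1 * H + C3 * H) * `|D| <= ln 5 * `|D|.
  rewrite ler_wpM2r//; apply: le_trans m5; rewrite -HK /K; lra.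
have := le_trans Xle U1.
have -> : C1 * (2 * H * `|D| + (2 * C4) ^+ k.+2 * eps ^+ k.+1) =
   2 * C1 * H * `|D| + C1 * (2 * C4) ^+ k.+2 * eps ^+ k.+1 by ring.
rewrite [in leRHS]mulrDl; move: G; rewrite mulrDl; lra.
Qed.

(** * Size of the remainder *)

(** The coefficient at s0 is nonzero because 0 < s0 < 1 is not an integer. With A its modulus, a
    change of at most A/2 keeps it between A/2 and 3A/2. *)
Lemma binom_near {R : realType} (n : nat) (d : R) : 0 < d ->
  exists A0 h : R, [/\ 0 < A0, 0 < h, h <= d & forall u, 0 <= u <= h ->
    A0 <= `|binom (ln 2 / ln 5 + u) n| <= 3 * A0].
Proof.
move=> d0; have /andP[s0 s1] := @dim0_bounds R; set s := ln 2 / ln 5 in s0 s1 *.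
have [C C0 hC] := poly_low_bound (binomial_poly n \Po ('X + s%:P)) 1.
pose A := `|binom s n|.
have A0 : 0 < A.
  rewrite normr_gt0 binomE mulf_neq0 ?invr_eq0 ?pnatr_eq0 -?lt0n ?fact_gt0//.
  apply/prodf_neq0 => -[i ii] _ /=; case: i ii => [|i] _; first by rewrite subr0 gt_eqF.
  by rewrite lt_eqF// subr_lt0 (lt_le_trans s1)// ler1n.
pose h := Num.min (Num.min 1 d) (A / 2 / (C + 1)).
have C1 : 0 < C + 1 by lra.
have h0 : 0 < h by rewrite !lt_min ltr01 d0 !divr_gt0.
exists (A / 2), h; split => //; [by rewrite divr_gt0|by rewrite !ge_min lexx orbT|].
move=> u /andP[u0 uh].
have h1 : h <= 1 by rewrite !ge_min lexx.
have hA : h <= A / 2 / (C + 1) by rewrite !ge_min lexx !orbT.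
have := hC u (ltac:(by rewrite u0 (le_trans uh))).
rewrite big_ord1 -horner_coef0 !horner_comp !hornerD !hornerX !hornerC add0r expr0 mulr1 expr1.
rewrite [u + s]addrC -!/(binom _ n) => hu.
have : C * u <= A / 2.
  have : (C + 1) * u <= A / 2.
    by rewrite mulrC -ler_pdivlMr// (le_trans uh).
  lra.
have := ler_normD (binom (s + u) n - binom s n) (binom s n).
have := ler_normB (binom (s + u) n) (binom (s + u) n - binom s n).
rewrite subrK opprB addrCA subrr addr0 -/A; lra.
Qed.

(** M is the last letter whose relative perturbation (5 / a)^M eps is at most 1, hence of order |ln
    eps|. *)
Definition scale {R : realType} (a eps : R) (M : nat) : Prop :=
  (5 / a) ^+ M * eps <= 1 < (5 / a) ^+ M.+1 * eps.

Lemma scale_exists {R : realType} (a eps : R) : 1 < 5 / a -> 0 < eps <= 1 ->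
  exists2 M, scale a eps M & forall N, (5 / a) ^+ N * eps <= 1 -> (N <= M)%N.
Proof.
move=> t1 /andP[e0 e1]; have t0 : 0 < 5 / a := lt_trans ltr01 t1.
have ex : exists m, 1 < (5 / a) ^+ m * eps.
  have z1 : `|(5 / a)^-1| < 1 by rewrite gtr0_norm ?invr_gt0// invf_lt1.
  have /cvgrPdist_lt/(_ _ e0)[m _ /(_ m (leqnn m))] := @cvg_expr R _ z1.
  rewrite sub0r normrN exprVn ger0_norm ?invr_ge0 ?exprn_ge0 ?(ltW t0)// => h.
  by exists m; rewrite mulrC -ltr_pdivrMr ?exprn_gt0// div1r.
case: (ex_minnP ex) => -[|M] hM mM; first by move: hM; rewrite expr0 mul1r ltNge e1.
exists M.
  by rewrite /scale hM andbT leNgt; apply/negP => /mM; rewrite ltnn.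
move=> N hN; rewrite leqNgt; apply/negP => MN; move: hN; rewrite leNgt => /negP; apply.
by apply: lt_le_trans hM _; rewrite ler_pM2r// ler_weXn2l// ltW.
Qed.

Definition head_sum {R : realType} (a : R) (k : nat) (eps : R) (M : nat) : R :=
  \sum_(1 <= e < M.+1) 2^-1 ^+ e * ((5 / a) ^+ e * eps) ^+ k.+1.

Lemma sums_norm_le {R : realType} (f : nat -> R) (l B : R) : sums f l ->
  (forall n, \sum_(1 <= e < n) `|f e| <= B) -> `|l| <= B.
Proof.
move=> fl fB; have [g hg /andP[_ gB]] := sums_ex (fun e => `|f e|) B (fun _ _ => normr_ge0 _) fB.
have [l' hl' ll'] := sums_comp f (fun e => `|f e|) g (fun _ _ => lexx _) hg.
by rewrite (sums_unique _ _ _ fl hl') (le_trans ll').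
Qed.

Lemma geo_partial_le {R : realType} (z : R) n : 0 <= z < 1 ->
  \sum_(i < n) z ^+ i <= (1 - z)^-1.
Proof.
move=> /andP[z0 z1]; rewrite -[leRHS]mul1r ler_pdivlMr ?subr_gt0// mulrC.
have := subrX1 z n; have := exprn_ge0 n z0; lra.
Qed.

(** The two-sided bounds carry a factor [binom s n] that cancels only if it is nonzero; near s0 the
    second alternative is excluded by [binom_near]. *)
Lemma binom_rem_norm_le {R : realType} (s y : R) n : s <= n%:R -> 0 <= y ->
  `|binom_rem s n y| <= `|binom s n| * y ^+ n \/ binom s n = 0.
Proof.
move=> sn y0; have [->|A0] := eqVneq (binom s n) 0; [by right|left].
have /andP[h1 h2] := binom_rem_bounds n s y y sn (ltac:(by rewrite y0 lexx)).
have Ap : 0 < `|binom s n| by rewrite normr_gt0.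
rewrite -(ler_pM2l Ap) mulrA -normrM -expr2 real_normK ?num_real// ger0_norm//.
by apply: le_trans h1; rewrite mulr_ge0 ?exprn_ge0// mulr_ge0 ?sqr_ge0 ?powR_ge0.
Qed.

Lemma expR_natV5_le1 {R : realType} (u : R) e : 0 <= u -> 0 < expR (- (e%:R * (u * ln 5))) <= 1.
Proof.
by move=> u0; rewrite expR_gt0 expR_le1 oppr_le0 !mulr_ge0// ltW// ln5_gt0.
Qed.

Lemma press_rem_small {R : realType} (a : R) k : 5 <= a ->
  exists C h : R, [/\ 0 <= C, 0 < h & forall eps u X, 0 <= eps -> 0 <= u <= h ->
    sums (press_rem a k eps u) X -> `|X| <= C * eps ^+ k.+1].
Proof.
move=> a5; have /andP[s0 s1] := @dim0_bounds R.
have [A [h [A0 h0 h1 hA]]] := @binom_near R k.+1 (1 - ln 2 / ln 5) (ltac:(by rewrite subr_gt0)).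
have a0 : 0 < a by apply: lt_le_trans a5.
exists (3 * A), h; split => //; first by rewrite mulr_ge0// ltW.
move=> eps u X e0 uh hX; have /andP[u0 u1] := uh; have /andP[hA1 hA2] := hA u uh.
have sk : ln 2 / ln 5 + u <= k.+1%:R by apply: (@le_trans _ _ 1); [lra|rewrite ler1n].
have [e _|Y hY Yle] := sums_comp (press_rem a k eps u) _ _ _ (sumsZ (3 * A * eps ^+ k.+1) _ _ (@sums_geo_half R)); last first.
  by rewrite (sums_unique _ _ _ hX hY) -[leRHS]mulr1.
have t0 : 0 <= 5 / a by rewrite divr_ge0// ltW.
have t1 : 5 / a <= 1 by rewrite ler_pdivrMr// mul1r.
have y0 : 0 <= (5 / a) ^+ e * eps by rewrite mulr_ge0// exprn_ge0.
have ye : (5 / a) ^+ e * eps <= eps by rewrite ler_piMl// exprn_ile1.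
have [hb|hb] := binom_rem_norm_le _ _ _ sk y0; last first.
  by exfalso; move: hA1; rewrite hb normr0; lra.
rewrite /press_rem !normrM ger0_norm ?exprn_ge0 ?invr_ge0//.
have /andP[x0 x1] := expR_natV5_le1 u e u0.
rewrite (gtr0_norm x0) -mulrA [leRHS]mulrC ler_wpM2l ?exprn_ge0 ?invr_ge0//.
rewrite -[leRHS]mul1r; apply: ler_pM; rewrite ?(ltW x0)//.
apply: le_trans hb _; apply: ler_pM; rewrite ?exprn_ge0//.
by apply: lerXn2r; rewrite ?nnegrE.
Qed.

(* Beyond the scale [M] the remainder is estimated termwise with an exponent
   [kappa] strictly below the critical exponent ln 2 / ln (5 / a). *)
Lemma press_rem_upper {R : realType} (a kappa d : R) k : 1 < 5 / a -> 0 < d ->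
  k%:R <= kappa -> ln 2 / ln 5 + d <= kappa -> (5 / a) `^ kappa < 2 ->
  exists C h : R, [/\ 0 <= C, 0 < h & forall eps u X M, 0 < eps -> 0 <= u <= h ->
    scale a eps M -> sums (press_rem a k eps u) X ->
    `|X| <= C * (head_sum a k eps M + 2^-1 ^+ M)].
Proof.
move=> t1 d0 kk sk zk; have t0 : 0 < 5 / a := lt_trans ltr01 t1.
have /andP[s0 s1] := @dim0_bounds R.
pose d' := Num.min d (1 - ln 2 / ln 5).
have d'0 : 0 < d' by rewrite lt_min d0 subr_gt0.
have [A [h [A0 h0 h1 hA]]] := @binom_near R k.+1 d' d'0.
have d'd : d' <= d by rewrite ge_min lexx.
have d's : d' <= 1 - ln 2 / ln 5 by rewrite ge_min lexx orbT.
have [B B0 hB] : exists2 B, 0 <= B & forall v (u : R), (v < k.+1)%N -> 0 <= u <= 1 ->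
    `|binom (ln 2 / ln 5 + u) v| <= B * 1.
  have [v _||C C0 hC] := @uniform_bound R R k.+1 (fun v u => `|binom (ln 2 / ln 5 + u) v|)
    (fun _ _ => 1) (fun u => 0 <= u <= 1); [|by []|by exists C].
  by have [C C0 hC] := binom_bounded (ln 2 / ln 5 : R) v; exists C => // u /hC; rewrite mulr1.
pose z := (5 / a) `^ kappa / 2.
have z0 : 0 <= z by rewrite divr_ge0// powR_ge0.
have z1 : z < 1 by rewrite ltr_pdivrMr// mul1r.
(* For y >= 1, the power (1 + y)^(s + u) is at most (2 y)^(s + u) <= 2 y^kappa, and each of the k +
   1 subtracted terms is at most B y^kappa. *)
pose C2 := 2 + k.+1%:R * B; have C20 : 0 <= C2 by rewrite addr_ge0// mulr_ge0.
have zi : 0 < (1 - z)^-1 by rewrite invr_gt0 subr_gt0.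
exists (3 * A + C2 * (1 - z)^-1), h; split => //.
  by rewrite addr_ge0// ?mulr_ge0// ltW.
move=> eps u X M e0 uh /andP[sM1 sM2] hX; have /andP[u0 u1] := uh; have /andP[hA1 hA2] := hA u uh.
set s := ln 2 / ln 5 in s0 s1 hA1 hA2 sk d's hB *.
have sn : s + u <= k.+1%:R by apply: (@le_trans _ _ 1); [lra|rewrite ler1n].
have y0 e : 0 < (5 / a) ^+ e * eps by rewrite mulr_gt0// exprn_gt0.
have h2 e : 0 <= 2^-1 ^+ e :> R by rewrite exprn_ge0// invr_ge0.
have termle e c : `|binom_rem (s + u) k.+1 ((5 / a) ^+ e * eps)| <= c ->
    `|press_rem a k eps u e| <= 2^-1 ^+ e * c.
  move=> hc; rewrite /press_rem !normrM ger0_norm//.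
  have /andP[x0 x1] := expR_natV5_le1 u e u0.
  rewrite (gtr0_norm x0) -mulrA ler_wpM2l//.
  by rewrite -[leRHS]mul1r; apply: ler_pM; rewrite ?(ltW x0).
have low e : `|press_rem a k eps u e| <= 3 * A * (2^-1 ^+ e * ((5 / a) ^+ e * eps) ^+ k.+1).
  rewrite mulrCA; apply: termle.
  have [hb|hb] := binom_rem_norm_le _ _ _ sn (ltW (y0 e)); last first.
    by exfalso; move: hA1; rewrite hb normr0; lra.
  by apply: le_trans hb _; rewrite ler_wpM2r// exprn_ge0// ltW.
have high e : 1 <= (5 / a) ^+ e * eps ->
    `|press_rem a k eps u e| <= C2 * (z ^+ e * eps `^ kappa).
  move=> y1; have -> : C2 * (z ^+ e * eps `^ kappa) =
      2^-1 ^+ e * (C2 * ((5 / a) ^+ e * eps) `^ kappa).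
    rewrite powRM ?(ltW e0) ?exprn_ge0 ?(ltW t0)// -(powR_mulrn e (ltW t0)) -powRrM mulrC.
    rewrite [_ * kappa]mulrC powRrM powR_mulrn ?powR_ge0//.
    by rewrite /z exprMn; ring.
  apply: termle; set y := (5 / a) ^+ e * eps in y1 *.
  apply: le_trans (ler_normB _ _) _; rewrite mulrDl; apply: lerD.
    rewrite ger0_norm ?powR_ge0//.
    apply: (@le_trans _ _ ((2 * y) `^ (s + u))).
      by apply: ge0_ler_powR; rewrite ?nnegrE; lra.
    rewrite powRM//; last lra.
    apply: ler_pM; rewrite ?powR_ge0//.
      by apply: ler1_powR; [rewrite ler1n|lra].
    by apply: ler_powR => //; lra.
  apply: le_trans (ler_norm_sum _ _ _) _.
  have -> : k.+1%:R * B * y `^ kappa = \sum_(v < k.+1) B * y `^ kappa.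
    by rewrite sumr_const card_ord -mulrA mulr_natl.
  apply: ler_sum => v _; rewrite normrM; apply: ler_pM => //.
    by have := hB v u (ltn_ord v) (ltac:(apply/andP; split; lra)); rewrite mulr1.
  rewrite ger0_norm ?exprn_ge0//; last lra.
  rewrite -powR_mulrn; last lra.
  apply: ler_powR => //; apply: le_trans kk; rewrite ler_nat -ltnS; exact: ltn_ord.
apply: (sums_norm_le _ _ _ hX) => n.
apply: (@le_trans _ _ (\sum_(1 <= e < M.+1 + n) `|press_rem a k eps u e|)).
  by apply: (nat_partial_nd (fun e => `|press_rem a k eps u e|)) => //; exact: leq_addl.
rewrite (big_cat_nat _ (n := M.+1))//=; last by rewrite leq_addr.
rewrite mulrDr mulrDl -addrA; apply: lerD.
  by rewrite /head_sum mulr_sumr; apply: ler_sum => e _; exact: low.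
have hs0 : 0 <= head_sum a k eps M.
  by apply: sumr_ge0 => e _; rewrite mulr_ge0// exprn_ge0// ltW.
apply: (@le_trans _ _ (C2 * (1 - z)^-1 * 2^-1 ^+ M)); last first.
  have : 0 <= 3 * A * 2^-1 ^+ M by rewrite mulr_ge0// mulr_ge0// ltW.
  have : 0 <= C2 * (1 - z)^-1 * head_sum a k eps M by rewrite mulr_ge0// mulr_ge0// ltW.
  by rewrite mulrDl; lra.
rewrite -{1}(add0n M.+1) big_addn addKn big_mkord.
apply: (@le_trans _ _ (\sum_(i < n) C2 * (z ^+ M.+1 * eps `^ kappa) * z ^+ i)).
  apply: ler_sum => i _; have -> : C2 * (z ^+ M.+1 * eps `^ kappa) * z ^+ i =
     C2 * (z ^+ (i + M.+1) * eps `^ kappa) by rewrite exprD; ring.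
  apply: high; apply: le_trans (ltW sM2) _.
  by rewrite ler_pM2r// ler_weXn2l ?leq_addl// ltW.
rewrite -mulr_sumr.
(* Rewritten as 2^-(M+1) ((5 / a)^(M+1) eps)^kappa: since (5 / a)^M eps <= 1, the last power is at
   most (5 / a)^kappa < 2. *)
have zM : z ^+ M.+1 * eps `^ kappa <= 2^-1 ^+ M.
  have -> : z ^+ M.+1 * eps `^ kappa = 2^-1 ^+ M.+1 * ((5 / a) ^+ M.+1 * eps) `^ kappa.
    rewrite powRM ?(ltW e0) ?exprn_ge0 ?(ltW t0)// -(powR_mulrn M.+1 (ltW t0)) -powRrM.
    rewrite [_ * kappa]mulrC powRrM powR_mulrn ?powR_ge0//.
    by rewrite /z exprMn; ring.
  rewrite exprSr -mulrA ler_piMr// mulrC ler_pdivrMr// mul1r.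
  apply: le_trans (ltW zk); apply: ge0_ler_powR; rewrite ?nnegrE; [lra|exact: ltW|exact: ltW|].
  by rewrite exprS -mulrA ler_piMr// ltW.
rewrite -mulrA -mulrA; apply: ler_wpM2l => //.
rewrite mulrC; apply: ler_pM => //.
- by apply: sumr_ge0 => i _; rewrite exprn_ge0.
- by rewrite mulr_ge0 ?exprn_ge0 ?powR_ge0.
- by apply: geo_partial_le; rewrite z0.
Qed.

(** All summands have the sign of the binomial coefficient, so the letters up to M bound |X| from
    below. There y <= 1 makes the Taylor factor at least 2^-(k+1), and M u <= B controls the
    exponential; B is a parameter because its bound becomes available only after the upper
    estimate. *)
Lemma press_rem_lower {R : realType} (a : R) k : 1 < 5 / a ->
  exists c h : R, [/\ 0 < c, 0 < h & forall eps u X M B, 0 < eps -> 0 <= u <= h ->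
    scale a eps M -> M%:R * u <= B -> sums (press_rem a k eps u) X ->
    c * expR (- (B * ln 5)) * head_sum a k eps M <= `|X|].
Proof.
move=> t1; have t0 : 0 < 5 / a := lt_trans ltr01 t1.
have /andP[s0 s1] := @dim0_bounds R.
have [A [h [A0 h0 h1 hA]]] := @binom_near R k.+1 (1 - ln 2 / ln 5) (ltac:(by rewrite subr_gt0)).
exists (A * 2 `^ (- k.+1%:R)), h; split => //; first by rewrite mulr_gt0// powR_gt0.
move=> eps u X M B e0 uh /andP[sM1 sM2] MB hX.
have /andP[u0 u1] := uh; have /andP[hA1 hA2] := hA u uh.
set s := ln 2 / ln 5 in s0 s1 h1 hA1 hA2 *; set b := binom (s + u) k.+1 in hA1 hA2.
have sn : s + u <= k.+1%:R by apply: (@le_trans _ _ 1); [lra|rewrite ler1n].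
have y0 e : 0 < (5 / a) ^+ e * eps by rewrite mulr_gt0// exprn_gt0.
have h2 e : 0 <= 2^-1 ^+ e :> R by rewrite exprn_ge0// invr_ge0.
have bp : 0 < `|b| by lra.
have hbX := sumsZ b _ _ hX.
have rem0 e : 0 <= b * binom_rem (s + u) k.+1 ((5 / a) ^+ e * eps).
  have /andP[hb _] := binom_rem_bounds k.+1 (s + u) ((5 / a) ^+ e * eps) ((5 / a) ^+ e * eps) sn
    (ltac:(by rewrite lexx andbT (ltW (y0 e)))).
  by apply: le_trans hb; rewrite mulr_ge0 ?exprn_ge0 ?(ltW (y0 e))// mulr_ge0 ?sqr_ge0 ?powR_ge0.
have termE e : b * press_rem a k eps u e = 2^-1 ^+ e * expR (- (e%:R * (u * ln 5))) *
    (b * binom_rem (s + u) k.+1 ((5 / a) ^+ e * eps)) by rewrite /press_rem -/s; ring.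
have term0 e : (0 < e)%N -> 0 <= b * press_rem a k eps u e.
  by move=> _; rewrite termE mulr_ge0 ?rem0// mulr_ge0// expR_ge0.
have hpart := sums_ge_partial _ _ M.+1 term0 hbX.
have : `|b| * (A * 2 `^ (- k.+1%:R) * expR (- (B * ln 5)) * head_sum a k eps M) <= `|b| * `|X|.
  rewrite -normrM; apply: le_trans (ler_norm _); apply: le_trans hpart.
  rewrite /head_sum !mulr_sumr big_nat [leRHS]big_nat; apply: ler_sum => e /andP[e1 eM].
  rewrite termE.
  have yM : (5 / a) ^+ e * eps <= 1.
    by apply: le_trans sM1; rewrite ler_pM2r// ler_weXn2l// ltW.
  have /andP[lo _] := binom_rem_bounds k.+1 (s + u) ((5 / a) ^+ e * eps) 1 sn
    (ltac:(by rewrite yM (ltW (y0 e)))).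
  set y := (5 / a) ^+ e * eps in yM lo *.
  have yp : 0 <= y ^+ k.+1 by rewrite exprn_ge0// ltW// /y.
  have ex : expR (- (B * ln 5)) <= expR (- (e%:R * (u * ln 5))).
    rewrite ler_expR lerN2 mulrA ler_pM2r ?ln5_gt0//.
    by apply: le_trans MB; rewrite ler_wpM2r// ler_nat -ltnS.
  have low2 : `|b| * (A * 2 `^ (- k.+1%:R)) * y ^+ k.+1 <= b * binom_rem (s + u) k.+1 y.
    apply: le_trans lo; rewrite ler_wpM2r// -/b.
    have -> : b ^+ 2 = `|b| * `|b| by rewrite -expr2 real_normK ?num_real.
    rewrite -[leRHS]mulrA ler_pM2l//; apply: ler_pM; rewrite ?powR_ge0 ?(ltW A0)//.
    by apply: ler_powR; [lra|rewrite lerDr; lra].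
  apply: (@le_trans _ _ (2^-1 ^+ e * expR (- (e%:R * (u * ln 5))) *
     (`|b| * (A * 2 `^ (- k.+1%:R)) * y ^+ k.+1))); last first.
    by rewrite ler_wpM2l// mulr_ge0// expR_ge0.
  have -> : `|b| * (A * 2 `^ (- k.+1%:R) * expR (- (B * ln 5)) * (2^-1 ^+ e * y ^+ k.+1)) =
    2^-1 ^+ e * expR (- (B * ln 5)) * (`|b| * (A * 2 `^ (- k.+1%:R)) * y ^+ k.+1) by ring.
  rewrite ler_wpM2r ?mulr_ge0 ?powR_ge0 ?(ltW A0)//.
  by rewrite ler_wpM2l.
by rewrite ler_pM2l.
Qed.

(** * The expansion of the dimension *)

Lemma near_right0 {R : realType} (h : R) (P : R -> Prop) : 0 < h ->
  (forall eps, 0 < eps -> eps <= h -> P eps) -> \forall eps \near 0^'+, P eps.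
Proof.
by move=> h0 hP; near=> eps; apply: hP; near: eps; [exact: nbhs_right_gt|exact: nbhs_right_le].
Unshelve. all: by end_near. Qed.

Lemma asymp_one {R : realType} (r : R -> R) (c C h : R) : 0 < c -> 0 < h ->
  (forall eps, 0 < eps -> eps <= h -> c <= `|r eps| <= C) -> asymp (fun eps => `|r eps|) (fun=> 1).
Proof.
move=> c0 h0 hr; have ci : 0 < c^-1 by rewrite invr_gt0.
have C0 : 0 <= C.
  by have /andP[h1 h2] := hr h h0 (lexx h); apply: le_trans h2; apply: le_trans h1; exact: ltW.
exists (1 + c^-1 + C); first lra.
apply: (near_right0 h) => // eps e0 eh; have /andP[h1 h2] := hr eps e0 eh.
rewrite !mulr1; apply/andP; split; last lra.
apply: le_trans h1; rewrite -[leRHS]invrK lef_pV2 ?posrE//; lra.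
Qed.

Lemma log_ratio_exp {R : realType} (th : R) n : 1 < th ->
  (th ^+ n < 2) = (n%:R < ln 2 / ln th).
Proof.
move=> t1; have t0 : 0 < th := lt_trans ltr01 t1.
have l0 : 0 < ln th by rewrite ln_gt0.
rewrite ltr_pdivlMr// mulr_natl -lnXn//.
by rewrite ltr_ln ?posrE ?exprn_gt0.
Qed.

Lemma le_log_ratio_exp {R : realType} (th : R) n : 1 < th ->
  (th ^+ n <= 2) = (n%:R <= ln 2 / ln th).
Proof.
move=> t1; have t0 : 0 < th := lt_trans ltr01 t1.
have l0 : 0 < ln th by rewrite ln_gt0.
rewrite ler_pdivlMr// mulr_natl -lnXn//.
by rewrite ler_ln ?posrE ?exprn_gt0.
Qed.

Lemma le_threshold {R : realType} (a : R) j : 1 < a -> a < 5 ->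
  (a <= threshold j) = (ln 2 / ln (5 / a) <= j.+1%:R).
Proof.
move=> a1 a5; have a0 : 0 < a := lt_trans ltr01 a1.
have t1 : 1 < 5 / a by rewrite ltr_pdivlMr// mul1r.
have t0 : 0 < 5 / a := lt_trans ltr01 t1.
have l0 : 0 < ln (5 / a) by rewrite ln_gt0.
have j0 : 0 < j.+1%:R :> R by rewrite ltr0n.
have p0 : 0 < (2 : R) `^ j.+1%:R^-1 by rewrite powR_gt0.
rewrite /threshold ler_pdivlMr// ler_pdivrMr// mulrC -ler_pdivlMr//.
by rewrite -ler_ln ?posrE// ln_powR mulrC ler_pdivrMr// mulrC.
Qed.

Lemma threshold_le {R : realType} (a : R) j : 1 < a -> a < 5 ->
  (threshold j <= a) = (j.+1%:R <= ln 2 / ln (5 / a)).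
Proof.
move=> a1 a5; have a0 : 0 < a := lt_trans ltr01 a1.
have t1 : 1 < 5 / a by rewrite ltr_pdivlMr// mul1r.
have t0 : 0 < 5 / a := lt_trans ltr01 t1.
have l0 : 0 < ln (5 / a) by rewrite ln_gt0.
have j0 : 0 < j.+1%:R :> R by rewrite ltr0n.
have p0 : 0 < (2 : R) `^ j.+1%:R^-1 by rewrite powR_gt0.
rewrite /threshold ler_pdivrMr// ler_pdivlMr// [a * _]mulrC -ler_pdivrMr//.
by rewrite -ler_ln ?posrE// ln_powR [_ * ln 2]mulrC ler_pdivlMr// mulrC.
Qed.

Lemma dim_remainder_small {R : realType} (a : R) (b c : nat -> R) k : 5 <= a -> ifs_osc a b ->
  (forall i, (0 < i <= k)%N -> c i = coef_rhs a (ln 2 / ln 5) c i) ->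
  exists C h : R, [/\ 0 <= C, 0 < h & forall eps, 0 < eps -> eps <= h ->
    `|dim_limit_set a b eps - (ln 2 / ln 5 + (seq_poly c k).[eps])| <= C * eps ^+ k.+1].
Proof.
move=> a5 hb hc; have a1 : 1 < a by apply: lt_le_trans a5; rewrite ltr1n.
have a0 : 0 < a := lt_trans ltr01 a1.
have hk v : (v <= k)%N -> (5 / a) ^+ v < 2.
  move=> _; apply: (@le_lt_trans _ _ 1); last by rewrite ltr1n.
  by apply: exprn_ile1; [rewrite divr_ge0// ltW|rewrite ler_pdivrMr// mul1r].
have [C [h1 [C0 h10 h11 H]]] := press_main_estimate _ _ _ a1 hk hc.
have [C' [h2 [C'0 h20 H']]] := press_rem_small a k a5.
pose d := Num.min h1 h2; have d0 : 0 < d by rewrite lt_min h10.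
have d1 : d <= h1 by rewrite ge_min lexx.
have d2 : d <= h2 by rewrite ge_min lexx orbT.
have [h3 h30 H3] := dim_limit_set_near _ _ a1 hb _ d0.
pose h := Num.min h1 h3.
exists ((C' + C) / ln 5), h; split.
- by rewrite divr_ge0 ?addr_ge0// ltW// ln5_gt0.
- by rewrite lt_min h10.
move=> eps e0 eh.
have e1 : eps <= h1 by apply: le_trans eh _; rewrite ge_min lexx.
have e3 : eps <= h3 by apply: le_trans eh _; rewrite ge_min lexx orbT.
have [u /andP[u0 ud] [-> hu]] := H3 eps (ltac:(by rewrite (ltW e0))).
have [X hX Xle] := H eps u (ltac:(by rewrite (ltW e0))) (ltac:(by rewrite u0 (le_trans ud))) hu.
have := H' eps u X (ltW e0) (ltac:(by rewrite u0 (le_trans ud))) hX.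
rewrite opprD addrACA subrr add0r.
set D := u - _ in Xle *; move=> X2.
rewrite mulrAC ler_pdivlMr ?ln5_gt0//.
have := ler_normB X (X - 2 * ln 5 * D).
have -> : X - (X - 2 * ln 5 * D) = 2 * ln 5 * D by ring.
rewrite (normrM (2 * ln 5)) (@ger0_norm _ (2 * ln 5)); last by rewrite mulr_ge0// ltW// ln5_gt0.
have -> : (C' + C) * eps ^+ k.+1 = C' * eps ^+ k.+1 + C * eps ^+ k.+1 by ring.
lra.
Qed.

(** The summands ((5 / a)^(k+1) / 2)^e eps^(k+1) are nondecreasing in e and at least eps^(k+1). The
    last one lies between the lower bound in the second claim and 2^-M. *)
Lemma head_sum_bounds {R : realType} (a eps : R) k M : 1 < 5 / a -> 2 <= (5 / a) ^+ k.+1 ->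
  0 < eps -> scale a eps M -> (0 < M)%N ->
  [/\ M%:R * eps ^+ k.+1 <= head_sum a k eps M,
      2^-1 ^+ M / (5 / a) ^+ k.+1 <= head_sum a k eps M &
      head_sum a k eps M <= M%:R * 2^-1 ^+ M].
Proof.
move=> t1 t2 e0 /andP[sM1 sM2] M0; have t0 : 0 < 5 / a := lt_trans ltr01 t1.
rewrite /head_sum; set th := 5 / a in t0 t1 t2 sM1 sM2 *; clearbody th.
have h2 e : 0 < 2^-1 ^+ e :> R by rewrite exprn_gt0// invr_gt0.
have e0' : 0 <= eps ^+ k.+1 by rewrite exprn_ge0// ltW.
have termE e : 2^-1 ^+ e * (th ^+ e * eps) ^+ k.+1 = (th ^+ k.+1 / 2) ^+ e * eps ^+ k.+1.
  by rewrite !exprMn -!exprM [(k.+1 * e)%N]mulnC; ring.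
have q1 : 1 <= th ^+ k.+1 / 2 by rewrite ler_pdivlMr// mul1r.
have yM : 0 <= th ^+ M * eps by rewrite mulr_ge0 ?exprn_ge0// ltW.
have cst (x : R) : \sum_(1 <= e < M.+1) x = M%:R * x.
  by rewrite sumr_const_nat subn1 mulr_natl.
split.
- rewrite -cst; apply: ler_sum => e _; rewrite termE ler_peMl// exprn_ege1//.
- rewrite big_nat_recr//=.
  apply: (@le_trans _ _ (2^-1 ^+ M * (th ^+ M * eps) ^+ k.+1)); last first.
    rewrite lerDr sumr_ge0// => e _; apply: mulr_ge0; first exact: ltW (h2 e).
    by rewrite exprn_ge0// mulr_ge0 ?exprn_ge0// ltW.
  rewrite ler_wpM2l ?(ltW (h2 M))// -exprVn; apply: lerXn2r; rewrite ?nnegrE ?invr_ge0 ?(ltW t0)//.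
  by rewrite -[leLHS]mul1r ler_pdivrMr// mulrC mulrA -exprS ltW.
- rewrite -cst; apply: ler_sum_nat => e /andP[_ eM]; rewrite termE.
  apply: (@le_trans _ _ ((th ^+ k.+1 / 2) ^+ M * eps ^+ k.+1)).
    by rewrite ler_wpM2r// ler_weXn2l.
  by rewrite -termE ler_piMr ?(ltW (h2 M))// exprn_ile1.
Qed.

Lemma scale_logs {R : realType} (a eps : R) M : 1 < 5 / a -> 0 < eps -> scale a eps M ->
  M%:R * ln (5 / a) <= - ln eps <= M.+1%:R * ln (5 / a).
Proof.
move=> t1 e0 /andP[s1 s2]; have t0 : 0 < 5 / a := lt_trans ltr01 t1.
have lnE n : n%:R * ln (5 / a) + ln eps = ln ((5 / a) ^+ n * eps).
  by rewrite [in RHS]lnM ?posrE ?exprn_gt0// lnXn// mulr_natl.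
have h1 : ln ((5 / a) ^+ M * eps) <= 0 by rewrite ln_le0.
have h2 : 0 <= ln ((5 / a) ^+ M.+1 * eps) by rewrite ln_ge0// ltW.
move: h1 h2; rewrite -!lnE => h1 h2; apply/andP; split; lra.
Qed.

(** By the choice of M, eps lies between consecutive powers of a / 5, and raising 5 / a to ln 2 / ln
    (5 / a) gives 2. *)
Lemma scale_powR {R : realType} (a eps : R) M : 1 < 5 / a -> 0 < eps -> scale a eps M ->
  eps `^ (ln 2 / ln (5 / a)) <= 2^-1 ^+ M <= 2 * eps `^ (ln 2 / ln (5 / a)).
Proof.
move=> t1 e0 sM; have /andP[h1 h2] := scale_logs _ _ _ t1 e0 sM.
have l0 : 0 < ln (5 / a) by rewrite ln_gt0.
have ln20 : 0 < ln 2 :> R by rewrite ln_gt0// ltr1n.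
set D := ln 2 / _; have D0 : 0 < D by rewrite divr_gt0.
have DE : D * ln (5 / a) = ln 2 by rewrite divfK// gt_eqF.
have -> : 2^-1 ^+ M = expR (- (M%:R * ln 2)) :> R.
  by rewrite expRN expRM_natl lnK ?posrE// exprVn.
have -> : 2 * eps `^ D = expR (ln 2 + D * ln eps) by rewrite expRD lnK ?posrE// /powR gt_eqF.
rewrite /powR gt_eqF// !ler_expR -DE.
have e1 : D * (M%:R * ln (5 / a)) <= D * (- ln eps) by rewrite ler_pM2l.
have e2 : D * (- ln eps) <= D * (M.+1%:R * ln (5 / a)) by rewrite ler_pM2l.
rewrite -natr1 in e2; apply/andP; split; lra.
Qed.

(** The terms grow geometrically with ratio (5 / a)^(k+1) / 2 > 1, so the sum is a constant times
    its last term, which is at most 2^-M. *)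
Lemma head_sum_subcritical {R : realType} (a eps : R) k M : 1 < 5 / a -> 2 < (5 / a) ^+ k.+1 ->
  0 < eps -> scale a eps M ->
  head_sum a k eps M <= (5 / a) ^+ k.+1 / ((5 / a) ^+ k.+1 - 2) * 2^-1 ^+ M.
Proof.
move=> t1 t2 e0 /andP[sM1 sM2]; have t0 : 0 < 5 / a := lt_trans ltr01 t1.
rewrite /head_sum; set th := 5 / a in t0 t1 t2 sM1 sM2 *; clearbody th.
pose q := th ^+ k.+1 / 2.
have q1 : 1 < q by rewrite ltr_pdivlMr// mul1r.
have termE e : 2^-1 ^+ e * (th ^+ e * eps) ^+ k.+1 = q ^+ e * eps ^+ k.+1.
  by rewrite /q !exprMn -!exprM [(k.+1 * e)%N]mulnC; ring.
have -> : th ^+ k.+1 / (th ^+ k.+1 - 2) = q / (q - 1).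
  by rewrite /q; field; rewrite gt_eqF ?subr_gt0.
have yM : q ^+ M * eps ^+ k.+1 <= 2^-1 ^+ M.
  rewrite -termE ler_piMr ?exprn_ge0 ?invr_ge0// exprn_ile1//.
  by rewrite mulr_ge0 ?exprn_ge0// ltW.
have -> : \sum_(1 <= e < M.+1) 2^-1 ^+ e * (th ^+ e * eps) ^+ k.+1 =
    q * (\sum_(i < M) q ^+ i) * eps ^+ k.+1.
  rewrite big_add1 /= big_mkord mulr_sumr mulr_suml; apply: eq_bigr => i _.
  by rewrite termE exprS.
have e0' : 0 <= eps ^+ k.+1 by rewrite exprn_ge0// ltW.
clearbody q.
rewrite -mulrA -[leRHS]mulrA ler_pM2l; last lra.
rewrite mulrC -[leRHS]mulrC ler_pdivlMr ?subr_gt0//.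
have := subrX1 q M; set S := \sum_(i < M) _ => SE.
have -> : eps ^+ k.+1 * S * (q - 1) = eps ^+ k.+1 * (q ^+ M - 1) by rewrite SE; ring.
apply: le_trans yM; rewrite mulrC ler_wpM2r//; lra.
Qed.

Lemma head_sum_critical {R : realType} (a eps : R) k M : (5 / a) ^+ k.+1 = 2 ->
  head_sum a k eps M = M%:R * eps ^+ k.+1.
Proof.
move=> t2; rewrite /head_sum (eq_bigr (fun=> eps ^+ k.+1)).
  by rewrite sumr_const_nat subn1 mulr_natl.
move=> e _; rewrite [(_ * eps) ^+ _]exprMn -exprM mulnC exprM t2 mulrA -exprMn.
by rewrite mulVf// expr1n mul1r.
Qed.

Lemma dim_remainder_head_sum {R : realType} (a : R) (b c : nat -> R) k : 1 < a -> a < 5 ->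
  ifs_osc a b -> k%:R < ln 2 / ln (5 / a) -> ln 2 / ln (5 / a) <= k.+1%:R ->
  (forall i, (0 < i <= k)%N -> c i = coef_rhs a (ln 2 / ln 5) c i) ->
  exists c1 c2 h : R, [/\ 0 < c1, 0 < h & forall eps, 0 < eps -> eps <= h ->
    exists M, [/\ (0 < M)%N, scale a eps M &
     c1 * head_sum a k eps M
       <= `|dim_limit_set a b eps - (ln 2 / ln 5 + (seq_poly c k).[eps])|
       <= c2 * head_sum a k eps M]].
Proof.
move=> a1 a5 hb kD Dk hc; have a0 : 0 < a := lt_trans ltr01 a1.
have t1 : 1 < 5 / a by rewrite ltr_pdivlMr// mul1r.
have t0 : 0 < 5 / a := lt_trans ltr01 t1.
have lt0 : 0 < ln (5 / a) by rewrite ln_gt0.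
have /andP[s0 s1] := @dim0_bounds R.
have hk v : (v <= k)%N -> (5 / a) ^+ v < 2.
  by move=> vk; rewrite log_ratio_exp// (le_lt_trans _ kD)// ler_nat.
have t2 : 2 <= (5 / a) ^+ k.+1 by rewrite leNgt log_ratio_exp// -leNgt.
(* The critical exponent exceeds k by hypothesis and s0 because 5 / a < 5; kap is the midpoint
   between it and the larger of the two. *)
have [kap [kk skap zk]] : exists kap, [/\ k%:R <= kap, ln 2 / ln 5 < kap & (5 / a) `^ kap < 2].
  have sD : ln 2 / ln 5 < ln 2 / ln (5 / a).
    rewrite ltr_pM2l ?ln_gt0 ?ltr1n// ltf_pV2 ?posrE ?ln5_gt0//.
    by rewrite ltr_ln ?posrE// ltr_pdivrMr// ltr_pMr.
  set D := ln 2 / ln (5 / a) in sD kD.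
  pose m := Num.max k%:R (ln 2 / ln 5 : R).
  have mD : m < D by rewrite gt_max kD.
  have km : k%:R <= m by rewrite le_max lexx.
  have sm : ln 2 / ln 5 <= m by rewrite le_max lexx orbT.
  exists ((m + D) / 2); split; [lra|lra|].
  rewrite /powR gt_eqF// -[ltRHS]lnK ?posrE// ltr_expR -ltr_pdivlMr// -/D; lra.
have d0 : 0 < kap - ln 2 / ln 5 by lra.
have [C [h1 [C0 h10 h11 H]]] := press_main_estimate _ _ _ a1 hk hc.
have sk : ln 2 / ln 5 + (kap - ln 2 / ln 5) <= kap by lra.
have [C' [h2 [C'0 h20 H']]] := press_rem_upper a kap _ k t1 d0 kk sk zk.
have [c' [h3 [c'0 h30 H'']]] := press_rem_lower a k t1.
have [C4 C40 h4] := seq_poly_linear_bound c k.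
have half01 : 0 < (2^-1 : R) < 1 by rewrite invr_gt0 invf_lt1 ?ltr1n ?ltr0n.
have [l2 hl2 l20] := sums_pow_geo 2 _ half01.
have inv01 : 0 < (5 / a)^-1 < 1 by rewrite invr_gt0 t0 invf_lt1.
have [l1 hl1 l10] := sums_pow_geo 1 _ inv01.
have ln5 := @ln5_gt0 R.
pose K1 := C' * (1 + (5 / a) ^+ k.+1); pose K2 := (K1 + C) / ln 5.
have tk : 0 < (5 / a) ^+ k.+1 by rewrite exprn_gt0.
have K10 : 0 <= K1 by rewrite mulr_ge0// addr_ge0// ltW.
have K20 : 0 <= K2 by rewrite divr_ge0 ?addr_ge0// ltW.
(* A bound for M u: M^2 2^-M and M (5 / a)^-M are terms of the convergent series with sums l2 and
   l1. *)
pose B := K2 * l2 + C4 * l1.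
pose c3 := c' * expR (- (B * ln 5)); have c30 : 0 < c3 by rewrite mulr_gt0// expR_gt0.
(* For M >= N the error C eps^(k+1) is at most half of the lower bound c3 M eps^(k+1). *)
have [N hN] : exists N : nat, 2 * C / c3 <= N%:R.
  by exists (Num.truncn (2 * C / c3)).+1; apply/ltW; apply: truncnS_gt.
pose d := Num.min h1 (Num.min h2 h3); have d00 : 0 < d by rewrite !lt_min h10 h20.
have d1 : d <= h1 by rewrite ge_min lexx.
have d2 : d <= h2 by rewrite !ge_min lexx orbT.
have d3 : d <= h3 by rewrite !ge_min lexx !orbT.
have [hd hd0 Hd] := dim_limit_set_near _ _ a1 hb _ d00.
pose h := Num.min h1 (Num.min hd (((5 / a) ^+ N.+1)^-1)).
(* From c3 G <= |X| <= 3 ln 5 |Dl| + C eps^(k+1), where the last term takes at most half of the left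
   side. *)
exists (c3 / (6 * ln 5)), K2, h; split.
- by rewrite divr_gt0// mulr_gt0.
- by rewrite !lt_min h10 hd0 invr_gt0 exprn_gt0.
move=> eps e0 eh.
have e1 : eps <= h1 by apply: le_trans eh _; rewrite ge_min lexx.
have ed : eps <= hd by apply: le_trans eh _; rewrite !ge_min lexx orbT.
have eN : (5 / a) ^+ N.+1 * eps <= 1.
  rewrite mulrC -ler_pdivlMr ?exprn_gt0// div1r.
  by apply: le_trans eh _; rewrite !ge_min lexx !orbT.
have eps01 : 0 < eps <= 1 by rewrite e0 (le_trans e1).
have [M sM MN] := scale_exists a eps t1 eps01.
have NM := MN _ eN; have M0 : (0 < M)%N by apply: leq_trans NM.
exists M; split => //.
have [u /andP[u0 ud] [-> hu]] := Hd eps (ltac:(by rewrite (ltW e0))).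
have [X hX Xle] := H eps u (ltac:(by rewrite (ltW e0))) (ltac:(by rewrite u0 (le_trans ud))) hu.
have Xup := H' eps u X M e0 (ltac:(by rewrite u0 (le_trans ud))) sM hX.
have Xlo := H'' eps u X M B e0 (ltac:(by rewrite u0 (le_trans ud))) sM.
have [G1 G2 G3] := head_sum_bounds _ _ _ _ t1 t2 e0 sM M0.
have wle := h4 eps (ltac:(by rewrite (ltW e0) (le_trans e1))).
rewrite opprD addrACA subrr add0r.
set w := (seq_poly c k).[eps] in Xle wle *; set G := head_sum a k eps M in Xup Xlo G1 G2 G3 *.
set Dl := u - w in Xle *.
have G0 : 0 <= G by apply: le_trans G1; rewrite mulr_ge0// exprn_ge0// ltW.
have M1 : 1 <= M%:R :> R by rewrite ler1n.
have ek : 0 <= eps ^+ k.+1 by rewrite exprn_ge0// ltW.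
have eG : eps ^+ k.+1 <= G by apply: le_trans G1; rewrite ler_peMl.
have XG : `|X| <= K1 * G.
  apply: le_trans Xup _; rewrite /K1 -mulrA ler_wpM2l// mulrDl mul1r lerD2l.
  by rewrite mulrC -ler_pdivrMr.
have CG : C * eps ^+ k.+1 <= C * G by rewrite ler_wpM2l.
have nD : `|2 * ln 5 * Dl| = 2 * ln 5 * `|Dl|.
  by rewrite normrM ger0_norm// mulr_ge0// ltW.
have up : `|Dl| <= K2 * G.
  rewrite /K2 mulrAC ler_pdivlMr//.
  have := ler_normB X (X - 2 * ln 5 * Dl).
  have -> : X - (X - 2 * ln 5 * Dl) = 2 * ln 5 * Dl by ring.
  have -> : (K1 + C) * G = K1 * G + C * G by ring.
  clear -nD XG CG Xle; lra.
rewrite up andbT.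
(* The bootstrap: the bound [up], proved without any lower estimate, controls u well enough for the
   lower estimate to apply. *)
have MB : M%:R * u <= B.
  have uw : u <= K2 * G + C4 * eps.
    have : u <= `|Dl| + `|w| by rewrite -[leLHS](ger0_norm u0) -[X in `|X|](subrK w) ler_normD.
    clear -wle up; lra.
  apply: (@le_trans _ _ (M%:R * (K2 * G + C4 * eps))); first by rewrite ler_wpM2l.
  rewrite mulrDr ![M%:R * (_ * _)]mulrCA; apply: lerD; apply: ler_wpM2l => //.
    apply: (@le_trans _ _ (M%:R * (M%:R * 2^-1 ^+ M))); first by rewrite ler_wpM2l.
    rewrite mulrA -expr2; apply: sums_ge_term hl2 M0 => e _.
    by rewrite mulr_ge0 ?exprn_ge0 ?invr_ge0.
  apply: (@le_trans _ _ (M%:R ^+ 1 * (5 / a)^-1 ^+ M)).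
    rewrite expr1 ler_wpM2l// exprVn -[leRHS]mul1r ler_pdivlMr ?exprn_gt0// mulrC.
    by have /andP[] := sM.
  apply: sums_ge_term hl1 M0 => e _.
  by rewrite mulr_ge0 ?exprn_ge0 ?invr_ge0// ltW.
have lo := Xlo MB hX; rewrite -/c3 in lo.
have Ce : C * eps ^+ k.+1 <= c3 / 2 * G.
  apply: (@le_trans _ _ (c3 / 2 * (M%:R * eps ^+ k.+1))); last first.
    by rewrite ler_wpM2l// divr_ge0// ltW.
  rewrite mulrA ler_wpM2r//.
  have : 2 * C / c3 <= M%:R by apply: le_trans hN _; rewrite ler_nat (leq_trans _ NM).
  rewrite ler_pdivrMr// mulrC; clear; lra.
have := ler_normD (X - 2 * ln 5 * Dl) (2 * ln 5 * Dl); rewrite subrK nD => N1.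
rewrite mulrAC ler_pdivrMr ?mulr_gt0//; clear -N1 lo Ce Xle; lra.
Qed.

Theorem theorem2p6 (R : realType) (a : R) (b : nat -> R)
    (ha : 1 < a) (hb : ifs_osc a b) :
  let s := dim_limit_set a b in
  [/\ s 0 = ln 2 / ln 5,
      5 <= a ->
        exists2 c : nat -> R,
          forall k : nat, (0 < k)%N -> c k = coef_rhs a (s 0) c k &
          forall n : nat, exists2 r : R -> R,
            r eps @[eps --> 0^'+] --> (0 : R) &
            \forall eps \near 0^'+,
              s eps = ln 2 / ln 5 + \sum_(1 <= i < n.+1) c i * eps ^+ i
                      + r eps * eps ^+ n &
      a < 5 ->
        exists k : nat,
          [/\ a <= threshold k /\ (forall j : nat, a <= threshold j -> (k <= j)%N),
              k%:R < ln 2 / ln (5 / a) <= k.+1%:R &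
              exists2 c : nat -> R,
                forall i : nat, (0 < i <= k)%N -> c i = coef_rhs a (s 0) c i &
                exists2 r : R -> R,
                  asymp (fun eps => `|r eps|) (fun _ => 1) &
                  (a < threshold k ->
                     \forall eps \near 0^'+,
                       s eps = s 0 + \sum_(1 <= i < k.+1) c i * eps ^+ i
                               + r eps * eps `^ (ln 2 / ln (5 / a))) /\
                  (a = threshold k ->
                     \forall eps \near 0^'+,
                       s eps = s 0 + \sum_(1 <= i < k.+1) c i * eps ^+ i
                               + r eps * (eps ^+ k.+1 * ln eps))]].
Proof.
move=> s; have s0E : s 0 = ln 2 / ln 5 by exact: dim_limit_set_at0.
have [c hc] := coef_rhs_sequence a (ln 2 / ln 5).
rewrite s0E; split => // [a5|a5].
  exists c => // n.
  have [C [h [C0 h0 H]]] := dim_remainder_small _ _ c n a5 hb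
    (fun i hi => hc i (proj1 (andP hi))).
  exists (fun eps => (s eps - (ln 2 / ln 5 + \sum_(1 <= i < n.+1) c i * eps ^+ i)) / eps ^+ n).
    apply/cvgrPdist_le => e e0.
    have C1 : 0 < C + 1 by rewrite ltr_wpDl.
    apply: (near_right0 (Num.min h (e / (C + 1)))).
      by rewrite lt_min h0 divr_gt0.
    move=> eps eps0; rewrite le_min => /andP[eh ee].
    rewrite sub0r normrN normrM normfV (@ger0_norm _ (eps ^+ n)) ?exprn_ge0 ?(ltW eps0)//.
    rewrite ler_pdivrMr ?exprn_gt0// -horner_seq_poly.
    apply: le_trans (H eps eps0 eh) _; rewrite exprS mulrA ler_wpM2r ?exprn_ge0 ?(ltW eps0)//.
    move: ee; rewrite ler_pdivlMr// mulrC => ee; apply: le_trans ee.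
    by rewrite ler_wpM2r ?(ltW eps0)// lerDl.
  apply: (near_right0 1) => // eps e0 _.
  by rewrite divfK ?expf_neq0 ?gt_eqF// addrC subrK.
have a0 : 0 < a := lt_trans ltr01 ha.
have t1 : 1 < 5 / a by rewrite ltr_pdivlMr// mul1r.
have t0 : 0 < 5 / a := lt_trans ltr01 t1.
have l0 : 0 < ln (5 / a) by rewrite ln_gt0.
have D0 : 0 < ln 2 / ln (5 / a) by rewrite divr_gt0// ln_gt0// ltr1n.
(* The condition on the threshold is used in this equivalent form; minimality gives k below the
   exponent, for k = 0 because the exponent is positive. *)
have exk : exists j, ln 2 / ln (5 / a) <= j.+1%:R.
  by exists (Num.truncn (ln 2 / ln (5 / a))); apply/ltW; exact: truncnS_gt.
case: (ex_minnP exk) => k kle kmin.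
have klt : k%:R < ln 2 / ln (5 / a).
  case: k kle kmin => [|k] _ kmin //.
  by rewrite ltNge; apply/negP => /kmin; rewrite ltnn.
have [c1 [c2 [h [c10 h0 H]]]] := dim_remainder_head_sum _ _ c k ha a5 hb klt kle
  (fun i hi => hc i (proj1 (andP hi))).
exists k; split.
- by rewrite le_threshold//; split => // j; rewrite le_threshold//; exact: kmin.
- by rewrite klt.
exists c => [i /andP[i0 _]|]; first exact: hc.
pose rem eps := s eps - (ln 2 / ln 5 + \sum_(1 <= i < k.+1) c i * eps ^+ i).
have remE eps x y : y != 0 -> x = rem eps / y ->
    s eps = ln 2 / ln 5 + \sum_(1 <= i < k.+1) c i * eps ^+ i + x * y.
  by move=> y0 ->; rewrite divfK// /rem addrC subrK.
have t2 : 2 <= (5 / a) ^+ k.+1 by rewrite leNgt log_ratio_exp// -leNgt.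
(* The sign is read off the two-sided estimate at eps = h, where the head sum is positive. *)
have c20 : 0 <= c2.
  have [M [M0 sM /andP[H1 H2]]] := H h h0 (lexx h).
  have [_ G _] := head_sum_bounds _ _ _ _ t1 t2 h0 sM M0.
  have Gp : 0 < head_sum a k h M.
    by apply: lt_le_trans G; rewrite divr_gt0 ?exprn_gt0 ?invr_gt0.
  by rewrite -(pmulr_lge0 _ Gp); apply: le_trans H2; exact: normr_ge0.
have [alt|age] := ltrP a (threshold k).
  have Dlt : ln 2 / ln (5 / a) < k.+1%:R by rewrite ltNge -threshold_le// -ltNge.
  have t2' : 2 < (5 / a) ^+ k.+1 by rewrite ltNge le_log_ratio_exp// -ltNge.
  exists (fun eps => rem eps / eps `^ (ln 2 / ln (5 / a))).
    pose K := (5 / a) ^+ k.+1 / ((5 / a) ^+ k.+1 - 2).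
    apply: (asymp_one _ (c1 / (5 / a) ^+ k.+1) (c2 * (K * 2)) h) => //.
      by rewrite divr_gt0// exprn_gt0.
    move=> eps e0 eh; have [M [M0 sM /andP[H1 H2]]] := H eps e0 eh.
    have [_ G2 _] := head_sum_bounds _ _ _ _ t1 t2 e0 sM M0.
    have G4 := head_sum_subcritical _ _ _ _ t1 t2' e0 sM.
    have /andP[P1 P2] := scale_powR _ _ _ t1 e0 sM.
    have ep : 0 < eps `^ (ln 2 / ln (5 / a)) by rewrite powR_gt0.
    have K0 : 0 <= K by rewrite divr_ge0 ?exprn_ge0 ?subr_ge0 ?(ltW t0)// ltW.
    rewrite normrM normfV (gtr0_norm ep) ler_pdivlMr// ler_pdivrMr// /rem -horner_seq_poly.
    apply/andP; split.
      apply: le_trans H1; rewrite -mulrA ler_pM2l//; apply: le_trans G2.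
      by rewrite mulrC ler_wpM2r// invr_ge0 exprn_ge0// ltW.
    apply: le_trans H2 _; rewrite -mulrA ler_wpM2l//; apply: le_trans G4 _.
    by rewrite -/K -[leRHS]mulrA ler_wpM2l.
  split => [_|aE]; last by move: alt; rewrite -aE ltxx.
  by apply: (near_right0 1) => // eps e0 _; apply: remE => //; rewrite gt_eqF// powR_gt0.
have DE : ln 2 / ln (5 / a) = k.+1%:R.
  by apply/eqP; rewrite eq_le kle -threshold_le.
have t2' : (5 / a) ^+ k.+1 = 2.
  by apply/eqP; rewrite eq_le t2 le_log_ratio_exp// DE lexx.
(* Below 1/2 the logarithm is negative, so the divisor eps^(k+1) ln eps does not vanish. *)
pose h' := Num.min h (1 / 2); have h'0 : 0 < h' by rewrite lt_min h0 divr_gt0.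
have lnlt eps : 0 < eps -> eps <= h' -> ln eps < 0.
  move=> e0 eh; apply: ln_lt0; rewrite e0 /=.
  have : h' <= 1 / 2 by rewrite ge_min lexx orbT.
  lra.
exists (fun eps => rem eps / (eps ^+ k.+1 * ln eps)).
  apply: (asymp_one _ (c1 / (2 * ln (5 / a))) (c2 / ln (5 / a)) h') => //.
    by rewrite divr_gt0// mulr_gt0.
  move=> eps e0 eh; have eh' : eps <= h by apply: le_trans eh _; rewrite ge_min lexx.
  have ln0 := lnlt eps e0 eh.
  have [M [M0 sM /andP[H1 H2]]] := H eps e0 eh'.
  rewrite head_sum_critical// in H1 H2.
  have /andP[L1 L2] := scale_logs _ _ _ t1 e0 sM.
  have ek : 0 < eps ^+ k.+1 by rewrite exprn_gt0.
  have ep : 0 < eps ^+ k.+1 * - ln eps by rewrite mulr_gt0// oppr_gt0.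
  rewrite normrM normfV [`|_ * ln eps|]normrM (gtr0_norm ek) (ltr0_norm ln0).
  rewrite ler_pdivlMr// ler_pdivrMr// /rem -horner_seq_poly.
  apply/andP; split.
    apply: le_trans H1; rewrite -mulrA ler_pM2l// mulrCA mulrC ler_pM2r//.
    rewrite ler_pdivrMl ?mulr_gt0//; apply: le_trans L2 _.
    (* As M >= 1, |ln eps| is at most 2 M ln (5 / a), which is the origin of the factor 2 in the
       lower constant. *)
    have : M.+1%:R <= 2 * M%:R :> R by rewrite -natrM ler_nat mul2n -addnn -addn1 leq_add2l.
    by rewrite -(ler_pM2r l0) mulrAC.
  apply: le_trans H2 _; rewrite -mulrA ler_wpM2l// mulrCA mulrC ler_pM2l//.
  by rewrite ler_pdivlMl// mulrC.
split => // _.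
apply: (near_right0 h') => // eps e0 eh; apply: remE => //.
by apply: mulf_neq0; [rewrite expf_neq0// gt_eqF|rewrite lt_eqF// lnlt].
Qed.
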